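(* Let $k'$ be a local field, $k=k'\times k'$ (the split case) with $\tau$ the involution exchanging the two factors, and let $n=m+2r+1$ be odd. Then smooth matching holds, i.e., with the notation of the context: for every smooth compactly supported function $F$ on $\mathrm S_n(k')$ there exist smooth compactly supported functions $f^\beta$ on $\mathrm U_n^\beta(k')$, one for each $\beta\in[\mathrm{Her}_m(k/k')^\times]$, such that $$\mathcal O(F,\zeta)=\mathbf t(\zeta)\,\mathcal O(f^\beta,\zeta^\beta)$$ for all $\zeta\in[\mathrm S_n(k')_{\mathrm{reg}}]/\mathbf H(k')$ and all $\zeta^\beta$ matching $\zeta$; conversely, for any smooth compactly supported functions $f^\beta$ on $\mathrm U_n^\beta(k')$, one for each $\beta\in[\mathrm{Her}_m(k/k')^\times]$, there exists a smooth compactly supported function $F$ on $\mathrm S_n(k')$ such that the same identity holds.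
   Context: ${}^{\mathrm t}g$ is the transpose and $t^{\tau,-1}=(t^\tau)^{-1}$. $\mathrm{Her}_m(k/k')^\times=\{\beta\in\mathrm{GL}_m(k):{}^{\mathrm t}\beta^\tau=\beta\}$ and $[\mathrm{Her}_m(k/k')^\times]$ is its set of classes under $\beta\mapsto{}^{\mathrm t}g^\tau\beta g$, $g\in\mathrm{GL}_m(k)$ (choose a representative of each). Fix $\beta_0\in k'^\times$, put $\beta'=\mathrm{diag}(\beta,\beta_0)$. Fix an invertible $\jmath\in k$ with $\jmath^\tau=-\jmath$ and a nontrivial additive character $\psi'$ of $k'$; set $\psi(x)=\psi'(\jmath(x-x^\tau))$ for $x\in k$. Label the coordinates of $k^n$ by $v_1,\dots,v_r,w_1,\dots,w_m,w_0,\check v_r,\dots,\check v_1$, in this order. Groups. $\mathrm S_n(k')=\{s\in\mathrm{GL}_n(k):ss^\tau=\mathbf 1_n\}$. $\mathrm U_n^\beta(k')=\{g\in\mathrm{GL}_n(k):{}^{\mathrm t}g^\tau J_\beta g=J_\beta\}$, $J_\beta$ block-antidiagonal with blocks $w_r,\beta',w_r$ ($w_r$ the $r\times r$ antidiagonal permutation matrix); $\mathrm U^\beta_{m+1},\mathrm U^\beta_m$ are the unitary groups of $\beta',\beta$, with $\mathrm U_m^\beta\subset\mathrm U_n^\beta$ acting on the coordinates $w_1,\dots,w_m$. $U_{1^r,m+1,1^r}\subset\mathrm{GL}_n$ is the unipotent radical of the standard block upper triangular parabolic with blocks $1^r,m+1,1^r$. $U'_{1^r,m+1}\subset\mathrm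 U_n^\beta$ is the unipotent radical of the parabolic stabilizing $\langle v_1\rangle\subset\cdots\subset\langle v_1,\dots,v_r\rangle$, i.e. $\mathrm U_n^\beta\cap U_{1^r,m+1,1^r}(k)$. $\mathrm{GL}_m\subset\mathrm{GL}_n$ acts on $w_1,\dots,w_m$. $\mathbf H(k')=U_{1^r,m+1,1^r}(k)\rtimes\mathrm{GL}_m(k')$ acts on $\mathrm S_n(k')$ by $s\mapsto g^{-1}u^{-1}su^\tau g$; $\mathbf H^\beta(k')=\{(u_1g,u_2g):u_i\in U'_{1^r,m+1}(k'),\,g\in\mathrm U_m^\beta(k')\}$ acts on $\mathrm U_n^\beta(k')$ by $x\mapsto g^{-1}u_1^{-1}xu_2g$. $[\,\cdot\,]/\mathbf H(k')$ denotes the set of orbits. Regularity and matching. $\zeta$ in $\mathrm S_n(k')$ (resp. $\mathrm U_n^\beta(k')$) is pre-regular if its stabilizer under the action $u^{-1}\zeta u^\tau$ of $\mathrm{Res}_{k/k'}U_{1^r,m+1,1^r}$ (resp. $u_1^{-1}\zeta u_2$ of $(U'_{1^r,m+1})^2$) is trivial; then its orbit contains a unique element whose only nonzero entries are a central block $\mathrm{Pr}(\zeta)$ in the coordinates $w_1,\dots,w_m,w_0$, $t_i(\zeta)\in k^\times$ at $(v_i,\check v_i)$ and $t_i(\zeta)^{\tau,-1}$ at $(\check v_i,v_i)$, $1\le i\le r$. $\xi\in\mathrm M_{m+1}(k)$ is regular if it is regular semisimple, the $\xi^ie$ ($0\le i\le m$) span $k^{m+1}$ and the ${}^{\mathrm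 t}e\,\xi^i$ ($0\le i\le m$) span $\mathrm M_{1,m+1}(k)$, $e={}^{\mathrm t}[0,\dots,0,1]$. $\zeta$ is regular if it is pre-regular with $\mathrm{Pr}(\zeta)$ regular (subscript reg). Regular $\zeta\in\mathrm S_n(k')$ and $\zeta^\beta\in\mathrm U^\beta_n(k')$ match if $t_i(\zeta)=t_i(\zeta^\beta)$ for all $i$ and $\mathrm{Pr}(\zeta)=g^{-1}\mathrm{Pr}(\zeta^\beta)g$ for some $g\in\mathrm{GL}_m(k)$ embedded as $\mathrm{diag}(g,1)$. Orbital integrals (Haar measures fixed). For $u\in U_{1^r,m+1,1^r}(k)$, $\underline\psi(u)=\psi\big(\sum_{i<r}u_{v_i,v_{i+1}}+u_{v_r,w_0}+\beta_0u_{w_0,\check v_r}+\sum_{i<r}u_{\check v_{i+1},\check v_i}\big)$; for $u'\in U'_{1^r,m+1}(k')$, $\underline{\psi'}(u')=\psi\big(\sum_{i<r}u'_{v_i,v_{i+1}}+u'_{v_r,w_0}\big)$ (both trivial if $r=0$). With $\eta$ the character of $k'^\times$ attached to $k/k'$ by class field theory (trivial in the present split case), $$\mathcal O(F,\zeta)=\int_{\mathrm{GL}_m(k')}\int_{U_{1^r,m+1,1^r}(k)}F(g^{-1}u^{-1}\zeta u^\tau g)\underline\psi(u^{-1})\eta(\det g)\,du\,dg,$$ $$\mathcal O(f^\beta,\zeta^\beta)=\int_{\mathrm U_m^\beta(k')}\iint_{(U'_{1^r,m+1}(k'))^2}f^\beta(g^{-1}u_1^{-1}\zeta^\beta u_2g)\underline{\psi'}(u_1^{-1}u_2)\,du_1\,du_2\,dg.$$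 The transfer factor, with $\zeta$ replaced by a representative in normal form, is $\mathbf t(\zeta)=\eta\big(\mathbf T_\zeta\cdot(\det\mathrm{Pr}(\zeta))^{-m/2}\big)$, where $\mathbf T_\zeta$ is the determinant of the $(m+1)\times(m+1)$ matrix whose $i$-th row consists of the coordinates of ${}^{\mathrm t}e\,\mathrm{Pr}(\zeta)^{i-1}$ in the order $w_0,w_1,\dots,w_m$; since $\eta$ is trivial here, $\mathbf t(\zeta)=1$.
   Formalization: The identity is stated for ζ and ζ^β in normal form (every regular orbit has such representatives): for r ≥ 1 the orbital integrals change by values of the character along unipotent orbits, so the identity fails for arbitrary matching representatives. *)

(* Defs.v *)
From HB Require Import structures.
From mathcomp Require Import all_boot all_order all_algebra all_field.
From mathcomp Require Import complex.
From mathcomp Require Import all_classical all_reals all_analysis.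
Import numFieldNormedType.Exports.
Set Implicit Arguments.
Unset Strict Implicit.
Unset Printing Implicit Defensive.
Import Order.TTheory GRing.Theory Num.Theory.
Local Open Scope classical_set_scope.
Local Open Scope ring_scope.
Local Open Scope complex_scope.

(* A field with a topology; no compatibility is assumed here, see
   [local_field]. *)
#[short(type="topFieldType")]
HB.structure Definition TopField := {K of GRing.Field K & Topological K}.

#[non_forgetful_inheritance]
HB.instance Definition _ (K : topFieldType) :=
  isPointed.Build (TopField.sort K) (0 : K).
HB.instance Definition _ (T : ptopologicalType) := Pointed.on (T * T)%type.

(* A local field: the topology comes from a nontrivial absolute value and is
   locally compact.  This covers the real and complex fields, the finite
   extensions of the p-adic numbers and the Laurent series fields over finite
   fields. *)
Definition local_field (R : realType) (K : topFieldType) : Prop :=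
  (exists v : K -> R,
    [/\ [/\ forall x, 0 <= v x,
            forall x, v x = 0 <-> x = 0,
            forall x y, v (x * y) = v x * v y &
            forall x y, v (x + y) <= v x + v y],
        exists2 x, x != 0 & v x != 1 &
        forall (x : K) (A : set K),
          nbhs x A <-> exists2 e : R, 0 < e & forall y, v (y - x) < e -> A y])
  /\ locally_compact [set: K].

Section Analysis.
Variables (R : realType) (K : topFieldType).

Definition additive_character (psi : K -> R[i]) : Prop :=
  [/\ forall x y, psi (x + y) = psi x * psi y,
      forall x, `|psi x| = 1,
      continuous (fun x => complex.Re (psi x)) &
      continuous (fun x => complex.Im (psi x))].

Variable n : nat.
Local Notation V := 'M[K * K]_n.

(* The functions of class C^p on V, regarded as a real vector space through an
   embedding [iota] of R in K: all iterated directional derivatives of order at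
   most p exist and are continuous. *)
Fixpoint Cclass (iota : R -> K) (p : nat) (f : V -> R) : Prop :=
  continuous f /\
  (if p is q.+1 then forall v : V,
     let line (x : V) (t : R) : R := f (x + (iota t, iota t) *: v) in
     (forall x, derivable (line x) 0 1) /\
     Cclass iota q (fun x => derive1 (line x) 0)
   else True).

(* A local field K is archimedean (isomorphic to the real or complex field) iff
   there is a continuous ring morphism from R to K, and the latter is then
   unique.  Smooth means C^oo in this case, and locally constant otherwise. *)
Definition smooth (f : V -> R[i]) : Prop :=
  (forall iota : {rmorphism R -> K}, continuous iota ->
     forall p, Cclass iota p (fun x => complex.Re (f x)) /\
               Cclass iota p (fun x => complex.Im (f x))) /\
  (~ (exists iota : {rmorphism R -> K}, continuous iota) ->
     forall x, \forall y \near x, f y = f x).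

(* Functions on a subset X of V: only the values on X matter. *)
Definition smooth_on (X : set V) (f : V -> R[i]) : Prop :=
  forall x, X x -> exists2 g, smooth g & \forall y \near x, X y -> f y = g y.

Definition compactly_supported_on (X : set V) (f : V -> R[i]) : Prop :=
  exists C : set V, [/\ compact C, C `<=` X &
                        forall x, X x -> ~ C x -> f x = 0].

Definition Cc_smooth (X : set V) (f : V -> R[i]) : Prop :=
  smooth_on X f /\ compactly_supported_on X f.

End Analysis.

Definition borel (T : ptopologicalType) := g_sigma_algebraType (@open T).

(* [mu] restricts to a (left) Haar measure on the locally closed subset [G] of
   [T], which is a group under [op]; the values of [mu] on sets not contained in
   [G] are irrelevant. *)
Definition haar_measure (R : realType) (T : ptopologicalType)
    (op : T -> T -> T) (G : set T) (mu : {measure set (borel T) -> \bar R}) :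
    Prop :=
  [/\ forall C : set T, compact C -> C `<=` G ->
        (mu (C : set (borel T)) < +oo)%E,
      forall O : set T, open O -> O `&` G !=set0 ->
        (0 < mu (O `&` G : set (borel T)))%E &
      forall (g : T) (A : set (borel T)), G g -> measurable A -> A `<=` G ->
        mu (op g @` A : set (borel T)) = mu A].

Definition Cintegral (R : realType) d (T : measurableType d)
    (mu : {measure set T -> \bar R}) (D : set T) (f : T -> R[i]) : R[i] :=
  Rintegral mu D (fun x => complex.Re (f x)) +i*
  Rintegral mu D (fun x => complex.Im (f x)).

Section SplitExtension.
(* k' = K and k = K * K with the product ring structure *)
Variable K : topFieldType.

Definition tau (x : K * K) : K * K := (x.2, x.1).
Definition diagk (x : K) : K * K := (x, x).

Definition taumx m n (A : 'M[K * K]_(m, n)) : 'M[K * K]_(m, n) := map_mx tau A.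

Definition Her m : set 'M[K * K]_m :=
  [set b | b \in unitmx /\ (taumx b)^T = b].

Definition Her_equiv m (b c : 'M[K * K]_m) : Prop :=
  exists2 g : 'M[K * K]_m, g \in unitmx & c = (taumx g)^T *m b *m g.

Definition Her_representatives m (B : set 'M[K * K]_m) : Prop :=
  B `<=` @Her m /\
  forall b, Her b -> exists! c, B c /\ Her_equiv b c.

Definition unitary_group m (J : 'M[K * K]_m) : set 'M[K * K]_m :=
  [set g | g \in unitmx /\ (taumx g)^T *m J *m g = J].

Definition GLset m : set 'M[K]_m := [set g | g \in unitmx].

Section RegularMatrices.
Variable m : nat.
Implicit Types xi : 'M[K * K]_(m + 1).

Definition evec : 'cV[K * K]_(m + 1) := col_mx 0 1%:M.

(* both components have pairwise distinct eigenvalues in an algebraic closure *)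
Definition regular_semisimple xi : Prop :=
  separable_poly (char_poly (map_mx fst xi)) /\
  separable_poly (char_poly (map_mx snd xi)).

Definition regular_mx xi : Prop :=
  [/\ regular_semisimple xi,
      forall x : 'cV[K * K]_(m + 1), exists c : 'I_(m.+1) -> K * K,
        x = \sum_(i < m.+1) c i *: (xi ^+ i *m evec) &
      forall x : 'rV[K * K]_(m + 1), exists c : 'I_(m.+1) -> K * K,
        x = \sum_(i < m.+1) c i *: (evec^T *m xi ^+ i)].

(* The i-th row holds the coordinates of e^T xi^i in the order
   w_0, w_1, ..., w_m. *)
Definition Tmx xi : 'M[K * K]_(1 + m) :=
  \matrix_(i < 1 + m)
    row_mx (rsubmx (evec^T *m xi ^+ i)) (lsubmx (evec^T *m xi ^+ i)).

End RegularMatrices.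

Section Coordinates.
Variables m r : nat.

(* Notation of the mathematics: ndim = n = m + 2r + 1, with coordinates
   v_1, ..., v_r, w_1, ..., w_m, w_0, \check v_r, ..., \check v_1;
   Urad = U_{1^r,m+1,1^r}(k), Sset = S_n(k'), Uset = U_n^beta(k'),
   Uprime = U'_{1^r,m+1}(k'). *)
Definition ndim := (r + ((m + 1) + r))%N.

Definition iv (i : 'I_r) : 'I_ndim := lshift (m + 1 + r) i.
Definition iw0 : 'I_ndim := rshift r (lshift r (rshift m ord0)).
Definition ivc (i : 'I_r) : 'I_ndim := rshift r (rshift (m + 1) (rev_ord i)).

(* index of the block of i for the partition 1^r, m+1, 1^r *)
Definition block (i : 'I_ndim) : nat :=
  if (i < r)%N then nat_of_ord i
  else if (i < r + (m + 1))%N then r else (i - m)%N.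

Definition Urad : set 'M[K * K]_ndim :=
  [set u | forall i j, (block j <= block i)%N -> u i j = (i == j)%:R].

Definition central (A : 'M[K * K]_(m + 1)) : 'M[K * K]_ndim :=
  block_mx 0 0 0 (block_mx A 0 0 0).

Definition embGL (g : 'M[K * K]_m) : 'M[K * K]_ndim :=
  block_mx 1%:M 0 0 (block_mx (block_mx g 0 0 1%:M) 0 0 1%:M).

Definition wmx : 'M[K * K]_r := \matrix_(i, j) (j == rev_ord i)%:R.

Definition Sset : set 'M[K * K]_ndim :=
  [set s | s \in unitmx /\ s *m taumx s = 1%:M].

Definition normal_form (xi : 'M[K * K]_(m + 1)) (t : {ffun 'I_r -> K * K}) :
    'M[K * K]_ndim :=
  central xi + \sum_(i < r) (t i *: delta_mx (iv i) (ivc i) +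
                             (tau (t i))^-1 *: delta_mx (ivc i) (iv i)).

(* The orbital integrals below change by values of psi along the unipotent
   orbits, so they are compared only at elements in normal form. *)
Definition in_normal_form (z : 'M[K * K]_ndim) : Prop :=
  exists (xi : 'M[K * K]_(m + 1)) (t : {ffun 'I_r -> K * K}),
    (forall i, t i \is a GRing.unit) /\ z = normal_form xi t.

(* (Pr, t) read off the element in normal form of a unipotent orbit; that
   element exists and is unique for pre-regular orbits. *)
Definition normal_data (orbit : set 'M[K * K]_ndim) :
    'M[K * K]_(m + 1) * {ffun 'I_r -> K * K} :=
  xget (0, [ffun=> 1])
    [set p : 'M[K * K]_(m + 1) * {ffun 'I_r -> K * K} |
      (forall i, p.2 i \is a GRing.unit) /\ orbit (normal_form p.1 p.2)].

Definition Sorbit (z : 'M[K * K]_ndim) : set 'M[K * K]_ndim :=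
  [set invmx u *m z *m taumx u | u in Urad].

Definition PrS z := (normal_data (Sorbit z)).1.
Definition tS z := (normal_data (Sorbit z)).2.

Definition Spreregular (z : 'M[K * K]_ndim) : Prop :=
  forall u, Urad u -> invmx u *m z *m taumx u = z -> u = 1%:M.

Definition Sreg : set 'M[K * K]_ndim :=
  [set z | [/\ Sset z, Spreregular z & regular_mx (PrS z)]].

Variable beta0 : K.

Section Unitary.
Variable beta : 'M[K * K]_m.

Definition betaprime : 'M[K * K]_(m + 1) :=
  block_mx beta 0 0 (diagk beta0)%:M.

Definition Jmx : 'M[K * K]_ndim :=
  block_mx 0 (row_mx 0 wmx) (col_mx 0 wmx) (block_mx betaprime 0 0 0).

Definition Uset : set 'M[K * K]_ndim := unitary_group Jmx.

Definition Uprime : set 'M[K * K]_ndim := Uset `&` Urad.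

Definition Uorbit (z : 'M[K * K]_ndim) : set 'M[K * K]_ndim :=
  [set x | exists u1 u2,
     [/\ Uprime u1, Uprime u2 & x = invmx u1 *m z *m u2]].

Definition PrU z := (normal_data (Uorbit z)).1.
Definition tU z := (normal_data (Uorbit z)).2.

Definition Upreregular (z : 'M[K * K]_ndim) : Prop :=
  forall u1 u2, Uprime u1 -> Uprime u2 -> invmx u1 *m z *m u2 = z ->
    u1 = 1%:M /\ u2 = 1%:M.

Definition Ureg : set 'M[K * K]_ndim :=
  [set z | [/\ Uset z, Upreregular z & regular_mx (PrU z)]].

Definition matching (z zb : 'M[K * K]_ndim) : Prop :=
  tS z = tU zb /\
  exists2 g : 'M[K * K]_m, g \in unitmx &
    PrS z = invmx (block_mx g 0 0 1%:M) *m PrU zb *m block_mx g 0 0 1%:M.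

End Unitary.

Variables (R : realType) (psi' : K -> R[i]) (jm : K * K).

(* jm * (x - x^tau) lies in the diagonal copy of k' when jm^tau = - jm, hence
   the first projection. *)
Definition psi (x : K * K) : R[i] := psi' (jm * (x - tau x)).1.

(* The entries at (v_r, w_0) and (w_0, \check v_r) are written as sums over the
   i : 'I_r with i.+1 = r, which are empty when r = 0. *)
Definition psiU (u : 'M[K * K]_ndim) : R[i] :=
  psi (\sum_(i < r) \sum_(j < r | j == i.+1 :> nat) u (iv i) (iv j)
     + \sum_(i < r | i.+1 == r) u (iv i) iw0
     + diagk beta0 * \sum_(i < r | i.+1 == r) u iw0 (ivc i)
     + \sum_(i < r) \sum_(j < r | j == i.+1 :> nat) u (ivc j) (ivc i)).

Definition psiU' (u : 'M[K * K]_ndim) : R[i] :=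
  psi (\sum_(i < r) \sum_(j < r | j == i.+1 :> nat) u (iv i) (iv j)
     + \sum_(i < r | i.+1 == r) u (iv i) iw0).

(* The quadratic character attached to the split algebra k' x k' is trivial. *)
Definition eta (x : K * K) : R[i] := 1.

(* m is even, as n is odd *)
Definition transfer (z : 'M[K * K]_ndim) : R[i] :=
  eta (\det (Tmx (PrS z)) * (\det (PrS z)) ^- m./2).

Definition orbS
    (muGL : {measure set (borel 'M[K]_m) -> \bar R})
    (muU : {measure set (borel 'M[K * K]_ndim) -> \bar R})
    (F : 'M[K * K]_ndim -> R[i]) (z : 'M[K * K]_ndim) : R[i] :=
  Cintegral muGL (@GLset m) (fun g : 'M[K]_m =>
    let g' := map_mx diagk g in
    Cintegral muU Urad (fun u : 'M[K * K]_ndim =>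
      F (invmx (embGL g') *m invmx u *m z *m taumx u *m embGL g')
        * psiU (invmx u) * eta (\det g'))).

Definition orbU (beta : 'M[K * K]_m)
    (muUm : {measure set (borel 'M[K * K]_m) -> \bar R})
    (muU' : {measure set (borel 'M[K * K]_ndim) -> \bar R})
    (f : 'M[K * K]_ndim -> R[i]) (z : 'M[K * K]_ndim) : R[i] :=
  Cintegral muUm (unitary_group beta) (fun g : 'M[K * K]_m =>
    Cintegral muU' (Uprime beta) (fun u1 : 'M[K * K]_ndim =>
      Cintegral muU' (Uprime beta) (fun u2 : 'M[K * K]_ndim =>
        f (invmx (embGL g) *m invmx u1 *m z *m u2 *m embGL g)
          * psiU' (invmx u1 *m u2)))).

End Coordinates.
End SplitExtension.

(* Main.v *)
Require Import Defs.
From HB Require Import structures.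
From mathcomp Require Import all_boot all_order all_algebra all_field.
From mathcomp Require Import complex.
From mathcomp Require Import all_classical all_reals all_analysis.
From mathcomp Require Import measurable_realfun ring lra zify.
Import numFieldNormedType.Exports.
Import Order.TTheory GRing.Theory Num.Theory.
Set Implicit Arguments.
Unset Strict Implicit.
Unset Printing Implicit Defensive.
Local Open Scope classical_set_scope.
Local Open Scope ring_scope.
Local Open Scope complex_scope.

(** Over k = K x K a matrix is a pair of matrices over K, and the first component
    determines the second one both in S_n, whose elements are (x, x^-1), and in
    the unitary group of J = (J_1, J_1^T), whose elements are
    (x, (J_1 x^-1 J_1^-1)^T) (SsetP, unitary_groupP).  So S_n and U_n^beta are
    two copies of GL_n(K), and (x_1, x_2) |-> (x_1, J_1^-1 x_2^T J_1) identifies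
    the second with the first.  This map is the restriction of a linear
    bijection of the matrix spaces, hence preserves smoothness and compact
    support (Cc_smooth_comp).  There is one class of hermitian matrices
    (Her_one_class), so one function f^beta, and f^beta = c F, transported
    along this identification, for a constant c > 0.

    Let N be the unipotent radical with blocks 1^r, m+1, 1^r over K.  Components
    give U_{1^r,m+1,1^r}(k) = N x N, and first components give U' = N and
    U_m^beta = GL_m(K).  On first components both actions become
      y |-> h^-1 a^-1 y b h,  h in GL_m(K), a and b in N:
    for S_n the pair (a, b) is a single element of N x N, for U_n^beta it is a
    pair of elements of U'.  The characters agree as well: in an element of U'
    the second component carries the entries at w_0 and the coordinates dual to
    the v_i of the first one, with the factor beta_0 (form_dual).  Both orbital
    integrals are thus integrals over GL_m(K) and N x N of one function,
    orbit_fun (orbS_E, orbU_E).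

    Three points remain.
    - The measures are arbitrary Haar measures.  By uniqueness up to scalars
      (haar_on_unique) the images of the two families of measures on GL_m(K) and
      N x N are proportional, and c is the ratio of the constants.  For
      U_n^beta the integral over N x N is an iterated one, so Fubini is needed
      for fixed h.  It applies because the integrand has compact support
      there: a normal form y is block antidiagonal, so y^-1 a^-1 y b is a lower
      times an upper unipotent matrix, and the factors depend continuously on
      the product (unipotent_lu, orbit_fun_support).
    - Matching elements in normal form have first components conjugate under
      GL_m(K), not equal (matching_conj).  The conjugating element is absorbed
      by h, a and b, at the cost of the modulus of the action of GL_m(K) on N.
    - This modulus is 1 (conjL_invariant).  It is a character of GL_m(K), so it
      is invariant under transposition (chi_trmx); the automorphism
      u |-> w u^-T w of N shows that it is also invariant under g |-> g^-T.
    The transfer factor is 1 since eta is trivial. *)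

(** * Topology and Borel sets of matrix spaces *)

Section MatrixInverse.
Variables (A : comUnitRingType) (n : nat).
Implicit Types a b : 'M[A]_n.

Lemma mulmx1_inv a b : a *m b = 1%:M -> invmx a = b.
Proof.
by move=> ab; have [au _] := mulmx1_unit ab; rewrite -[RHS](mulKmx au) ab mulmx1.
Qed.

Lemma invmxM a b : a \in unitmx -> b \in unitmx ->
  invmx (a *m b) = invmx b *m invmx a.
Proof. by move=> au bu; apply: mulmx1_inv; rewrite mulmxA mulmxK // mulmxV. Qed.

End MatrixInverse.

Section MatrixTopology.
Variables (T : topologicalType) (m n : nat).

Lemma cvg_mxP (U : Type) (F : set_system U) {FF : Filter F}
    (f : U -> 'M[T]_(m, n)) (M : 'M[T]_(m, n)) :
  f @ F --> M <-> forall i j, (fun x => f x i j) @ F --> M i j.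
Proof.
split=> [fM i j A MA|fM A [P MP PA]].
  apply: (fM [set N | A (N i j)]).
  exists (fun i' j' => [set x | i' = i -> j' = j -> A x]).
    move=> i' j'; have [[-> ->]|nij] := pselect (i' = i /\ j' = j).
      by apply: filterS MA => x Ax _ _.
    by apply: filterS filterT => x _ ei ej; case: nij.
  by move=> N /(_ i j); apply.
have H : \forall x \near F, forall i j, P i j (f x i j).
  apply: filter_forall => i; apply: filter_forall => j.
  exact: (fM i j _ (MP i j)).
by apply: filterS H => x Hx; apply: PA.
Qed.

Lemma entry_continuous i j : continuous (fun M : 'M[T]_(m, n) => M i j).
Proof. by move=> M; apply: ((@cvg_mxP _ _ (nbhs_filter M) id M).1 (fun A => id) i j). Qed.

Lemma cvg_mx (U : Type) (F : set_system U) {FF : Filter F}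
    (f : U -> 'M[T]_(m, n)) (M : 'M[T]_(m, n)) :
  (forall i j, (fun x => f x i j) @ F --> M i j) -> f @ F --> M.
Proof. by move/(cvg_mxP (FF := FF)). Qed.

End MatrixTopology.

Lemma cvg_block_mx (T : topologicalType) (U : Type) (F : set_system U)
    {FF : Filter F} m1 m2 n1 n2 (a : U -> 'M[T]_(m1, n1)) (b : U -> 'M[T]_(m1, n2))
    (c : U -> 'M[T]_(m2, n1)) (d : U -> 'M[T]_(m2, n2))
    (a0 : 'M[T]_(m1, n1)) (b0 : 'M[T]_(m1, n2)) (c0 : 'M[T]_(m2, n1))
    (d0 : 'M[T]_(m2, n2)) :
  a @ F --> a0 -> b @ F --> b0 -> c @ F --> c0 -> d @ F --> d0 ->
  (fun x => block_mx (a x) (b x) (c x) (d x)) @ F --> block_mx a0 b0 c0 d0.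
Proof.
move=> /(cvg_mxP (FF := FF)) ha /(cvg_mxP (FF := FF)) hb.
move=> /(cvg_mxP (FF := FF)) hc /(cvg_mxP (FF := FF)) hd.
apply: (cvg_mx (FF := FF)) => i j.
case: (split_ordP i) => i1 ->; case: (split_ordP j) => j1 ->.
- by rewrite block_mxEul; under eq_fun do rewrite block_mxEul; exact: ha.
- by rewrite block_mxEur; under eq_fun do rewrite block_mxEur; exact: hb.
- by rewrite block_mxEdl; under eq_fun do rewrite block_mxEdl; exact: hc.
- by rewrite block_mxEdr; under eq_fun do rewrite block_mxEdr; exact: hd.
Qed.

Lemma hausdorff_mx (T : topologicalType) m n :
  hausdorff_space T -> hausdorff_space 'M[T]_(m, n).
Proof.
move=> hT A B AB; apply/matrixP => i j; apply: (hT (A i j) (B i j)) => P Q PA QB.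
have [M [PM QM]] := AB [set M | P (M i j)] [set M | Q (M i j)]
  (@entry_continuous T m n i j A _ PA) (@entry_continuous T m n i j B _ QB).
by exists (M i j).
Qed.

Lemma map_mx_continuous (S T : topologicalType) (f : S -> T) m n :
  continuous f -> continuous (map_mx f : 'M[S]_(m, n) -> 'M[T]_(m, n)).
Proof.
move=> fc M; apply/(cvg_mx (F := nbhs _)) => i j; rewrite mxE.
under eq_fun do rewrite mxE.
exact: (cvg_comp (fun N : 'M[S]_(m, n) => N i j) f
  (@entry_continuous S m n i j M) (fc (M i j))).
Qed.

Lemma trmx_continuous (T : topologicalType) m n :
  continuous (@trmx T m n).
Proof.
move=> M; apply/(cvg_mx (F := nbhs _)) => i j; rewrite mxE.
under eq_fun do rewrite mxE.
exact: entry_continuous.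
Qed.

Definition pairmx (T : Type) m n (A B : 'M[T]_(m, n)) : 'M[T * T]_(m, n) :=
  \matrix_(i, j) (A i j, B i j).

Lemma fst_pairmx (T : Type) m n (A B : 'M[T]_(m, n)) :
  map_mx fst (pairmx A B) = A.
Proof. by apply/matrixP => i j; rewrite !mxE. Qed.

Lemma snd_pairmx (T : Type) m n (A B : 'M[T]_(m, n)) :
  map_mx snd (pairmx A B) = B.
Proof. by apply/matrixP => i j; rewrite !mxE. Qed.

Lemma pairmxK (T : Type) m n (A : 'M[T * T]_(m, n)) :
  pairmx (map_mx fst A) (map_mx snd A) = A.
Proof. by apply/matrixP => i j; rewrite !mxE; case: (A i j). Qed.

Lemma cvg_pairmx (T : topologicalType) m n (U : Type) (F : set_system U)
  {FF : Filter F} (f g : U -> 'M[T]_(m, n)) (A B : 'M[T]_(m, n)) :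
  f @ F --> A -> g @ F --> B ->
  (fun x => pairmx (f x) (g x)) @ F --> pairmx A B.
Proof.
move=> /(cvg_mxP (FF := FF)) fA /(cvg_mxP (FF := FF)) gB; apply: (cvg_mx (FF := FF)) => i j; rewrite mxE.
under eq_fun do rewrite mxE.
by apply: cvg_pair; [exact: fA|exact: gB].
Qed.

Lemma mx_compact (T : ptopologicalType) m n (C : set T) : compact C ->
  compact [set M : 'M[T]_(m, n) | forall i j, C (M i j)].
Proof.
move=> cC.
have H : compact [set v : 'rV[T]_(m * n) | forall i, C (v ord0 i)].
  by apply: (@rV_compact T _ (fun=> C)).
have -> : [set M : 'M[T]_(m, n) | forall i j, C (M i j)] =
    (@vec_mx T m n) @` [set v : 'rV[T]_(m * n) | forall i, C (v ord0 i)].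
  apply/seteqP; split=> [M CM|_ [v Cv <-] i j] /=; last by rewrite mxE.
  exists (mxvec M); last exact: mxvecK.
  by move=> k; case/mxvec_indexP: k => i j; rewrite mxvecE.
apply: continuous_compact => //; apply: continuous_subspaceT => v.
apply/(cvg_mx (F := nbhs _)) => i j; rewrite mxE; under eq_fun do rewrite mxE.
exact: entry_continuous.
Qed.

(** It makes the open sets of a product measurable for the product of the Borel
    sigma-algebras, which may otherwise be strictly smaller than the Borel
    sigma-algebra of the product. *)
Definition countable_base (T : topologicalType) : Prop :=
  exists B : nat -> set T, (forall k, open (B k)) /\
     forall x A, nbhs x A -> exists2 k, B k x & B k `<=` A.

Lemma countable_base_count (T : topologicalType) (I : countType)
    (B : I -> set T) : (forall k, open (B k)) ->
  (forall x A, nbhs x A -> exists2 k, B k x & B k `<=` A) -> countable_base T.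
Proof.
move=> Bo Bb; exists (fun k => if unpickle k is Some i then B i else set0).
split=> [k|x A /Bb[i Bix BiA]]; first by case: unpickle => // ; exact: open0.
by exists (pickle i); rewrite pickleK.
Qed.

Lemma countable_base_mx (T : topologicalType) m n :
  countable_base T -> countable_base 'M[T]_(m, n).
Proof.
move=> [B [Bo Bb]].
apply: (@countable_base_count 'M[T]_(m, n) 'M[nat]_(m, n)
  (fun k => [set M | forall i j, B (k i j) (M i j)])).
  move=> k; rewrite openE => M BM; exists (fun i j => B (k i j)) => // i j.
  by apply: open_nbhs_nbhs; split.
move=> M A [P MP PA].
have H i j : exists k, B k (M i j) /\ B k `<=` P i j.
  by have [k] := Bb _ _ (MP i j); exists k.
pose k := \matrix_(i, j) xget 0%N [set k | B k (M i j) /\ B k `<=` P i j].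
have Hk i j : B (k i j) (M i j) /\ B (k i j) `<=` P i j.
  by rewrite mxE; case: xgetP => [k' _ //|]; have [k' Hk'] := H i j => /(_ k').
exists k => [i j|N BN]; first by have [] := Hk i j.
by apply: PA => i j; have [_] := Hk i j; apply.
Qed.

Lemma countable_base_prod (S T : topologicalType) :
  countable_base S -> countable_base T -> countable_base (S * T)%type.
Proof.
move=> [B [Bo Bb]] [C [Co Cb]].
apply: (@countable_base_count (S * T)%type (nat * nat)%type
  (fun k => B k.1 `*` C k.2)).
  move=> k; rewrite openE => -[x y] [/= Bx Cy].
  exists (B k.1, C k.2) => //=; split; apply: open_nbhs_nbhs; split=> //.
move=> [x y] A [[P Q] /= [xP yQ] PQA].
have [k Bk BkP] := Bb _ _ xP; have [l Cl ClQ] := Cb _ _ yQ.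
by exists (k, l) => // -[a b] [/= Ba Cb']; apply: PQA; split; [exact: BkP|exact: ClQ].
Qed.

Lemma open_borel (T : ptopologicalType) (A : set T) :
  open A -> measurable (A : set (borel T)).
Proof. by move=> oA; exact: sub_gen_smallest. Qed.

Lemma closed_borel (T : ptopologicalType) (A : set T) :
  closed A -> measurable (A : set (borel T)).
Proof.
move=> /closed_openC/open_borel /measurableC; by rewrite setCK.
Qed.

(** Measurability of a map to S, without a sigma-algebra on S: for a product S
    one would have to choose between the Borel and the product one. *)
Definition opens_measurable d (X : measurableType d) (S : topologicalType) (i : X -> S) :=
  forall O : set S, open O -> measurable (i @^-1` O).

Lemma opens_measurable_borel (S : ptopologicalType) :
  opens_measurable (id : borel S -> S).
Proof. by move=> O oO; exact: open_borel. Qed.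

Lemma opens_measurable_prod d1 d2 (X : measurableType d1) (Y : measurableType d2)
    (S T : topologicalType) (i : X -> S) (j : Y -> T) :
  countable_base S -> countable_base T ->
  opens_measurable i -> opens_measurable j ->
  opens_measurable (fun p : X * Y => (i p.1, j p.2)).
Proof.
move=> [B [Bo Bb]] [C [Co Cb]] mi mj A oA.
have -> : (fun p : X * Y => (i p.1, j p.2)) @^-1` A = \bigcup_k \bigcup_l
    (if `[< B k `*` C l `<=` A >] then (i @^-1` B k) `*` (j @^-1` C l) else set0).
  apply/seteqP; split=> [[x y] Axy|p [k _] [l _]]; last first.
    by case: asboolP => // H [Bp Cp]; apply: H.
  have [[P Q] /= [xP yQ] PQA] : nbhs (i x, j y) A by apply: open_nbhs_nbhs.
  have [k Bk BkP] := Bb _ _ xP; have [l Cl ClQ] := Cb _ _ yQ.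
  exists k => //; exists l => //; rewrite asboolT //.
  by move=> [a b] [/= Ba Cb']; apply: PQA; split; [exact: BkP|exact: ClQ].
apply: bigcupT_measurable => k; apply: bigcupT_measurable => l.
case: ifP => _; last exact: measurable0.
by apply: measurableX; [exact: mi|exact: mj].
Qed.

Lemma open_prod_borel (S T : ptopologicalType) (A : set (S * T)) :
  countable_base S -> countable_base T ->
  open A -> measurable (A : set (borel S * borel T)%type).
Proof.
move=> bS bT oA; rewrite (_ : A = (fun p : borel S * borel T => (p.1, p.2)) @^-1` A).
  exact: (opens_measurable_prod bS bT (@opens_measurable_borel S)
    (@opens_measurable_borel T) oA).
by apply/seteqP; split=> -[].
Qed.

Lemma continuous_borel_fun (S T : ptopologicalType) (f : S -> T) :
  continuous f -> measurable_fun setT (f : borel S -> borel T).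
Proof.
move=> fc; apply: (measurability (@open T : set (set (borel T)))) => //.
move=> _ [B oB <-]; rewrite setTI; apply: open_borel.
by apply: open_comp.
Qed.

Lemma continuous_prod_borel_fun (S1 S2 T : ptopologicalType) (f : S1 * S2 -> T) :
  countable_base S1 -> countable_base S2 ->
  continuous f ->
  measurable_fun setT (f : (borel S1 * borel S2)%type -> borel T).
Proof.
move=> b1 b2 fc; apply: (measurability (@open T : set (set (borel T)))) => //.
move=> _ [B oB <-]; rewrite setTI; apply: open_prod_borel => //.
by apply: open_comp.
Qed.

(** * The topology of a local field *)

Section LocalFieldTopology.
Variables (R : realType) (K : topFieldType).

Definition topological_abs (v : K -> R) : Prop :=
  [/\ [/\ forall x, 0 <= v x,
          forall x, v x = 0 <-> x = 0,
          forall x y, v (x * y) = v x * v y &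
          forall x y, v (x + y) <= v x + v y],
      exists2 x, x != 0 & v x != 1 &
      forall (x : K) (A : set K),
        nbhs x A <-> exists2 e : R, 0 < e & forall y, v (y - x) < e -> A y].

Variable v : K -> R.
Hypothesis vP : topological_abs v.

Lemma abs_ge0 x : 0 <= v x. Proof. by have [[? _ _ _] _ _] := vP. Qed.
Lemma abs_eq0 x : (v x == 0) = (x == 0).
Proof. by have [[_ H _ _] _ _] := vP; apply/eqP/eqP => /H. Qed.
Lemma absM x y : v (x * y) = v x * v y.
Proof. by have [[_ _ ? _] _ _] := vP. Qed.
Lemma absD x y : v (x + y) <= v x + v y.
Proof. by have [[_ _ _ ?] _ _] := vP. Qed.
Lemma abs_gt0 x : (0 < v x) = (x != 0).
Proof. by rewrite lt0r abs_ge0 abs_eq0 andbT. Qed.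
Lemma abs0 : v 0 = 0. Proof. by apply/eqP; rewrite abs_eq0. Qed.
Lemma abs1 : v 1 = 1.
Proof.
have v1 : v 1 != 0 by rewrite abs_eq0 oner_eq0.
by apply: (mulfI v1); rewrite -absM !mulr1.
Qed.
Lemma absN x : v (- x) = v x.
Proof.
apply/eqP; rewrite -(@eqrXn2 _ 2) ?abs_ge0 // !expr2 -!absM mulrNN //.
Qed.
Lemma absV x : v x^-1 = (v x)^-1.
Proof.
have [->|x0] := eqVneq x 0; first by rewrite invr0 abs0 invr0.
by apply: (mulfI (x := v x)); rewrite ?abs_eq0 // -absM !mulfV ?abs_eq0 ?abs1.
Qed.
Lemma absX x n : v (x ^+ n) = v x ^+ n.
Proof. by elim: n => [|n IH]; rewrite ?abs1 // !exprS absM IH. Qed.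
Lemma absB x y : `|v x - v y| <= v (x - y).
Proof.
rewrite ler_norml; apply/andP; split.
  rewrite lerBrDl lerBlDr addrC -lerBlDr.
  have := absD (y - x) x; rewrite subrK -(opprB x y) absN => H.
  by rewrite lerBlDr.
have := absD (x - y) y; rewrite subrK => H.
by rewrite lerBlDr.
Qed.

Lemma nbhs_absP (x : K) (A : set K) :
  nbhs x A <-> exists2 e : R, 0 < e & forall y, v (y - x) < e -> A y.
Proof. by have [_ _] := vP. Qed.

Lemma nbhs_abs (x : K) (e : R) : 0 < e -> \forall y \near x, v (y - x) < e.
Proof. by move=> e0; apply/nbhs_absP; exists e. Qed.

Lemma cvg_absP (U : Type) (F : set_system U) {FF : Filter F} (f : U -> K) a :
  f @ F --> a <-> forall e : R, 0 < e -> \forall x \near F, v (f x - a) < e.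
Proof.
split=> [fa e e0|H A /nbhs_absP[e e0 eA]]; first exact: (fa _ (nbhs_abs a e0)).
by rewrite /fmap /=; apply: filterS (H _ e0) => x; exact: eA.
Qed.

Lemma abs_continuous : continuous v.
Proof.
move=> x; apply/(cvgrPdist_lt (FF := nbhs_filter x)) => e e0.
apply: filterS (nbhs_abs x e0) => y; apply: le_lt_trans.
by rewrite -(absN (y - x)) opprB; exact: absB.
Qed.

Section Cvg.
Variables (U : Type) (F : set_system U) (FF : Filter F).

Lemma cvg_addK (f g : U -> K) (a b : K) :
  f @ F --> a -> g @ F --> b -> (fun x => f x + g x) @ F --> a + b.
Proof.
move=> /(cvg_absP (FF := FF)) fa /(cvg_absP (FF := FF)) gb.
apply/(cvg_absP (FF := FF)) => e e0.
have e2 : 0 < e / 2 by rewrite divr_gt0.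
apply: filterS2 (fa _ e2) (gb _ e2) => x fx gx.
rewrite opprD addrACA (le_lt_trans (absD _ _)) //.
by rewrite [ltRHS]splitr ltrD.
Qed.

Lemma cvg_oppK (f : U -> K) (a : K) :
  f @ F --> a -> (fun x => - f x) @ F --> - a.
Proof.
move=> /(cvg_absP (FF := FF)) fa.
apply/(cvg_absP (FF := FF)) => e e0.
by apply: filterS (fa _ e0) => x; rewrite -opprD absN.
Qed.

Lemma cvg_mulK (f g : U -> K) (a b : K) :
  f @ F --> a -> g @ F --> b -> (fun x => f x * g x) @ F --> a * b.
Proof.
move=> /(cvg_absP (FF := FF)) fa /(cvg_absP (FF := FF)) gb.
apply/(cvg_absP (FF := FF)) => e e0.
have A0 : 0 < v a + 1 by rewrite ltr_wpDl ?abs_ge0.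
have B0 : 0 < v b + 1 by rewrite ltr_wpDl ?abs_ge0.
have ea : 0 < Num.min (e / 2 / (v b + 1)) 1 by rewrite lt_min ltr01 !divr_gt0.
have eb : 0 < e / 2 / (v a + 1) by rewrite !divr_gt0.
apply: filterS2 (fa _ ea) (gb _ eb) => x; rewrite lt_min => /andP[fx fx1] gx.
have -> : f x * g x - a * b = (f x - a) * b + f x * (g x - b) by ring.
rewrite (le_lt_trans (absD _ _)) // !absM [ltRHS]splitr.
have fxa : v (f x) <= v a + 1.
  by rewrite -[f x](subrK a) (le_trans (absD _ _)) // addrC lerD2l ltW.
apply: ltr_leD.
  apply: (@le_lt_trans _ _ (v (f x - a) * (v b + 1))).
    by rewrite ler_wpM2l ?abs_ge0 // lerDl.
  by rewrite -ltr_pdivlMr.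
apply: (@le_trans _ _ ((v a + 1) * v (g x - b))).
  by rewrite ler_wpM2r ?abs_ge0.
by rewrite mulrC -ler_pdivlMr // ltW.
Qed.

Lemma cvg_invK (f : U -> K) (a : K) : a != 0 ->
  f @ F --> a -> (fun x => (f x)^-1) @ F --> a^-1.
Proof.
move=> a0 /(cvg_absP (FF := FF)) fa.
apply/(cvg_absP (FF := FF)) => e e0.
have va : 0 < v a by rewrite abs_gt0.
have e1 : 0 < Num.min (v a / 2) (e * (v a / 2 * v a)).
  by rewrite lt_min divr_gt0 // !mulr_gt0 // divr_gt0.
apply: filterS (fa _ e1) => x; rewrite lt_min => /andP[f1 f2].
have vf : v a / 2 < v (f x).
  have := absB (f x) a; rewrite ler_norml => /andP[+ _].
  rewrite lerBrDl => H; apply: lt_le_trans H.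
  by rewrite ltrBrDr {2}(splitr (v a)) ltrD2l.
have vf0 : 0 < v (f x) by apply: lt_trans vf; rewrite divr_gt0.
have fx0 : f x != 0 by rewrite -abs_gt0.
have -> : (f x)^-1 - a^-1 = (a - f x) / (f x * a).
  by field; rewrite fx0 a0.
rewrite absM absV absM ltr_pdivrMr ?mulr_gt0 // -(opprB (f x)) absN.
apply: lt_le_trans f2 _; rewrite ler_pM2l // ler_pM2r // ltW //.
Qed.

Lemma cvg_bigK (op : K -> K -> K) idx (I : Type) (s : seq I) (P : pred I)
    (f : I -> U -> K) (a : I -> K) :
  (forall g h b c, g @ F --> b -> h @ F --> c ->
    (fun x => op (g x) (h x)) @ F --> op b c) ->
  (forall i, f i @ F --> a i) ->
  (fun x => \big[op/idx]_(i <- s | P i) f i x) @ F --> \big[op/idx]_(i <- s | P i) a i.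
Proof.
move=> opc fa; elim: s => [|i s IH].
  by rewrite big_nil; under eq_fun do rewrite big_nil; exact: cvg_cst.
rewrite big_cons; under eq_fun do rewrite big_cons.
by case: (P i) => //; apply: opc.
Qed.

Lemma cvg_sumK (I : Type) (s : seq I) (P : pred I) (f : I -> U -> K) (a : I -> K) :
  (forall i, f i @ F --> a i) ->
  (fun x => \sum_(i <- s | P i) f i x) @ F --> \sum_(i <- s | P i) a i.
Proof. exact/cvg_bigK/cvg_addK. Qed.

Lemma cvg_mulmx m n p (f : U -> 'M[K]_(m, n)) (g : U -> 'M[K]_(n, p))
    (A : 'M[K]_(m, n)) (B : 'M[K]_(n, p)) :
  f @ F --> A -> g @ F --> B -> (fun x => f x *m g x) @ F --> A *m B.
Proof.
move=> /(cvg_mxP (FF := FF)) fA /(cvg_mxP (FF := FF)) gB.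
apply/(cvg_mxP (FF := FF)) => i j; rewrite mxE; under eq_fun do rewrite mxE.
by apply: cvg_sumK => k; apply: cvg_mulK; [exact: fA|exact: gB].
Qed.

Lemma cvg_det n (f : U -> 'M[K]_n) (A : 'M[K]_n) :
  f @ F --> A -> (fun x => \det (f x)) @ F --> \det A.
Proof.
move=> /(cvg_mxP (FF := FF)) fA; apply: cvg_sumK => s.
apply: cvg_mulK; first exact: cvg_cst.
by apply: cvg_bigK => [|i]; [exact: cvg_mulK|exact: fA].
Qed.

Lemma cvg_adj n (f : U -> 'M[K]_n) (A : 'M[K]_n) :
  f @ F --> A -> (fun x => \adj (f x)) @ F --> \adj A.
Proof.
move=> /(cvg_mxP (FF := FF)) fA.
apply/(cvg_mxP (FF := FF)) => i j; rewrite mxE; under eq_fun do rewrite mxE.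
apply: cvg_mulK; [exact: cvg_cst|apply: cvg_det].
apply/(cvg_mxP (FF := FF)) => k l; rewrite !mxE; under eq_fun do rewrite !mxE.
exact: fA.
Qed.
End Cvg.

Lemma abs_det_continuous n : continuous (fun A : 'M[K]_n => v (\det A)).
Proof.
move=> A; have dA := cvg_det (nbhs_filter A) (@cvg_id _ (nbhs A)).
exact: (cvg_comp (fun B : 'M[K]_n => \det B) v dA (@abs_continuous (\det A))).
Qed.

Lemma GL_open n : open [set A : 'M[K]_n | A \in unitmx].
Proof.
have -> : [set A : 'M[K]_n | A \in unitmx] =
    (fun A : 'M[K]_n => v (\det A)) @^-1` [set t | 0 < t].
  by apply/seteqP; split=> A /=; rewrite unitmxE unitfE abs_gt0.
apply: open_comp; last exact: open_gt.
by move=> A _; exact: abs_det_continuous.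
Qed.

Lemma cvg_invmx (U : Type) (F : set_system U) (FF : Filter F) n
    (f : U -> 'M[K]_n) (A : 'M[K]_n) : A \in unitmx ->
  f @ F --> A -> (fun x => invmx (f x)) @ F --> invmx A.
Proof.
move=> Au fA.
have H : (fun x => (\det (f x))^-1 *: \adj (f x)) @ F --> invmx A.
  rewrite /invmx Au; apply/(cvg_mxP (FF := FF)) => i j; rewrite mxE.
  under eq_fun do rewrite mxE; apply: cvg_mulK.
    by apply: cvg_invK; [rewrite -unitfE -unitmxE|exact: cvg_det].
  by move: i j; apply/(cvg_mxP (FF := FF)); exact: cvg_adj.
have fu : \forall x \near F, f x \in unitmx.
  apply: (fA [set B : 'M[K]_n | B \in unitmx]).
  by apply: open_nbhs_nbhs; split=> //; exact: GL_open.
move=> P /H; rewrite /fmap /= => HP; apply: filterS2 fu HP => x fxu.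
by rewrite /preimage /= /invmx fxu.
Qed.

Lemma hausdorff_abs : hausdorff_space K.
Proof.
move=> x y xy; apply/eqP; rewrite -subr_eq0 -abs_eq0; apply/negP => /negP n0.
have e0 : 0 < v (x - y) / 2 by rewrite divr_gt0 // lt_neqAle eq_sym n0 abs_ge0.
have [z [/= zx zy]] := xy _ _ (nbhs_abs x e0) (nbhs_abs y e0).
have := absD (x - z) (z - y); rewrite subrKA leNgt => /negP; apply.
by rewrite [ltRHS]splitr -(absN (x - z)) opprB ltrD.
Qed.

Hypothesis lcK : locally_compact [set: K].

Lemma closed_abs_ball (t : R) : closed [set x : K | v x <= t].
Proof.
apply: (@closed_comp _ _ v [set s | s <= t]); last exact: closed_le.
by move=> x _; exact: abs_continuous.
Qed.

(** Powers of an element of absolute value greater than 1. *)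
Lemma abs_large (t : R) : exists2 x : K, x != 0 & t < v x.
Proof.
have [x x0 x1] : exists2 x : K, x != 0 & 1 < v x.
  have [_ [x x0 x1] _] := vP.
  have [h|h] := ltP 1 (v x); first by exists x.
  exists x^-1; rewrite ?invr_eq0 // absV invf_gt1 ?abs_gt0 //.
  by rewrite lt_neqAle x1.
have vx1 : `|(v x)^-1| < 1 by rewrite ger0_norm ?invr_ge0 ?abs_ge0 // invf_lt1 // abs_gt0.
have t1 : 0 < (`|t| + 1)^-1 by rewrite invr_gt0 ltr_wpDl.
have [n _ /(_ n (leqnn n))] := cvgr0_norm_lt _ (cvg_expr vx1) _ t1.
rewrite /= exprVn ger0_norm ?invr_ge0 ?exprn_ge0 ?abs_ge0 //.
rewrite ltf_pV2 ?qualifE/= ?exprn_gt0 ?abs_gt0 ?ltr_wpDl // => tn.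
exists (x ^+ n); first by rewrite expf_neq0.
by rewrite absX (le_lt_trans _ tn) // (le_trans (ler_norm t)) // lerDl.
Qed.

(** Some ball around 0 is compact by local compactness, and multiplication by an
    element of large absolute value maps it onto a set containing the ball of
    radius t. *)
Lemma compact_abs_ball (t : R) : compact [set x : K | v x <= t].
Proof.
have [U U0 [cU _]] : compact_near (within setT (nbhs (0 : K))) by exact: lcK.
have /nbhs_absP[e e0 eU] : nbhs (0 : K) U.
  by move: U0; rewrite /within /=; apply: filterS => x; apply.
have [c c0 ct] := abs_large (t / e).
have H : [set x : K | v x <= t] `<=` (fun x : K => c * x) @` U.
  move=> x /= xt; exists (c^-1 * x); last by rewrite mulrA divff // mul1r.
  apply: eU; rewrite subr0 absM absV mulrC ltr_pdivrMr ?abs_gt0 //.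
  by apply: le_lt_trans xt _; rewrite mulrC -ltr_pdivrMr.
suff cU' : compact ((fun x : K => c * x) @` U).
  exact: (subclosed_compact (@closed_abs_ball t) cU' H).
apply: continuous_compact => //; apply: continuous_subspaceT => x.
by apply: (cvg_mulK (F := nbhs x)); [exact: cvg_cst|exact: cvg_id].
Qed.

(** The lower bound on the determinant makes these sets closed in the space of all
    matrices, hence compact; for t = 1, 2, ... they exhaust GL_n. *)
Definition GLball n (t : R) : set 'M[K]_n :=
  [set A : 'M[K]_n | (forall i j, v (A i j) <= t) /\ t^-1 <= v (\det A)].

Arguments GLball n t : clear implicits.

Lemma compact_GLball n (t : R) : compact (GLball n t).
Proof.
apply: (compact_closedI (mx_compact (C := [set x : K | v x <= t]) _)).
  exact: compact_abs_ball.
apply: (@closed_comp _ _ (fun A : 'M[K]_n => v (\det A)) [set s | t^-1 <= s]).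
  by move=> A _; exact: abs_det_continuous.
exact: closed_ge.
Qed.

Lemma GLball_sub n (t : R) : 0 < t -> GLball n t `<=` [set A : 'M[K]_n | A \in unitmx].
Proof.
move=> t0 A [_ tA] /=; rewrite unitmxE unitfE -abs_gt0.
by apply: lt_le_trans tA; rewrite invr_gt0.
Qed.

Lemma GLball_cover n (A : 'M[K]_n) : A \in unitmx ->
  exists k : nat, GLball n k.+1%:R A.
Proof.
rewrite unitmxE unitfE -abs_gt0 => d0.
pose M := (v (\det A))^-1 + \sum_i \sum_j v (A i j).
have S0 (i : 'I_n) : 0 <= \sum_j v (A i j) by apply: sumr_ge0 => j _; exact: abs_ge0.
have dV0 : 0 < (v (\det A))^-1 by rewrite invr_gt0.
have M0 : 0 <= M by rewrite addr_ge0 ?sumr_ge0 // ltW.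
exists (Num.truncn M).
have Mk : M <= (Num.truncn M).+1%:R by rewrite ltW // truncnS_gt.
split=> [i j|]; last first.
  rewrite invf_ple ?qualifE/= // (le_trans _ Mk) // lerDl sumr_ge0 //.
apply: le_trans Mk; rewrite /M (bigD1 i) //= (bigD1 j) //= addrCA -!addrA lerDl.
rewrite addr_ge0 ?sumr_ge0 // => *; first exact: abs_ge0.
by rewrite addr_ge0 ?sumr_ge0 // ltW.
Qed.

Lemma GLball_nbhs1 n : \forall A \near (1%:M : 'M[K]_n), GLball n 2 A.
Proof.
apply: filterI.
  have H i j : \forall A \near (1%:M : 'M[K]_n), v ((A : 'M[K]_n) i j) < 2.
    have := cvg_comp (fun A : 'M[K]_n => A i j) v
      (@entry_continuous K n n i j 1%:M) (@abs_continuous _).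
    move=> /(_ [set s | s < 2]); apply.
    apply: open_nbhs_nbhs; split; first exact: open_lt.
    by rewrite /= mxE; case: (i == j); rewrite ?abs0 ?abs1 // ltr1n.
  have : \forall A \near (1%:M : 'M[K]_n), forall i j, v ((A : 'M[K]_n) i j) < 2.
    apply: (@filter_forall _ _ (fun i (A : 'M[K]_n) => forall j, v (A i j) < 2) _ (nbhs_filter _)) => i.
    by exact: (@filter_forall _ _ (fun j (A : 'M[K]_n) => v (A i j) < 2) _ (nbhs_filter _) (H i)).
  by apply: filterS => A HA i j; rewrite ltW.
have := @abs_det_continuous n 1%:M [set s | 2^-1 < s].
suff h : nbhs (v (\det (1%:M : 'M[K]_n))) [set s | 2^-1 < s].
  move=> /(_ h) h2.
  by apply: (@filterS _ (nbhs (1%:M : 'M[K]_n)) _ _ _ _ h2) => A /= /ltW.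
apply: open_nbhs_nbhs; split; first exact: open_gt.
by rewrite /= det1 abs1 invf_lt1 // ltr1n.
Qed.

Lemma open_abs_ball (y : K) (e : R) : open [set x | v (x - y) < e].
Proof.
rewrite openE => x /= xy; apply/nbhs_absP; exists (e - v (x - y)).
  by rewrite subr_gt0.
move=> z zx /=; have -> : z - y = (z - x) + (x - y) by ring.
by rewrite (le_lt_trans (absD _ _)) // -ltrBrDr.
Qed.

(** Each compact ball of radius k is covered by finitely many balls of radius
    1/(j+1); all these balls form a base. *)
Lemma countable_base_abs : countable_base K.
Proof.
have H (k j : nat) : exists s : seq K, forall x, v x <= k%:R ->
    exists2 y, y \in s & v (x - y) < j.+1%:R^-1.
  have := @compact_abs_ball k%:R; rewrite compact_cover.
  move=> /(_ K setT (fun y => [set x | v (x - y) < j.+1%:R^-1])) [].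
  - by move=> y _; exact: open_abs_ball.
  - by move=> x _; exists x => //=; rewrite subrr abs0 invr_gt0.
  move=> D _ cD; have /finite_seqP[s Ds] := finite_fset D.
  by exists s => x /cD[y]; rewrite Ds; exists y.
pose s k j := xget [::] [set s : seq K | forall x, v x <= k%:R ->
    exists2 y, y \in s & v (x - y) < j.+1%:R^-1].
have Hs k j x : v x <= k%:R -> exists2 y, y \in s k j & v (x - y) < j.+1%:R^-1.
  rewrite /s; case: xgetP => [t _ /(_ x) //|]; have [t Ht] := H k j.
  by move/(_ t).
apply: (@countable_base_count K (nat * nat * nat)%type
  (fun k => [set x | v (x - nth 0 (s k.1.1 k.1.2) k.2) < k.1.2.+1%:R^-1])).
  move=> [[k j] l] /=; set y := nth _ _ _.
  exact: open_abs_ball.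
move=> x A /nbhs_absP[e e0 eA].
have [j je] : exists j : nat, j.+1%:R^-1 < e / 2.
  exists (Num.truncn (e / 2)^-1); rewrite invf_plt ?qualifE/= ?divr_gt0 //.
  exact: truncnS_gt.
have /Hs-/(_ j)[y yin xy] : v x <= (Num.truncn (v x)).+1%:R.
  by rewrite ltW // truncnS_gt.
exists (((Num.truncn (v x)).+1, j), index y (s (Num.truncn (v x)).+1 j)) => /=.
  by rewrite nth_index.
move=> z /=; rewrite nth_index // => zy; apply: eA.
have -> : z - x = (z - y) + - (x - y) by ring.
rewrite (le_lt_trans (absD _ _)) // absN [ltRHS]splitr.
by rewrite ltrD // (lt_trans _ je).
Qed.

End LocalFieldTopology.

Arguments GLball {R K} v n t _.

Lemma local_field_abs (R : realType) (K : topFieldType) : local_field R K ->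
  exists2 v : K -> R, topological_abs v & locally_compact [set: K].
Proof. by move=> [[v [p q r]] lc]; exists v. Qed.

(** * Uniqueness of left-invariant measures *)

Section HaarUniqueness.
Local Open Scope ereal_scope.
Context d (T : measurableType d) (R : realType).
Variables (G : set T) (op : T * T -> T) (inv : T -> T).
Hypotheses (mG : measurable G) (mop : measurable_fun setT op)
  (minv : measurable_fun setT inv).
Hypotheses (opG : forall x y, G x -> G y -> G (op (x, y)))
  (invG : forall x, G x -> G (inv x)).
Hypotheses (opKr : forall x y, G x -> G y -> op (op (x, y), inv y) = x)
  (opVK : forall x y, G x -> op (x, op (inv x, y)) = y)
  (opKV : forall x y, G x -> op (inv x, op (x, y)) = y)
  (invMV : forall x y, G x -> G y -> op (inv (op (x, y)), x) = inv y).

Definition left_invariant (mu : set T -> \bar R) : Prop :=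
  forall g A, G g -> measurable A -> mu ((fun x => op (g, x)) @^-1` A) = mu A.

(** The groups live in spaces of matrices, on which their measures are defined. *)
Definition concentrated (mu : set T -> \bar R) : Prop := mu (~` G) = 0.

Lemma concentratedE (mu : {measure set T -> \bar R}) A :
  concentrated mu -> measurable A -> mu A = mu (A `&` G).
Proof.
move=> cmu mA; rewrite -[in LHS](setUIDK A G) measureU //.
- rewrite [X in _ + X](_ : _ = 0) ?adde0 //.
  apply/eqP; rewrite eq_le measure_ge0 andbT -cmu.
  apply: le_measure; rewrite ?inE; [exact: measurableD|exact: measurableC|].
  by move=> x [].
- exact: measurableI.
- exact: measurableD.
- by apply/seteqP; split=> x // [[_ Gx] [_ /(_ Gx)]].
Qed.

Let mop1 g : measurable_fun setT (fun x => op (g, x)).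
Proof.
by apply: (measurableT_comp mop); apply: measurable_fun_pair.
Qed.

Lemma left_invariant_integral (mu : {measure set T -> \bar R}) g
    (k : T -> \bar R) : left_invariant mu -> G g ->
  measurable_fun setT k -> (forall x, 0 <= k x) ->
  \int[mu]_x k (op (g, x)) = \int[mu]_x k x.
Proof.
move=> imu Gg mk k0.
have := @ge0_integral_pushforward _ _ _ _ _ _ (mop1 g) mu setT k measurableT mk.
rewrite preimage_setT => <-; last by move=> x _; exact: k0.
by apply: eq_measure_integral => A mA _; exact: imu.
Qed.

Section Formula.
Variables (mu nu : {sigma_finite_measure set T -> \bar R}).
Hypotheses (imu : left_invariant mu) (inu : left_invariant nu).
Hypotheses (cmu : concentrated mu).
Variables (B : set T).
Hypothesis mB : measurable B.
Let D x := nu (G `&` [set z | B (op (z, x))]).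
Hypothesis Dpos : forall x, G x -> 0 < D x < +oo.

Let W x := ((fine (D x)) `^ (-1))%:E.

Let BG : set (T * T) := [set p | G p.2 /\ B (op (p.2, p.1))].

Let mBG : measurable BG.
Proof.
have -> : BG = (snd @^-1` G) `&` ((fun p => op (p.2, p.1)) @^-1` B) by [].
apply: measurableI; rewrite -[X in measurable X]setTI.
  exact: (@measurable_snd _ _ T T measurableT _ mG).
have : measurable_fun setT (fun p : T * T => op (p.2, p.1)).
  by apply: (measurableT_comp mop); apply: measurable_fun_pair;
    [exact: measurable_snd|exact: measurable_fst].
by apply.
Qed.

Let DE x : D x = \int[nu]_y (\1_BG (x, y))%:E.
Proof.
have := congr1 (fun f => f x) (indic_fubini_tonelli_FE nu mBG).
rewrite /fubini_F /= => ->; congr (nu _).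
by apply/seteqP; split=> y; rewrite /xsection /= ?inE.
Qed.

Let mD : measurable_fun setT D.
Proof.
have := indic_measurable_fun_fubini_tonelli_F nu mBG.
by apply: eq_measurable_fun => x _; rewrite /fubini_F /= DE.
Qed.

Let mW : measurable_fun setT W.
Proof.
apply/measurable_EFinP; apply: (measurableT_comp (measurable_powR _)).
exact: (measurableT_comp (fine_measurable measurableT)).
Qed.

Let W0 x : 0 <= W x.
Proof. by rewrite lee_fin powR_ge0. Qed.

Let WD x : G x -> W x * D x = 1.
Proof.
move=> /Dpos /andP[D0 Doo].
have Df : D x \is a fin_num by rewrite ge0_fin_numE // ltW.
rewrite /W -[in X in _ * X](fineK Df) -EFinM powR_inv1 ?fine_ge0 ?ltW //.
rewrite mulVf // gt_eqF //.
by rewrite fine_gt0 // D0.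
Qed.

(** The value at A of every left-invariant measure that takes the value 1 at B. *)
Definition haar_density (A : set T) : \bar R :=
  \int[nu]_y ((\1_(inv @^-1` A `&` G) y)%:E * W (inv y)).

(** Here D x = nu {z | z x in B} and W = 1 / D.  Evaluate the double integral of
      1_A(x) W(x) 1_B(y x)
    for mu in x and nu in y in two ways.  Integrating over y first gives mu A.
    Substituting first x by y^-1 x and then y by x y, which preserve mu and nu,
    turns the integrand into 1_A(y^-1) W(y^-1) 1_B(x), whose integral is mu B
    times a number that involves only nu. *)
Lemma left_invariant_formula A : measurable A ->
  mu A = mu B * haar_density A.
Proof.
move=> mA; rewrite (concentratedE cmu mA) (concentratedE cmu mB).
pose Phi (p : T * T) : \bar R :=
  (\1_(A `&` G) p.1)%:E * W p.1 * (\1_BG p)%:E.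
have mPhi : measurable_fun setT Phi.
  apply: emeasurable_funM; last first.
    by apply/measurable_EFinP; apply: measurable_indic.
  apply: emeasurable_funM; last exact: (measurableT_comp mW).
  apply/measurable_EFinP.
  have m1 : measurable_fun setT (\1_(A `&` G) : T -> R).
    by apply: measurable_indic; exact: measurableI.
  exact: (measurableT_comp m1).
have Phi0 p : 0 <= Phi p.
  by rewrite !mule_ge0 // ?lee_fin // W0.
have mPhi1 x : measurable_fun setT (fun y => Phi (x, y)).
  by apply: (measurableT_comp mPhi); exact: measurable_pair1.
have mPhi2 y : measurable_fun setT (fun x => Phi (x, y)).
  by apply: (measurableT_comp mPhi); exact: measurable_pair2.
transitivity (\int[mu]_x \int[nu]_y Phi (x, y)).
  rewrite -[in LHS](setIT (_ `&` G)) -integral_indic //; last exact: measurableI.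
  apply: eq_integral => x _; rewrite /Phi /=.
  rewrite ge0_integralZl //; last 2 first.
  - apply/measurable_EFinP.
    have m1 : measurable_fun setT (\1_BG : T * T -> R).
      exact: measurable_indic.
    exact: (measurableT_comp m1 (measurable_pair1 x)).
  - by apply: mule_ge0 => //; rewrite lee_fin.
  rewrite -DE -muleA; have [Gx|nGx] := pselect (G x).
    by rewrite WD // mule1.
  by rewrite indicE memNset ?mul0e // => -[].
(* the substitution of x by y^-1 x *)
rewrite fubini_tonelli //.
pose Psi (p : T * T) : \bar R := Phi (op (inv p.2, p.1), p.2).
have mPsi : measurable_fun setT Psi.
  apply: (measurableT_comp mPhi); apply: measurable_fun_pair => //.
  apply: (measurableT_comp mop); apply: measurable_fun_pair => //.
  exact: (measurableT_comp minv).
have -> : \int[nu]_y \int[mu]_x Phi (x, y) = \int[nu]_y \int[mu]_x Psi (x, y).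
  apply: eq_integral => y _; have [Gy|nGy] := pselect (G y).
    by rewrite -(left_invariant_integral imu (invG Gy) (mPhi2 y)).
  rewrite !integral0_eq // => x _; rewrite /Psi /Phi /=.
    by rewrite [X in _ * X%:E]indicE memNset ?mule0 // => -[].
  by rewrite [X in _ * X%:E]indicE memNset ?mule0 // => -[].
rewrite -fubini_tonelli //; last by move=> p; exact: Phi0.
rewrite -[in RHS](setIT (B `&` G)) -integral_indic //; last exact: measurableI.
rewrite muleC -ge0_integralZl //; last 2 first.
- by apply/measurable_EFinP; apply: measurable_indic; exact: measurableI.
- by apply: integral_ge0 => y _; apply: mule_ge0 => //; rewrite lee_fin.
apply: eq_integral => x _; have [Gx|nGx] := pselect (G x); last first.
  rewrite [X in _ * X%:E]indicE memNset ?mule0; last by move=> -[].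
  rewrite integral0_eq // => y _; rewrite /Psi /Phi /=.
  have [Gy|nGy] := pselect (G y); last first.
    by rewrite [X in _ * X%:E]indicE memNset ?mule0 // => -[].
  rewrite [X in X%:E * _ * _]indicE memNset ?mul0e // => -[_ Gz]; apply: nGx.
  by rewrite -(opVK x Gy); exact: opG.
(* the substitution of y by x y *)
rewrite -(left_invariant_integral inu Gx) //; last 2 first.
- by apply: (measurableT_comp mPsi); exact: measurable_pair1.
- by move=> y; exact: Phi0.
rewrite /haar_density muleC -ge0_integralZl //; last 2 first.
- apply: emeasurable_funM; last exact: (measurableT_comp mW minv).
  apply/measurable_EFinP; apply: measurable_indic; apply: measurableI => //.
  by rewrite -[X in measurable X]setTI; exact: minv.
- by move=> y _; apply: mule_ge0 => //; rewrite lee_fin.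
apply: eq_integral => y _; rewrite /Psi /Phi /=.
have [Gy|nGy] := pselect (G y); last first.
  rewrite [X in _ * X%:E = _]indicE memNset ?mule0; last first.
    by move=> [/= Gxy _]; apply: nGy; rewrite -(opKV y Gx); exact/opG/Gxy/invG.
  by rewrite [X in _ = _ * (X%:E * _)]indicE memNset ?mul0e ?mule0 // => -[].
rewrite invMV // muleC; congr (_%:E * (_%:E * _)).
  rewrite !indicE; congr (_%:R); congr nat_of_bool.
  apply/idP/idP; rewrite !inE /BG /=.
    by move=> [_]; rewrite opKr.
  by move=> [Bx _]; split; [exact: opG|rewrite opKr].
rewrite !indicE; congr (_%:R); congr nat_of_bool.
apply/idP/idP; rewrite !inE /=; first by move=> [].
by move=> [Ay _]; split=> //; exact: invG.
Qed.
End Formula.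

(** The formula for mu and for nu itself differ by the factors mu B and nu B. *)
Lemma left_invariant_unique (mu nu : {sigma_finite_measure set T -> \bar R})
    (B : set T) :
  left_invariant mu -> left_invariant nu -> concentrated mu ->
  concentrated nu -> measurable B -> 0 < mu B < +oo -> 0 < nu B < +oo ->
  (forall x, G x -> 0 < nu (G `&` [set z | B (op (z, x))]) < +oo) ->
  exists2 c : R, (0 < c)%R &
    forall A, measurable A -> mu A = c%:E * nu A.
Proof.
move=> imu inu cmu cnu mB muB nuB DB.
have Hmu := left_invariant_formula imu inu cmu mB DB.
have Hnu := left_invariant_formula inu inu cnu mB DB.
have fin (m : {measure set T -> \bar R}) : 0 < m B < +oo ->
    exists2 r : R, (0 < r)%R & m B = r%:E.
  case/andP => p q; exists (fine (m B)); first by rewrite fine_gt0 // p.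
  by rewrite fineK // ge0_fin_numE // ltW.
have [a a0 aE] := fin mu muB; have [b b0 bE] := fin nu nuB.
exists (a / b)%R; first by rewrite divr_gt0.
move=> A mA; rewrite Hmu // Hnu // aE bE muleA -EFinM; congr (_%:E * _).
by rewrite divfK // gt_eqF.
Qed.
End HaarUniqueness.

(** * Haar measures on closed subgroups of GL_n *)

Section MeasureConstructions.
Context d (T : measurableType d) (R : realType).

Section SigmaFinite.
Variables (mu : {measure set T -> \bar R}) (sf : sigma_finite setT mu).
Let sfm : set T -> \bar R := mu.
Let sfm0 : sfm set0 = 0%E. Proof. exact: measure0. Qed.
Let sfm_ge0 A : (0 <= sfm A)%E. Proof. exact: measure_ge0. Qed.
Let sfm_sa : semi_sigma_additive sfm.
Proof. exact: measure_semi_sigma_additive. Qed.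
HB.instance Definition _ := isMeasure.Build _ _ _ sfm sfm0 sfm_ge0 sfm_sa.
HB.instance Definition _ := Measure_isSigmaFinite.Build _ _ _ sfm sf.

Lemma sigma_finite_measureP :
  exists nu : {sigma_finite_measure set T -> \bar R}, forall A, nu A = mu A.
Proof. by exists sfm. Qed.
End SigmaFinite.

Lemma pushforward_restrP d' (T' : measurableType d')
    (mu : {measure set T -> \bar R}) (D : set T) (p : T -> T') :
  measurable D -> measurable_fun setT p ->
  exists nu : {measure set T' -> \bar R},
    forall A, nu A = mu (p @^-1` A `&` D).
Proof. by move=> mD mp; unshelve (exists (pushforward (mrestr mu mD) p)). Qed.
End MeasureConstructions.

Lemma open_preimage_on (S T : topologicalType) (f : S -> T) (Om : set S)
    (V : set T) : open Om -> (forall x, Om x -> {for x, continuous f}) ->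
  open V -> open (Om `&` f @^-1` V).
Proof.
move=> oOm fc oV; rewrite openE => x [Ox Vx]; apply: filterI.
  exact: open_nbhs_nbhs.
by apply: (fc x Ox); exact: open_nbhs_nbhs.
Qed.

Section HaarGL.
Variables (R : realType) (K : topFieldType) (v : K -> R).
Hypotheses (vP : topological_abs v) (lcK : locally_compact [set: K]).

(** A subgroup of GL_n that is closed in GL_n; GL_n itself is not closed in the
    space of matrices. *)
Definition closed_subgroup n (G : set 'M[K]_n) : Prop :=
  [/\ exists2 Z, closed Z & G = Z `&` [set A : 'M[K]_n | A \in unitmx],
      G 1%:M, forall A B, G A -> G B -> G (A *m B) &
      forall A, G A -> G (invmx A)].

Definition mulop n (q : borel 'M[K]_n * borel 'M[K]_n) : borel 'M[K]_n :=
  (q.1 : 'M[K]_n) *m (q.2 : 'M[K]_n).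

(** A Haar measure of G with no mass outside G: integrals over G are then
    integrals over the whole space.  Invariance is stated for preimages, whose
    measurability is immediate. *)
Definition haar_on n (G : set 'M[K]_n)
    (mu : {measure set (borel 'M[K]_n) -> \bar R}) : Prop :=
  [/\ forall C : set 'M[K]_n, compact C -> C `<=` G ->
        (mu (C : set (borel 'M[K]_n)) < +oo)%E,
      forall O : set 'M[K]_n, open O -> O `&` G !=set0 ->
        (0 < mu (O : set (borel 'M[K]_n)))%E,
      @left_invariant _ (borel 'M[K]_n) R G (@mulop n) mu &
      @concentrated _ (borel 'M[K]_n) R G mu].

Lemma haar_on_eq n (G : set 'M[K]_n) (a b : {measure set (borel 'M[K]_n) -> \bar R}) :
  (forall A, a A = b A) -> haar_on G b -> haar_on G a.
Proof.
move=> ab [h1 h2 h3 h4]; split.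
- by move=> C cC CG; rewrite ab h1.
- by move=> O oO OG; rewrite ab h2.
- by move=> g A Gg mA; rewrite !ab h3.
- by rewrite /concentrated ab.
Qed.

Lemma mulmx_continuous n : continuous (fun q : 'M[K]_n * 'M[K]_n => q.1 *m q.2).
Proof.
move=> q; apply: (cvg_mulmx vP (nbhs_filter q)).
  exact: cvg_fst.
exact: cvg_snd.
Qed.

Lemma mulmxr_continuous m n p (A : 'M[K]_(n, p)) :
  continuous (fun B : 'M[K]_(m, n) => B *m A).
Proof.
move=> B; apply: (cvg_mulmx vP (nbhs_filter B)); first exact: cvg_id.
exact: cvg_cst.
Qed.

Lemma mulmxl_continuous m n p (A : 'M[K]_(m, n)) :
  continuous (fun B : 'M[K]_(n, p) => A *m B).
Proof.
move=> B; apply: (cvg_mulmx vP (nbhs_filter B)); last exact: cvg_id.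
exact: cvg_cst.
Qed.

Lemma countable_base_mxK m n : countable_base 'M[K]_(m, n).
Proof. exact/countable_base_mx/(countable_base_abs vP). Qed.

Lemma measurable_mulop n : measurable_fun setT (@mulop n).
Proof.
apply: (@continuous_prod_borel_fun 'M[K]_n 'M[K]_n 'M[K]_n).
- exact: countable_base_mxK.
- exact: countable_base_mxK.
- exact: mulmx_continuous.
Qed.

Lemma invmx_continuous n (A : 'M[K]_n) : A \in unitmx ->
  {for A, continuous (@invmx K n)}.
Proof. by move=> Au; apply: (cvg_invmx vP (nbhs_filter A)) => //; exact: cvg_id. Qed.

Lemma measurable_invmx n :
  measurable_fun setT (@invmx K n : borel 'M[K]_n -> borel 'M[K]_n).
Proof.
apply: (measurability (@open 'M[K]_n : set (set (borel 'M[K]_n)))) => //.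
move=> _ [V oV <-]; rewrite setTI.
have oGL := GL_open vP (n := n).
have -> : @invmx K n @^-1` V =
    ([set A : 'M[K]_n | A \in unitmx] `&` @invmx K n @^-1` V) `|`
    (~` [set A : 'M[K]_n | A \in unitmx] `&` V).
  apply/seteqP; split=> A /=.
    move=> VA; have [Au|nAu] := boolP (A \in unitmx); first by left.
    by right; split; [exact/negP|move: VA; rewrite invmx_out].
  by move=> [[]|[/negP nA]] //; rewrite invmx_out.
apply: measurableU.
  apply: open_borel; apply: open_preimage_on => // A.
  exact: invmx_continuous.
by apply: measurableI; [apply/measurableC|]; exact: open_borel.
Qed.

Lemma closed_borel_compact n (C : set 'M[K]_n) : compact C ->
  measurable (C : set (borel 'M[K]_n)).
Proof.
move=> cC; apply: closed_borel; apply: compact_closed => //.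
exact/hausdorff_mx/(hausdorff_abs vP).
Qed.

Section Subgroup.
Variables (n : nat) (G : set 'M[K]_n).
Hypothesis HG : closed_subgroup G.

Lemma subgroup_unit A : G A -> A \in unitmx.
Proof. by have [[Z _ ->] _ _ _] := HG => -[]. Qed.

Lemma measurable_subgroup : measurable (G : set (borel 'M[K]_n)).
Proof.
have [[Z cZ ->] _ _ _] := HG; apply: measurableI.
  exact: closed_borel.
by apply: open_borel; exact: (GL_open vP).
Qed.

Lemma compact_GLballI t : 0 < t -> compact (GLball v n t `&` G).
Proof.
move=> t0; have [[Z cZ ->] _ _ _] := HG.
have -> : GLball v n t `&` (Z `&` [set A : 'M[K]_n | A \in unitmx]) =
    GLball v n t `&` Z.
  apply/seteqP; split=> A; first by move=> [? []].
  by move=> [tA ZA]; split=> //; split=> //; exact: (GLball_sub vP t0 tA).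
by apply: compact_closedI => //; exact: compact_GLball.
Qed.

Lemma haar_sigma_finite (mu : {measure set (borel 'M[K]_n) -> \bar R}) :
  haar_on G mu -> sigma_finite setT mu.
Proof.
move=> [fmu _ _ cmu].
exists (fun k : nat => (GLball v n k.+1%:R `&` G) `|` ~` G).
  apply/seteqP; split=> A // _; have [GA|nGA] := pselect (G A); last first.
    by exists 0%N => //; right.
  by have [k kA] := GLball_cover vP (subgroup_unit GA); exists k => //; left.
move=> k; have mB : measurable (GLball v n k.+1%:R `&` G : set (borel 'M[K]_n)).
  by apply: closed_borel_compact; apply: compact_GLballI; rewrite ltr0Sn.
have mG := measurable_subgroup.
split; first by apply: measurableU => //; exact: measurableC.
apply: le_lt_trans (measureU2 _ _ _) _ => //; first exact: measurableC.
apply: lte_add_pinfty; last by rewrite [ltLHS]cmu ltry.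
by apply: fmu; [exact: compact_GLballI|move=> A []].
Qed.

Lemma haar_GLball (mu : {measure set (borel 'M[K]_n) -> \bar R}) : haar_on G mu ->
  (0 < mu (GLball v n 2 `&` G : set (borel 'M[K]_n)) < +oo)%E.
Proof.
move=> [fmu pmu _ cmu]; have mG := measurable_subgroup; have [_ G1 _ _] := HG.
have cB : compact (GLball v n 2 `&` G) by exact: compact_GLballI.
have mB := closed_borel_compact cB.
apply/andP; split; last by apply: fmu => // A [].
apply: (@lt_le_trans _ _ (mu ((GLball v n 2)° : set (borel 'M[K]_n)))).
  apply: pmu; [exact: open_interior|exists 1%:M; split=> //].
  exact: (GLball_nbhs1 vP).
have mI : measurable ((GLball v n 2)° : set (borel 'M[K]_n)).
  by apply: open_borel; exact: open_interior.
rewrite (concentratedE mG cmu) //; apply: le_measure; rewrite ?inE //.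
  exact: measurableI.
by move=> A [/interior_subset ? ?].
Qed.

(** The test set B of left_invariant_unique is the intersection of G with a
    compact neighbourhood of 1. *)
Lemma haar_on_unique (mu nu : {measure set (borel 'M[K]_n) -> \bar R}) :
  haar_on G mu -> haar_on G nu ->
  exists2 c : R, 0 < c &
    forall A : set (borel 'M[K]_n), measurable A -> mu A = (c%:E * nu A)%E.
Proof.
move=> hmu hnu.
have [mu' Emu] := sigma_finite_measureP (haar_sigma_finite hmu).
have [nu' Enu] := sigma_finite_measureP (haar_sigma_finite hnu).
have {}hmu := haar_on_eq Emu hmu; have [fmu pmu imu cmu] := hmu.
have {}hnu := haar_on_eq Enu hnu; have [fnu pnu inu cnu] := hnu.
have mG := measurable_subgroup.
have [_ G1 GM GV] := HG.
have Gu := subgroup_unit.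
have cB : compact (GLball v n 2 `&` G) by exact: compact_GLballI.
have mB := closed_borel_compact cB.
have nbB : nbhs (1%:M : 'M[K]_n) (GLball v n 2)° by exact/nbhs_interior/(GLball_nbhs1 vP).
have DB x : G x -> (0 < nu' (G `&` [set z | (GLball v n 2 `&` G) (@mulop n (z, x))]) < +oo)%E.
  move=> Gx.
  set D := G `&` _.
  have E : D = (fun z : 'M[K]_n => z *m invmx x) @` (GLball v n 2 `&` G).
    apply/seteqP; split=> z.
      move=> [Gz Bz]; exists (z *m x) => //.
      by rewrite mulmxK ?Gu.
    move=> [y By <-]; split; first by apply: GM; [case: By|exact: GV].
    by rewrite /= /mulop /= mulmxKV ?Gu.
  have cE : compact (D : set 'M[K]_n).
    rewrite E; apply: continuous_compact => //; apply: continuous_subspaceT.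
    exact: mulmxr_continuous.
  apply/andP; split; last by apply: fnu => // z [].
  pose O : set 'M[K]_n := (fun z : 'M[K]_n => z *m x) @^-1` (GLball v n 2)°.
  have oO : open O.
    by apply: open_comp; [move=> z _; exact: mulmxr_continuous|exact: open_interior].
  apply: (@lt_le_trans _ _ (nu' O)).
    apply: pnu => //; exists (invmx x); split; last exact: GV.
    by rewrite /O /= mulVmx ?Gu //; exact: nbhs_singleton.
  rewrite (concentratedE mG cnu) //; last exact: open_borel.
  apply: le_measure; rewrite ?inE.
  - by apply: measurableI => //; exact: open_borel.
  - exact: closed_borel_compact.
  - move=> z [Oz Gz]; split=> //; split; first exact: interior_subset.
    exact: GM.
have invMV (x y : 'M[K]_n) : G x -> G y -> invmx (x *m y) *m x = invmx y.
  by move=> /Gu xu /Gu yu; rewrite invmxM // mulmxKV.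
have [c c0 cE] := @left_invariant_unique _ (borel 'M[K]_n) R G (@mulop n)
  (@invmx K n) mG (@measurable_mulop n) (@measurable_invmx n) GM GV
  (fun x y Gx Gy => mulmxK (Gu _ Gy) x) (fun x y Gx => mulKVmx (Gu _ Gx) y)
  (fun x y Gx => mulKmx (Gu _ Gx) y) invMV mu' nu'
  (GLball v n 2 `&` G) imu inu cmu cnu mB (haar_GLball hmu)
  (haar_GLball hnu) DB.
by exists c => // A mA; rewrite -Emu -Enu cE.
Qed.

(** Every group of the theorem is isomorphic, as a topological group, to a closed
    subgroup of some GL_n(K); this lemma carries its Haar measures over. *)
Lemma haar_push (T : ptopologicalType) (op : T -> T -> T) (Gs : set T)
    (mu : {measure set (borel T) -> \bar R}) (p : T -> 'M[K]_n)
    (s : 'M[K]_n -> T) :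
  haar_measure op Gs mu -> measurable (Gs : set (borel T)) ->
  continuous p -> (forall y, G y -> {for y, continuous s}) ->
  (forall x, Gs x -> G (p x)) -> (forall y, G y -> Gs (s y)) ->
  (forall x, Gs x -> s (p x) = x) -> (forall y, G y -> p (s y) = y) ->
  (forall x y, Gs x -> Gs y -> Gs (op x y)) ->
  (forall x y, Gs x -> Gs y -> p (op x y) = p x *m p y) ->
  exists2 nu : {measure set (borel 'M[K]_n) -> \bar R}, haar_on G nu &
    forall A, nu A = mu (p @^-1` A `&` Gs : set (borel T)).
Proof.
move=> [fmu pmu imu] mGs pc sc pG sG sK pK opG pM.
have mp := continuous_borel_fun pc.
have [nu nuE] := pushforward_restrP mu mGs mp.
exists nu => //; have [_ G1 GM GV] := HG.
split.
- move=> C cC CG; rewrite nuE.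
  have -> : p @^-1` C `&` Gs = s @` C.
    apply/seteqP; split=> [x [Cx Gx]|_ [y Cy <-]].
      by exists (p x) => //; exact: sK.
    by split; [rewrite /= pK //; exact: CG|exact/sG/CG].
  apply: fmu; last by move=> _ [y Cy <-]; exact/sG/CG.
  apply: continuous_compact => //; apply: continuous_in_subspaceT => y.
  by rewrite inE => /CG; exact: sc.
- move=> O oO [y [Oy Gy]]; rewrite nuE; apply: pmu.
    by apply: open_comp => // x _; exact: pc.
  by exists (s y); split; [rewrite /= pK|exact: sG].
- move=> g A Gg mA; rewrite !nuE.
  have mS (B : set (borel 'M[K]_n)) : measurable B -> measurable (p @^-1` B `&` Gs : set (borel T)).
    by move=> mB; apply: measurableI => //; rewrite -[X in measurable X]setTI; exact: mp.
  have mgA : measurable ((fun x : borel 'M[K]_n => @mulop n (g, x)) @^-1` A).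
    rewrite -[X in measurable X]setTI.
    have h : measurable_fun setT (fun x : borel 'M[K]_n => @mulop n (g, x)).
      by apply: (measurableT_comp (@measurable_mulop n)); exact: measurable_pair1.
    exact: h.
  rewrite -(imu (s g)); [|exact: sG|exact: mS|by move=> ? []].
  congr (mu _); apply/seteqP; split=> [_ [x [Ax Gx] <-]|z [Az Gz]].
    by split; [rewrite /= pM ?pK //; exact: sG|apply: opG => //; exact: sG].
  have Gpz := pG z Gz; have gu := subgroup_unit Gg.
  have Ggz : G (invmx g *m p z) by apply: GM => //; exact: GV.
  exists (s (invmx g *m p z)).
    split; last exact: sG.
    by rewrite /= /mulop /= pK // mulKVmx.
  rewrite -[LHS]sK ?pM ?pK ?mulKVmx ?sK //; try exact: sG.
  by apply: opG; exact: sG.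
- rewrite /concentrated nuE (_ : _ `&` _ = set0) ?measure0 //.
  by apply/seteqP; split=> x // [nG /pG].
Qed.

End Subgroup.

End HaarGL.

Section PushIntegral.
Context d1 d2 (T1 : measurableType d1) (T2 : measurableType d2) (R : realType).
Variables (mu : {measure set T1 -> \bar R}) (nu : {measure set T2 -> \bar R}).
Variables (D : set T1) (p : T1 -> T2).
Hypotheses (mD : measurable D) (mp : measurable_fun setT p).
Hypothesis nuE : forall A, measurable A -> nu A = mu (p @^-1` A `&` D).
Local Open Scope ereal_scope.

Lemma ge0_integral_push (f : T2 -> \bar R) : measurable_fun setT f ->
  (forall y, 0 <= f y) -> \int[mu]_(x in D) f (p x) = \int[nu]_y f y.
Proof.
move=> mf f0.
have [nu' nu'E] := pushforward_restrP mu mD mp.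
pose rD := mrestr mu mD.
transitivity (\int[rD]_x f (p x)).
  rewrite -[in RHS](setUv D) ge0_integral_setU //=; first last.
  - by rewrite disj_set2E setICr.
  - by rewrite setUv; exact: (measurableT_comp mf).
  - exact: measurableC.
  rewrite [X in _ + X](_ : _ = 0) ?adde0.
    apply: eq_measure_integral => A mA AD; rewrite /rD /= /mrestr.
    by have -> : A `&` D = A by apply/seteqP; split=> x; [case|split=> //; exact: AD].
  rewrite (eq_measure_integral mzero) ?integral_measure_zero // => A mA AD.
  by rewrite /rD /= /mrestr (_ : A `&` D = set0) ?measure0 //;
    apply/seteqP; split=> x // [/AD].
have := @ge0_integral_pushforward _ _ _ _ _ _ mp rD setT f measurableT mf.
rewrite preimage_setT => H; apply: (etrans (esym (H _))).
  by move=> x _; exact: f0.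
by apply: eq_measure_integral => A mA _; rewrite nuE.
Qed.

Lemma integral_push (f : T2 -> \bar R) : measurable_fun setT f ->
  \int[mu]_(x in D) f (p x) = \int[nu]_y f y.
Proof.
move=> mf; rewrite integralE [RHS]integralE.
have hp := ge0_integral_push (measurable_funepos mf) (funepos_ge0 f).
have hn := ge0_integral_push (measurable_funeneg mf) (funeneg_ge0 f).
by rewrite -hp -hn; congr (_ - _); apply: eq_integral => x _;
  rewrite unlock.
Qed.

Lemma Rintegral_push (f : T2 -> R) : measurable_fun setT f ->
  Rintegral mu D (fun x => f (p x)) = Rintegral nu setT f.
Proof.
move=> mf; rewrite /Rintegral; congr fine.
by rewrite -(integral_push (f := EFin \o f)) //; exact/measurable_EFinP.
Qed.

End PushIntegral.

(** * The unipotent radical and the Levi subgroup GL_m *)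

Section BlockGroups.
Variables (A : comUnitRingType) (m r : nat).
Local Notation n := (ndim m r).
Implicit Types (u a Z : 'M[A]_n) (i j k : 'I_n).

Lemma block_homo i j : (i <= j)%N -> (block i <= block j)%N.
Proof.
rewrite /block; move: (ltn_ord i) (ltn_ord j); rewrite /ndim.
by repeat (case: ifP => ?); lia.
Qed.

Lemma block_le i : (block i <= r + r)%N.
Proof.
by rewrite /block; move: (ltn_ord i); rewrite /ndim; repeat (case: ifP => ?); lia.
Qed.

Lemma block_iv (i : 'I_r) : block (iv m i) = i.
Proof. by rewrite /block /= ltn_ord. Qed.

Lemma block_iw0 : block (iw0 m r) = r.
Proof. by rewrite /block /=; repeat (case: ifP => ?); lia. Qed.

Lemma block_cen (x : 'I_(m + 1)) : block (rshift r (lshift r x) : 'I_n) = r.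
Proof. by rewrite /block /=; have := ltn_ord x; repeat (case: ifP => ?); lia. Qed.

Lemma block_ivc (i : 'I_r) : block (ivc m i) = (r + r - i)%N.
Proof. by rewrite /block /=; have := ltn_ord i; repeat (case: ifP => ?); lia. Qed.

(** It reverses the order of the blocks but fixes the middle block pointwise; the
    corresponding permutation matrix therefore commutes with GL_m. *)
Definition mirror i : 'I_n := if block i == r then i else rev_ord i.

Lemma block_mirror i : block (mirror i) = (r + r - block i)%N.
Proof.
rewrite /mirror; case: eqP => [->|]; first by lia.
rewrite /block /=; move: (ltn_ord i); rewrite {1}/ndim.
have -> : (n - i.+1)%N = (r + (m + 1 + r) - i.+1)%N by [].
by repeat (case: ifP => ?); lia.
Qed.

Lemma mirrorK : involutive mirror.
Proof.
move=> i; rewrite /mirror; case: (eqVneq (block i) r) => [->|bi]; first by rewrite eqxx.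
case: eqP => [e|_]; last exact: rev_ordK.
have := block_mirror i; rewrite /mirror (negbTE bi) e => e'.
by move: bi; have := block_le i; lia.
Qed.

(** Urad over an arbitrary ring: over K x K it is Urad, over K it is N. *)
Definition Nset : set 'M[A]_n :=
  [set u | forall i j, (block j <= block i)%N -> u i j = (i == j)%:R].

Definition antidiag Z := forall i j, (block i + block j)%N != (r + r)%N -> Z i j = 0.
Definition blockdiag Z := forall i j, block i != block j -> Z i j = 0.

Lemma Nset1 : Nset 1%:M.
Proof. by move=> i j _; rewrite mxE. Qed.

Lemma Nset_sub1 u i j : Nset u -> (block j <= block i)%N -> (u - 1%:M) i j = 0.
Proof. by move=> Nu ij; rewrite !mxE Nu // subrr. Qed.

Lemma NsetP u : (forall i j, (block j <= block i)%N -> (u - 1%:M) i j = 0) ->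
  Nset u.
Proof.
by move=> H i j /H; rewrite !mxE => /eqP; rewrite subr_eq0 => /eqP.
Qed.

(** Entries at most one block above the diagonal add up, since in the other terms
    of the product one factor vanishes; linear forms in them are characters. *)
Lemma Nset_mulE u a i j : Nset u -> Nset a -> (block j <= (block i).+1)%N ->
  i != j -> (u *m a) i j = u i j + a i j.
Proof.
move=> Nu Na ij nij; rewrite mxE (bigD1 i) //= (bigD1 j) 1?eq_sym //= big1.
  by rewrite addr0 (Nu i i) // eqxx mul1r (Na j j) // eqxx mulr1 addrC.
move=> k /andP[ki kj]; have [ik|ik] := leqP (block k) (block i).
  by rewrite Nu // eq_sym (negbTE ki) mul0r.
by rewrite (Na k j) ?(negbTE kj) ?mulr0 //; lia.
Qed.

Lemma NsetM u a : Nset u -> Nset a -> Nset (u *m a).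
Proof.
move=> Nu Na i j ij; have [<-|nij] := eqVneq i j; last first.
  by rewrite Nset_mulE ?Nu ?Na ?(negbTE nij) ?addr0 //; lia.
rewrite mxE (bigD1 i) //= big1; first by rewrite Nu // Na // eqxx mulr1 addr0.
move=> k ki; have [ik|ik] := leqP (block k) (block i).
  by rewrite Nu // eq_sym (negbTE ki) mul0r.
by rewrite (Na k i) ?(negbTE ki) ?mulr0 //; lia.
Qed.

Lemma Nset_det u : Nset u -> \det u = 1.
Proof.
move=> Nu; rewrite -det_tr det_trig; last first.
  apply/is_trig_mxP => i j ij; rewrite mxE Nu.
    by rewrite -val_eqE /= gtn_eqF.
  by apply: block_homo; apply: ltnW.
by rewrite big1 // => i _; rewrite mxE Nu // eqxx.
Qed.

Lemma Nset_unit u : Nset u -> u \in unitmx.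
Proof. by move=> /Nset_det du; rewrite unitmxE du unitr1. Qed.

Lemma Nset_adj u : Nset u -> invmx u = \adj u.
Proof. by move=> Nu; rewrite /invmx Nset_unit // Nset_det // invr1 scale1r. Qed.

Lemma NsetV u : Nset u -> Nset (invmx u).
Proof.
move=> Nu; have uu := Nset_unit Nu; set w := invmx u.
(* by induction from the last block of rows upwards *)
have H d i j : (r + r - block i < d)%N -> (block j <= block i)%N -> w i j = (i == j)%:R.
  elim: d i j => // d IH i j id ij.
  have : (u *m w) i j = (i == j)%:R by rewrite mulmxV // mxE.
  rewrite mxE (bigD1 i) //= Nu // eqxx mul1r big1 ?addr0 // => k ki.
  have [ik|ik] := leqP (block k) (block i).
    by rewrite Nu // eq_sym (negbTE ki) mul0r.
  rewrite IH; first 1 last; first by have := block_le k; lia.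
    by apply: leq_trans ij _; exact: ltnW.
  case: eqP => [kj|_]; last by rewrite mulr0.
  by move: ik; rewrite kj ltnNge ij.
by move=> i j ij; apply: H ij.
Qed.

Lemma Nset_invE u i j : Nset u -> (block j <= (block i).+1)%N -> i != j ->
  (invmx u) i j = - u i j.
Proof.
move=> Nu ij nij; apply/eqP; rewrite -addr_eq0 addrC -Nset_mulE //; last exact: NsetV.
by rewrite mulmxV ?Nset_unit // mxE (negbTE nij).
Qed.

Lemma conj_sub1 u (Y Z : 'M[A]_n) : Y *m Z = 1%:M ->
  Y *m u *m Z - 1%:M = Y *m (u - 1%:M) *m Z.
Proof. by move=> YZ; rewrite mulmxBr mulmxBl mulmx1 YZ. Qed.

Lemma conj_entry0 (Y Z X : 'M[A]_n) (P : 'I_n -> 'I_n -> Prop) i j :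
  (forall k l, P k l \/ Y i k * X k l * Z l j = 0) ->
  (forall k l, P k l -> X k l = 0) -> (Y *m X *m Z) i j = 0.
Proof.
move=> H HP; rewrite mxE big1 // => l _; rewrite mxE mulr_suml big1 // => k _.
by have [/HP ->|//] := H k l; rewrite mulr0 mul0r.
Qed.

(** Conjugation by a block antidiagonal matrix exchanges the two opposite
    unipotent radicals. *)
Lemma antidiag_conj u (Y Z : 'M[A]_n) : antidiag Y -> antidiag Z ->
  Y *m Z = 1%:M -> Nset u -> Nset (Y *m u *m Z)^T.
Proof.
move=> aY aZ YZ Nu; apply: NsetP => i j ij.
have -> : (Y *m u *m Z)^T - 1%:M = (Y *m (u - 1%:M) *m Z)^T.
  by rewrite -conj_sub1 // linearB /= trmx1.
rewrite mxE; apply: (@conj_entry0 _ _ _ (fun k l => (block l <= block k)%N)); last first.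
  by move=> k l; exact: Nset_sub1.
move=> k l; have [jk|jk] := eqVneq (block j + block k)%N (r + r)%N; last first.
  by right; rewrite aY // !mul0r.
have [li|li] := eqVneq (block l + block i)%N (r + r)%N; last first.
  by right; rewrite aZ // mulr0.
by left; lia.
Qed.

Lemma blockdiag_conj u (Y Z : 'M[A]_n) : blockdiag Y -> blockdiag Z ->
  Y *m Z = 1%:M -> Nset u -> Nset (Y *m u *m Z).
Proof.
move=> aY aZ YZ Nu; apply: NsetP => i j ij; rewrite conj_sub1 //.
apply: (@conj_entry0 _ _ _ (fun k l => (block l <= block k)%N)); last first.
  by move=> k l; exact: Nset_sub1.
move=> k l; have [ik|ik] := eqVneq (block i) (block k); last first.
  by right; rewrite aY // !mul0r.
have [lj|lj] := eqVneq (block l) (block j); last first.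
  by right; rewrite aZ // mulr0.
by left; lia.
Qed.

(** On the antidiagonal blocks z a agrees with z and u z' with z', as the entries
    of u and a off the diagonal do not contribute there. *)
Lemma antidiag_unique (z z' u a : 'M[A]_n) : antidiag z -> antidiag z' ->
  Nset u -> Nset a -> z *m a = u *m z' -> z = z'.
Proof.
move=> az az' Nu Na E; apply/matrixP => i j.
have [ij|ij] := eqVneq (block i + block j)%N (r + r)%N; last by rewrite az ?az'.
have := congr1 (fun M : 'M[A]_n => M i j) E; rewrite !mxE.
rewrite (bigD1 j) //= Na // eqxx mulr1 big1 ?addr0; last first.
  move=> k kj; have [ik|ik] := eqVneq (block i + block k)%N (r + r)%N; last first.
    by rewrite az // mul0r.
  by rewrite Na ?(negbTE kj) ?mulr0 //; lia.
move=> ->; rewrite (bigD1 i) //= Nu // eqxx mul1r big1 ?addr0 //.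
move=> k ki; have [jk|jk] := eqVneq (block k + block j)%N (r + r)%N; last first.
  by rewrite az' // mulr0.
by rewrite Nu 1?eq_sym ?(negbTE ki) ?mul0r //; lia.
Qed.

(** The automorphism u |-> w u^-T w of N, for w the permutation matrix of mirror.
    The adjugate stands for the inverse, with which it agrees on N, to make the
    map continuous on all matrices. *)
Definition flip u : 'M[A]_n := \matrix_(i, j) (\adj u) (mirror j) (mirror i).

Lemma flipE u : Nset u -> flip u = \matrix_(i, j) (invmx u) (mirror j) (mirror i).
Proof. by move=> Nu; apply/matrixP => i j; rewrite !mxE Nset_adj // mxE. Qed.

Lemma Nset_flip u : Nset u -> Nset (flip u).
Proof.
move=> Nu i j ij; rewrite flipE // mxE NsetV //; last by rewrite !block_mirror; lia.
by rewrite (can_eq mirrorK) eq_sym.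
Qed.

Lemma flipM u a : Nset u -> Nset a -> flip (u *m a) = flip u *m flip a.
Proof.
move=> Nu Na; rewrite !flipE //; last exact: NsetM.
have uu := Nset_unit Nu; have aa := Nset_unit Na.
rewrite invmxM //.
apply/matrixP => i j; rewrite !mxE (reindex_inj (inv_inj mirrorK)) /=.
by apply: eq_bigr => k _; rewrite !mxE mulrC.
Qed.

Lemma flipK u : Nset u -> flip (flip u) = u.
Proof.
move=> Nu; have Nf := Nset_flip Nu.
have E : invmx (flip u) = \matrix_(i, j) u (mirror j) (mirror i).
  apply: mulmx1_inv; apply/matrixP => i j; rewrite flipE // !mxE.
  rewrite (reindex_inj (inv_inj mirrorK)) /=.
  under eq_bigr do rewrite !mxE mirrorK mulrC.
  have := congr1 (fun M : 'M[A]_n => M (mirror j) (mirror i)) (mulmxV (Nset_unit Nu)).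
  by rewrite !mxE => ->; rewrite (can_eq mirrorK) eq_sym.
by rewrite flipE // E; apply/matrixP => i j; rewrite !mxE !mirrorK.
Qed.

(** embGL over any ring. *)
Definition levi (g : 'M[A]_m) : 'M[A]_n :=
  block_mx 1%:M 0 0 (block_mx (block_mx g 0 0 1%:M) 0 0 1%:M).

Lemma levi1 : levi 1%:M = 1%:M.
Proof. by rewrite /levi -!scalar_mx_block. Qed.

Lemma leviM g h : levi (g *m h) = levi g *m levi h.
Proof. by rewrite /levi !mulmx_block ?(mulmx0, mul0mx, addr0, add0r, mul1mx, mulmx1). Qed.

Lemma levi_unit g : g \in unitmx -> levi g \in unitmx.
Proof.
move=> gu; have H : levi g *m levi (invmx g) = 1%:M by rewrite -leviM mulmxV // levi1.
by have [] := mulmx1_unit H.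
Qed.

Lemma leviV g : g \in unitmx -> invmx (levi g) = levi (invmx g).
Proof.
by move=> gu; apply: mulmx1_inv; rewrite -leviM mulmxV // levi1.
Qed.

Lemma leviJV g u : g \in unitmx -> u \in unitmx ->
  invmx (levi g *m u *m levi (invmx g)) = levi g *m invmx u *m levi (invmx g).
Proof.
move=> gu uu; have eu := levi_unit gu; rewrite -leviV //; apply: mulmx1_inv.
by rewrite !mulmxA mulmxKV // mulmxK // mulmxV.
Qed.

Lemma levi_tr g : (levi g)^T = levi g^T.
Proof. by rewrite /levi !tr_block_mx !trmx0 !trmx1. Qed.

(** The coordinates that the Levi subgroup GL_m leaves fixed. *)
Definition outer i := (exists i' : 'I_r, i = iv m i') \/
  i = iw0 m r \/ (exists i' : 'I_r, i = ivc m i').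

Lemma levi_row g i k : outer i -> levi g i k = (i == k)%:R.
Proof.
rewrite /levi; move=> [[i' ->]|[->|[i' ->]]]; rewrite -(inj_eq val_inj).
- case: (split_ordP k) => k' ->; rewrite ?block_mxEul ?block_mxEur !mxE //=.
  by have := ltn_ord i'; case: eqP => [e|//]; lia.
- case: (split_ordP k) => k' ->.
    by rewrite block_mxEdl mxE gtn_eqF // (leq_trans (ltn_ord k')) // leq_addr.
  rewrite block_mxEdr; case: (split_ordP k') => k2 ->; last first.
    rewrite block_mxEur mxE /=; have := ltn_ord k2.
    by case: eqP => // e; lia.
  rewrite block_mxEul; case: (split_ordP k2) => k3 ->.
    rewrite block_mxEdl mxE /=; have := ltn_ord k3.
    by case: eqP => // e; lia.
  by rewrite block_mxEdr !ord1 mxE !eqxx.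
- case: (split_ordP k) => k' ->.
    by rewrite block_mxEdl mxE gtn_eqF // (leq_trans (ltn_ord k')) // leq_addr.
  rewrite block_mxEdr; case: (split_ordP k') => k2 ->.
    rewrite block_mxEdl mxE /=; have := ltn_ord k2.
    by case: eqP => // e; lia.
  by rewrite block_mxEdr mxE -(inj_eq val_inj) /= !eqn_add2l.
Qed.

Lemma outer_block i : block i != r -> outer i.
Proof.
case: (split_ordP i) => [j ->|j ->] b; first by left; exists j.
case: (split_ordP j) b => [k ->|k ->] b; last first.
  by right; right; exists (rev_ord k); rewrite /ivc rev_ordK.
by case/negP: b; rewrite block_cen.
Qed.

Lemma levi_col g i k : outer i -> levi g k i = (k == i)%:R.
Proof.
by move=> oi; have := levi_row g^T k oi; rewrite -levi_tr mxE eq_sym.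
Qed.

Lemma levi_blockdiag g : blockdiag (levi g).
Proof.
move=> i j; rewrite /levi.
case: (split_ordP i) => i1 ->; case: (split_ordP j) => j1 ->.
- by rewrite block_mxEul mxE; case: (eqVneq i1 j1) => [->|//]; rewrite eqxx.
- by rewrite block_mxEur mxE.
- by rewrite block_mxEdl mxE.
rewrite block_mxEdr.
case: (split_ordP i1) => i2 ->; case: (split_ordP j1) => j2 ->.
- by rewrite !block_cen eqxx.
- by rewrite block_mxEur mxE.
- by rewrite block_mxEdl mxE.
- by rewrite block_mxEdr mxE; case: (eqVneq i2 j2) => [->|//]; rewrite eqxx.
Qed.

Lemma Nset_levi g u : g \in unitmx -> Nset u ->
  Nset (levi g *m u *m levi (invmx g)).
Proof.
move=> gu; apply: blockdiag_conj; try exact: levi_blockdiag.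
by rewrite -leviM mulmxV // levi1.
Qed.

Lemma levi_conj_outer g u i j : outer i -> outer j ->
  (levi g *m u *m levi (invmx g)) i j = u i j.
Proof.
move=> oi oj; rewrite mxE (bigD1 j) //= levi_col // eqxx mulr1 big1 ?addr0; last first.
  by move=> k kj; rewrite levi_col // (negbTE kj) mulr0.
rewrite mxE (bigD1 i) //= levi_row // eqxx mul1r big1 ?addr0 //.
by move=> k ki; rewrite levi_row // eq_sym (negbTE ki) mul0r.
Qed.

Lemma flip_levi g u : g \in unitmx -> Nset u ->
  flip (levi g *m u *m levi (invmx g)) =
  levi (invmx g)^T *m flip u *m levi (invmx (invmx g)^T).
Proof.
move=> gu Nu; have NguV := Nset_levi gu Nu.
have gVu : invmx g \in unitmx by rewrite unitmx_inv.
have gTu : (invmx g)^T \in unitmx by rewrite unitmx_tr.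
have -> : invmx (invmx g)^T = g^T by rewrite -trmx_inv invmxK.
(* the permutation matrix w commutes with the Levi subgroup *)
have fixL h i j : levi h (mirror i) (mirror j) = levi h i j.
  have [bi|bi] := eqVneq (block i) r; last first.
    have oi := outer_block bi.
    have om : outer (mirror i) by apply: outer_block; rewrite block_mirror; have := block_le i; lia.
    by rewrite !levi_row // (can_eq mirrorK).
  have [bj|bj] := eqVneq (block j) r; first by rewrite /mirror bi bj eqxx.
  rewrite !levi_blockdiag ?block_mirror ?bi 1?eq_sym //.
  by have := block_le j; lia.
have -> : flip (levi g *m u *m levi (invmx g)) =
    \matrix_(i, j) (levi g *m invmx u *m levi (invmx g)) (mirror j) (mirror i).
  rewrite flipE //; apply/matrixP => i j; rewrite !mxE.
  by rewrite leviJV ?Nset_unit // !mxE.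
rewrite flipE //; apply/matrixP => i j; rewrite !mxE.
rewrite (reindex_inj (inv_inj mirrorK)) /=; under eq_bigr do rewrite mxE fixL mulr_suml.
under [RHS]eq_bigr do rewrite mxE mulr_suml.
rewrite exchange_big [LHS](reindex_inj (inv_inj mirrorK)) /=; apply: eq_bigr => k _.
apply: eq_bigr => l _.
rewrite fixL -!levi_tr !mxE; ring.
Qed.
End BlockGroups.

(** * Characters of GL_m and transposition *)

Section TransposeInvariance.
Variables (K : fieldType) (R : fieldType) (t : K).
Hypotheses (t0 : t != 0) (t1 : 1 + t != 0).

Definition mult_character m (chi : 'M[K]_m -> R) : Prop :=
  (forall g, g \in unitmx -> chi g != 0) /\
  (forall g h, g \in unitmx -> h \in unitmx -> chi (g *m h) = chi g * chi h).

(** Conjugation by diag(s, 1) turns the transvection u(x) into u(s x), for s = t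
    and for s = 1 + t.  As u((1 + t) x) = u(x) u(t x), the value of chi at u(x)
    equals its own square, so it is 1. *)
Lemma chi_block m (chi : 'M[K]_(1 + m) -> R) : mult_character chi ->
  forall b, chi (block_mx 1%:M b 0 1%:M) = 1.
Proof.
move=> [chi0 chiM].
have idem (g : 'M[K]_(1 + m)) : g \in unitmx -> chi g * chi g = chi g -> chi g = 1.
  by move=> gu e; apply: (mulfI (chi0 _ gu)); rewrite e mulr1.
have conj (g h d : 'M[K]_(1 + m)) : g \in unitmx -> d \in unitmx ->
    h *m d = d *m g -> chi h = chi g.
  move=> gu du e; have hE : h = d *m g *m invmx d by rewrite -e mulmxK.
  have hu : h \in unitmx by rewrite hE !unitmx_mul du gu unitmx_inv.
  by apply: (mulIf (chi0 _ du)); rewrite -chiM // e chiM // mulrC.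
have Uu y : (block_mx 1%:M y 0 1%:M : 'M[K]_(1 + m)) \in unitmx.
  by rewrite unitmxE det_ublock !det1 mulr1 unitr1.
have UM y z : (block_mx 1%:M y 0 1%:M : 'M[K]_(1 + m)) *m block_mx 1%:M z 0 1%:M =
   block_mx 1%:M (y + z) 0 1%:M.
  by rewrite mulmx_block !(mulmx0, mul0mx, addr0, add0r, mul1mx, mulmx1) addrC.
have DU s y : s != 0 -> chi (block_mx 1%:M (s *: y) 0 1%:M) = chi (block_mx 1%:M y 0 1%:M).
  move=> s0; pose Ds : 'M[K]_(1 + m) := block_mx s%:M 0 0 1%:M.
  apply: (conj _ _ Ds) => //.
    by rewrite unitmxE det_ublock det_scalar1 det1 mulr1 unitfE.
  rewrite !mulmx_block !(mulmx0, mul0mx, addr0, add0r, mul1mx, mulmx1).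
  by rewrite mul_scalar_mx.
move=> x; apply: idem => //; rewrite -{2}(DU _ x t0) -chiM // UM.
by rewrite -[X in X + _]scale1r -scalerDl DU.
Qed.

(** Elimination writes g as a product of transvections, at which the character is
    trivial, and a block diagonal matrix diag(x, S); induction applies to S. *)
Lemma chi_trmx m (chi : 'M[K]_m -> R) : mult_character chi ->
  forall g, g \in unitmx -> chi g^T = chi g.
Proof.
elim: m chi => [|m IH].
  by move=> chi _ g _; congr chi; apply/matrixP => -[].
suff H (chi : 'M[K]_(1 + m) -> R) : mult_character chi ->
    forall g : 'M[K]_(1 + m), g \in unitmx -> chi g^T = chi g by exact: H.
move=> hchi g gu.
have [chi0 chiM] := hchi.
have chiU := @chi_block m chi hchi.
have chiL c : chi (block_mx 1%:M 0 c 1%:M) = 1.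
  have hT : mult_character (fun g : 'M[K]_(1 + m) => chi g^T).
    split=> [x xu|x y xu yu]; first by rewrite chi0 // unitmx_tr.
    by rewrite trmx_mul chiM ?unitmx_tr // mulrC.
  by have := @chi_block m _ hT c^T; rewrite tr_block_mx !trmx1 trmx0 trmxK.
have Uu (y : 'M[K]_(1, m)) : (block_mx 1%:M y 0 1%:M : 'M[K]_(1 + m)) \in unitmx.
  by rewrite unitmxE det_ublock !det1 mulr1 unitr1.
have Lu (y : 'M[K]_(m, 1)) : (block_mx 1%:M 0 y 1%:M : 'M[K]_(1 + m)) \in unitmx.
  by rewrite unitmxE det_lblock !det1 mulr1 unitr1.
(* a row operation makes the corner entry nonzero *)
have [b ab] : exists b : 'M[K]_(1, m),
    (ulsubmx (g : 'M[K]_(1 + m)) + b *m dlsubmx (g : 'M[K]_(1 + m))) ord0 ord0 != 0.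
  have [a0|a0] := eqVneq (ulsubmx (g : 'M[K]_(1 + m)) ord0 ord0) 0; last first.
    by exists 0; rewrite mul0mx addr0.
  have [i ci] : exists i, dlsubmx (g : 'M[K]_(1 + m)) i ord0 != 0.
    apply: contrapT => /forallNP c1.
    have c0 i : dlsubmx (g : 'M[K]_(1 + m)) i ord0 = 0.
      by apply/eqP/negPn/negP => ci; apply: (c1 i).
    have : g *m delta_mx (lshift m ord0) ord0 = 0 :> 'cV[K]_(1 + m).
      apply/matrixP => i j; rewrite ord1 mxE (bigD1 (lshift m ord0)) //= big1.
        rewrite [delta_mx _ _ _ _]mxE (ord1 j) !eqxx mulr1 addr0 [RHS]mxE.
        case: (split_ordP i) => i' ->.
          rewrite (ord1 i'); move: a0; by rewrite !mxE.
        by have := c0 i'; rewrite !mxE.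
      by move=> k k0; rewrite mxE (negbTE k0) mulr0.
    move=> /(congr1 (mulmx (invmx g))); rewrite mulKmx // mulmx0.
    move=> /(congr1 (fun M : 'cV[K]_(1 + m) => M (lshift m ord0) ord0)).
    by rewrite !mxE !eqxx => /eqP; rewrite oner_eq0.
  exists (delta_mx ord0 i); rewrite mxE a0 add0r mxE (bigD1 i) //= big1.
    by rewrite [delta_mx _ _ _ _]mxE !eqxx mul1r addr0.
  by move=> k ki; rewrite mxE (negbTE ki) andbF mul0r.
pose U0 : 'M[K]_(1 + m) := block_mx 1%:M b 0 1%:M.
pose h : 'M[K]_(1 + m) := U0 *m g.
have hu : h \in unitmx by rewrite unitmx_mul Uu.
have hE : chi h = chi g.
  rewrite chiM //; last exact: Uu.
  by rewrite -[RHS]mul1r; congr (_ * _); exact: chiU.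
have hTE : chi h^T = chi g^T.
  rewrite trmx_mul chiM ?unitmx_tr //; last exact: Uu.
  by rewrite -[RHS]mulr1; congr (_ * _); rewrite tr_block_mx !trmx1 trmx0 chiL.
rewrite -hE -hTE.
pose a := ulsubmx h; pose x := a ord0 ord0.
have aE : a = x%:M by rewrite [LHS]mx11_scalar.
have x0 : x != 0.
  move: ab; rewrite /x /a /h /U0 -{3}(submxK (g : 'M[K]_(1 + m))) mulmx_block block_mxKul.
  by rewrite mul1mx.
pose S := drsubmx h - dlsubmx h *m (x^-1 *: ursubmx h).
pose L0 : 'M[K]_(1 + m) := block_mx 1%:M 0 (x^-1 *: dlsubmx h) 1%:M.
pose U1 : 'M[K]_(1 + m) := block_mx 1%:M (x^-1 *: ursubmx h) 0 1%:M.
pose Dx : 'M[K]_(1 + m) := block_mx x%:M 0 0 1%:M.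
pose DS (s : 'M[K]_m) : 'M[K]_(1 + m) := block_mx 1%:M 0 0 s.
have hdec : h = L0 *m (Dx *m DS S) *m U1.
  rewrite !mulmx_block !(mulmx0, mul0mx, addr0, add0r, mul1mx, mulmx1).
  rewrite -{1}(submxK h) -/a aE; congr block_mx.
  - by rewrite mul_scalar_mx scalerA mulfV // scale1r.
  - by rewrite mul_mx_scalar scalerA mulfV // scale1r.
  - rewrite mul_mx_scalar scalerA mulfV // scale1r.
    by rewrite /S addrC subrK.
have Dxu : Dx \in unitmx.
  by rewrite unitmxE det_ublock det_scalar1 det1 mulr1 unitfE.
have DSu s : (DS s \in unitmx) = (s \in unitmx).
  by rewrite !unitmxE det_ublock det1 mul1r.
have Su : S \in unitmx.
  by move: hu; rewrite hdec !unitmx_mul Lu Uu Dxu DSu andbT.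
have TE s : (DS s)^T = DS s^T by rewrite tr_block_mx !trmx0 trmx1.
have DxT : Dx^T = Dx by rewrite tr_block_mx !trmx0 tr_scalar_mx trmx1.
rewrite hdec !trmx_mul TE DxT.
have STu : S^T \in unitmx by rewrite unitmx_tr.
have U1u : U1 \in unitmx := Uu _.
have L0u : L0 \in unitmx := Lu _.
rewrite !chiM ?unitmx_mul ?unitmx_tr ?U1u ?L0u ?Dxu ?DSu ?STu //.
have -> : chi U1^T = 1 by rewrite tr_block_mx !trmx1 trmx0 chiL.
have -> : chi L0^T = 1 by rewrite tr_block_mx !trmx1 trmx0 chiU.
have -> : chi U1 = 1 := chiU _.
have -> : chi L0 = 1 := chiL _.
rewrite !mul1r !mulr1 mulrC; congr (_ * _).
apply: (IH (fun s => chi (DS s))) => //; split=> [s su|s s' su su'].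
  by apply: chi0; rewrite DSu.
by rewrite -chiM ?DSu // /DS mulmx_block !(mulmx0, mul0mx, addr0, add0r, mul1mx).
Qed.
End TransposeInvariance.

(** * Matrices over K x K *)

Section Pairs.
Variable K : fieldType.
Implicit Types (n : nat).

Lemma mxpairP (T : Type) n p (X Y : 'M[T * T]_(n, p)) :
  map_mx fst X = map_mx fst Y -> map_mx snd X = map_mx snd Y -> X = Y.
Proof. by move=> e1 e2; rewrite -(pairmxK X) e1 e2 pairmxK. Qed.

Lemma fst_mulmx n p q (X : 'M[K * K]_(n, p)) (Y : 'M[K * K]_(p, q)) :
  map_mx fst (X *m Y) = map_mx fst X *m map_mx fst Y.
Proof. exact: map_mxM. Qed.

Lemma snd_mulmx n p q (X : 'M[K * K]_(n, p)) (Y : 'M[K * K]_(p, q)) :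
  map_mx snd (X *m Y) = map_mx snd X *m map_mx snd Y.
Proof. exact: map_mxM. Qed.

Lemma fst_mx1 n : map_mx fst (1%:M : 'M[K * K]_n) = 1%:M.
Proof. exact: map_mx1. Qed.

Lemma snd_mx1 n : map_mx snd (1%:M : 'M[K * K]_n) = 1%:M.
Proof. exact: map_mx1. Qed.

Lemma fst_tr (T : Type) n p (X : 'M[T * T]_(n, p)) : map_mx fst X^T = (map_mx fst X)^T.
Proof. by rewrite map_trmx. Qed.

Lemma snd_tr (T : Type) n p (X : 'M[T * T]_(n, p)) : map_mx snd X^T = (map_mx snd X)^T.
Proof. by rewrite map_trmx. Qed.

Lemma unitmx_pair n (X : 'M[K * K]_n) :
  (X \in unitmx) = (map_mx fst X \in unitmx) && (map_mx snd X \in unitmx).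
Proof.
apply/idP/andP => [Xu|[X1 X2]].
  by split; [have := congr1 (map_mx fst) (mulmxV Xu)|have := congr1 (map_mx snd) (mulmxV Xu)];
    rewrite ?fst_mulmx ?snd_mulmx ?fst_mx1 ?snd_mx1 => /mulmx1_unit[].
have H : X *m pairmx (invmx (map_mx fst X)) (invmx (map_mx snd X)) = 1%:M.
  by apply: mxpairP; rewrite ?fst_mulmx ?snd_mulmx ?fst_pairmx ?snd_pairmx mulmxV
    ?fst_mx1 ?snd_mx1.
by have [] := mulmx1_unit H.
Qed.

Lemma fst_unit n (X : 'M[K * K]_n) : X \in unitmx -> map_mx fst X \in unitmx.
Proof. by rewrite unitmx_pair => /andP[]. Qed.

Lemma fst_invmx n (X : 'M[K * K]_n) : X \in unitmx ->
  map_mx fst (invmx X) = invmx (map_mx fst X).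
Proof.
by move=> Xu; apply/esym/mulmx1_inv; rewrite -fst_mulmx mulmxV // fst_mx1.
Qed.

Lemma snd_invmx n (X : 'M[K * K]_n) : X \in unitmx ->
  map_mx snd (invmx X) = invmx (map_mx snd X).
Proof.
by move=> Xu; apply/esym/mulmx1_inv; rewrite -snd_mulmx mulmxV // snd_mx1.
Qed.
End Pairs.

(** * The linear forms inside the generic characters *)

Section LambdaGen.
Variables (m r : nat).
Local Notation n := (ndim m r).

(** The arguments of psi in psiU' and psiU, over any ring: the identities below
    are used over K, for the components of a matrix over K x K. *)
Definition lamv (A : comUnitRingType) (u : 'M[A]_n) : A :=
  \sum_(i < r) \sum_(j < r | j == i.+1 :> nat) u (iv m i) (iv m j)
  + \sum_(i < r | i.+1 == r) u (iv m i) (iw0 m r).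

Definition lam (A : comUnitRingType) (b0 : A) (u : 'M[A]_n) : A :=
  \sum_(i < r) \sum_(j < r | j == i.+1 :> nat) u (iv m i) (iv m j)
  + \sum_(i < r | i.+1 == r) u (iv m i) (iw0 m r)
  + b0 * \sum_(i < r | i.+1 == r) u (iw0 m r) (ivc m i)
  + \sum_(i < r) \sum_(j < r | j == i.+1 :> nat) u (ivc m j) (ivc m i).

Lemma lamv_map (A B : comUnitRingType) (f : {rmorphism A -> B}) (u : 'M[A]_n) :
  f (lamv u) = lamv (map_mx f u).
Proof.
rewrite /lamv rmorphD !rmorph_sum /=; congr (_ + _).
  apply: eq_bigr => i _; rewrite rmorph_sum; apply: eq_bigr => j _.
  by rewrite mxE.
by apply: eq_bigr => i _; rewrite mxE.
Qed.

Lemma lam_map (A B : comUnitRingType) (f : {rmorphism A -> B}) b0 (u : 'M[A]_n) :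
  f (lam b0 u) = lam (f b0) (map_mx f u).
Proof.
rewrite /lam !rmorphD rmorphM !rmorph_sum /=; congr (_ + _ + _ * _ + _).
- apply: eq_bigr => i _; rewrite rmorph_sum; apply: eq_bigr => j _.
  by rewrite mxE.
- by apply: eq_bigr => i _; rewrite mxE.
- by apply: eq_bigr => i _; rewrite mxE.
- apply: eq_bigr => i _; rewrite rmorph_sum; apply: eq_bigr => j _.
  by rewrite mxE.
Qed.

Section Additive.
Variable A : comUnitRingType.
Implicit Types u a : 'M[A]_n.

(** The entries that occur in lam lie one block above the diagonal, where products
    in N are sums, and in rows and columns fixed by GL_m.  So lam is additive on
    N and invariant under GL_m. *)
Definition step (i j : 'I_n) := block j = (block i).+1 /\ outer i /\ outer j.

Lemma step_iv (i j : 'I_r) : j = i.+1 :> nat -> step (iv m i) (iv m j).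
Proof.
move=> ij; split; first by rewrite !block_iv.
by split; left; [exists i|exists j].
Qed.

Lemma step_vw (i : 'I_r) : i.+1 = r -> step (iv m i) (iw0 m r).
Proof.
move=> ij; split; first by rewrite block_iv block_iw0.
by split; [left; exists i|right; left].
Qed.

Lemma step_wv (i : 'I_r) : i.+1 = r -> step (iw0 m r) (ivc m i).
Proof.
move=> ij; split; first by rewrite block_iw0 block_ivc; lia.
by split; [right; left|right; right; exists i].
Qed.

Lemma step_ivc (i j : 'I_r) : j = i.+1 :> nat -> step (ivc m j) (ivc m i).
Proof.
move=> ij; split; first by rewrite !block_ivc; have := ltn_ord j; lia.
by split; right; right; [exists j|exists i].
Qed.

Lemma step_neq (i j : 'I_n) : step i j -> i != j.
Proof. by move=> [b _]; apply/eqP => e; move: b; rewrite e; lia. Qed.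

Lemma lam_ext (b0 : A) u a : (forall i j, step i j -> u i j = a i j) ->
  lam b0 u = lam b0 a.
Proof.
move=> H; rewrite /lam; congr (_ + _ + _ * _ + _).
- apply: eq_bigr => i _; apply: eq_bigr => j /eqP ij; exact/H/step_iv.
- by apply: eq_bigr => i /eqP ir; exact/H/step_vw.
- by apply: eq_bigr => i /eqP ir; exact/H/step_wv.
- apply: eq_bigr => i _; apply: eq_bigr => j /eqP ij; exact/H/step_ivc.
Qed.

Lemma lamD (b0 : A) u a : lam b0 (u + a) = lam b0 u + lam b0 a.
Proof.
have s2 (P : 'I_r -> 'I_r -> bool) (f g : 'I_r -> 'I_r -> 'I_n) :
    \sum_i \sum_(j | P i j) (u + a) (f i j) (g i j) =
    \sum_i \sum_(j | P i j) u (f i j) (g i j) + \sum_i \sum_(j | P i j) a (f i j) (g i j).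
  rewrite -big_split; apply: eq_bigr => i _; rewrite -big_split.
  by apply: eq_bigr => j _; rewrite mxE.
have s1 (P : pred 'I_r) (f g : 'I_r -> 'I_n) :
    \sum_(i | P i) (u + a) (f i) (g i) =
    \sum_(i | P i) u (f i) (g i) + \sum_(i | P i) a (f i) (g i).
  by rewrite -big_split; apply: eq_bigr => i _; rewrite mxE.
by rewrite /lam !s2 !s1; ring.
Qed.

Lemma lamM (b0 : A) u a : Nset u -> Nset a ->
  lam b0 (u *m a) = lam b0 u + lam b0 a.
Proof.
move=> Nu Na; rewrite -lamD; apply: lam_ext => i j st.
by rewrite Nset_mulE ?(step_neq st) ?[RHS]mxE //; have [-> _] := st.
Qed.

Lemma lam1 (b0 : A) : lam b0 1%:M = 0.
Proof.
apply: (@addrI _ (lam b0 1%:M)).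
by rewrite -lamM; [rewrite mulmx1 addr0|exact: Nset1|exact: Nset1].
Qed.

Lemma lamV (b0 : A) u : Nset u -> lam b0 (invmx u) = - lam b0 u.
Proof.
move=> Nu; apply/eqP; rewrite -addr_eq0 -lamM ?lam1 ?mulVmx ?lam1 //.
  exact: Nset_unit.
exact: NsetV.
Qed.

Lemma lam_levi (b0 : A) (g : 'M[A]_m) u :
  lam b0 (levi r g *m u *m levi r (invmx g)) = lam b0 u.
Proof. by apply: lam_ext => i j [_ [oi oj]]; rewrite levi_conj_outer. Qed.

(** The hypotheses give a the entries of u^-1 at the dual coordinates.  Inversion
    negates the entries above the diagonal, so subtracting lamv a supplies the
    terms of lam that are missing in lamv. *)
Lemma lamv_dual (b0 : A) u a : Nset u ->
  (forall i j : 'I_r, j = i.+1 :> nat ->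
     a (iv m i) (iv m j) = (invmx u) (ivc m j) (ivc m i)) ->
  (forall i : 'I_r, i.+1 = r ->
     a (iv m i) (iw0 m r) = b0 * (invmx u) (iw0 m r) (ivc m i)) ->
  lamv u - lamv a = lam b0 u.
Proof.
move=> Nu H1 H2; rewrite /lamv /lam.
have inv i j : step i j -> (invmx u) i j = - u i j.
  by move=> st; rewrite Nset_invE ?(step_neq st) //; have [-> _] := st.
have E1 : \sum_(i < r) \sum_(j < r | j == i.+1 :> nat) a (iv m i) (iv m j) =
    - \sum_(i < r) \sum_(j < r | j == i.+1 :> nat) u (ivc m j) (ivc m i).
  rewrite -sumrN; apply: eq_bigr => i _; rewrite -sumrN; apply: eq_bigr => j /eqP ij.
  by rewrite H1 // inv //; exact: step_ivc.
have E2 : \sum_(i < r | i.+1 == r) a (iv m i) (iw0 m r) =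
    - (b0 * \sum_(i < r | i.+1 == r) u (iw0 m r) (ivc m i)).
  rewrite mulr_sumr -sumrN; apply: eq_bigr => i /eqP ir.
  by rewrite H2 // inv ?mulrN //; exact: step_wv.
by rewrite E1 E2; ring.
Qed.
End Additive.
End LambdaGen.

Section FormMatrix.
Variables (A : comUnitRingType) (m r : nat).
Local Notation n := (ndim m r).

(** rmx and form are wmx and Jmx over any ring; over K they give the components
    of these. *)
Definition rmx : 'M[A]_r := \matrix_(i, j) (j == rev_ord i)%:R.

Lemma rmx_sqr : rmx *m rmx = 1%:M.
Proof.
apply/matrixP => i j; rewrite !mxE (bigD1 (rev_ord i)) //= !mxE eqxx mul1r rev_ordK.
rewrite big1 ?addr0 1?eq_sym // => k ki; by rewrite mxE (negbTE ki) mul0r.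
Qed.

Definition form (b : 'M[A]_m) (b0 : A) : 'M[A]_n :=
  block_mx 0 (row_mx 0 rmx) (col_mx 0 rmx)
    (block_mx (block_mx b 0 0 b0%:M) 0 0 0).

Lemma formM (b c : 'M[A]_m) (b0 c0 : A) : b *m c = 1%:M -> b0 * c0 = 1 ->
  form b b0 *m form c c0 = 1%:M.
Proof.
move=> bc bc0; rewrite /form mulmx_block mul_row_col mul_col_row mul_row_block mul_block_col.
rewrite !mulmx_block !(mulmx0, mul0mx, addr0, add0r) rmx_sqr bc -scalar_mxM bc0.
rewrite row_mx0 col_mx0 add_block_mx !(addr0, add0r).
by rewrite -!scalar_mx_block.
Qed.

Lemma form_antidiag b b0 : antidiag (form b b0).
Proof.
move=> i j; rewrite /form.
case: (split_ordP i) => i1 ->; case: (split_ordP j) => j1 ->.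
- by rewrite block_mxEul mxE.
- rewrite block_mxEur; case: (split_ordP j1) => j2 ->.
    by rewrite row_mxEl mxE.
  rewrite row_mxEr mxE; case: (eqVneq j2 (rev_ord i1)) => [-> /eqP[]|//].
  have -> : lshift (m + 1 + r) i1 = iv m i1 by [].
  have -> : rshift r (rshift (m + 1) (rev_ord i1)) = ivc m i1 by [].
  by rewrite block_iv block_ivc; have := ltn_ord i1; lia.
- rewrite block_mxEdl; case: (split_ordP i1) => i2 ->.
    by rewrite col_mxEu mxE.
  rewrite col_mxEd mxE; case: (eqVneq j1 (rev_ord i2)) => [-> /eqP[]|//].
  have -> : lshift (m + 1 + r) (rev_ord i2) = iv m (rev_ord i2) by [].
  have -> : rshift r (rshift (m + 1) i2) = ivc m (rev_ord i2) by rewrite /ivc rev_ordK.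
  by rewrite block_iv block_ivc; have := ltn_ord (rev_ord i2); lia.
rewrite block_mxEdr; case: (split_ordP i1) => i2 ->; case: (split_ordP j1) => j2 ->.
- by rewrite !block_cen eqxx.
- by rewrite block_mxEur mxE.
- by rewrite block_mxEdl mxE.
- by rewrite block_mxEdr mxE.
Qed.

Lemma form_iv b b0 (i : 'I_r) k : form b b0 (iv m i) k = (k == ivc m i)%:R.
Proof.
rewrite /form /iv /ivc; case: (split_ordP k) => k1 ->.
  by rewrite block_mxEul mxE eq_lrshift.
rewrite block_mxEur; case: (split_ordP k1) => k2 ->.
  rewrite row_mxEl mxE; case: eqP => // /rshift_inj/eqP.
  by rewrite eq_lrshift.
rewrite row_mxEr mxE; congr (_%:R); congr nat_of_bool.
by rewrite !(inj_eq (@rshift_inj _ _)).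
Qed.

Lemma form_ivc b b0 (i : 'I_r) k : form b b0 k (ivc m i) = (k == iv m i)%:R.
Proof.
rewrite /form /iv /ivc; case: (split_ordP k) => k1 ->.
  rewrite block_mxEur row_mxEr mxE (inj_eq rev_ord_inj) (inj_eq (@lshift_inj _ _)).
  by rewrite eq_sym.
rewrite block_mxEdr eq_rlshift; case: (split_ordP k1) => k2 ->.
  by rewrite block_mxEur mxE.
by rewrite block_mxEdr mxE.
Qed.

Lemma form_iw0 b b0 k : form b b0 (iw0 m r) k = b0 * (k == iw0 m r)%:R.
Proof.
rewrite /form /iw0; case: (split_ordP k) => k1 ->.
  by rewrite block_mxEdl col_mxEu mxE eq_lrshift mulr0.
rewrite block_mxEdr (inj_eq (@rshift_inj _ _)); case: (split_ordP k1) => k2 ->.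
  rewrite block_mxEul (inj_eq (@lshift_inj _ _)); case: (split_ordP k2) => k3 ->.
    by rewrite block_mxEdl mxE eq_lrshift mulr0.
  by rewrite block_mxEdr !ord1 !eqxx mulr1 mxE.
by rewrite block_mxEur mxE eq_rlshift mulr0.
Qed.

(** In an element (u, a) of U' the components satisfy a^T J u = J.  The columns of
    a^T J = J u^-1 at the coordinates dual to the v_i express the entries of a
    in lamv through entries of u. *)
Lemma form_dual b b0 (u a : 'M[A]_n) : Nset u ->
  a^T *m form b b0 *m u = form b b0 -> lamv u - lamv a = lam b0 u.
Proof.
move=> Nu E; have uu := Nset_unit Nu.
have {}E : a^T *m form b b0 = form b b0 *m invmx u by rewrite -{2}E mulmxK.
have ent (i j : 'I_n) := congr1 (fun M : 'M[A]_n => M i j) E.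
have colE i (j : 'I_r) : (a^T *m form b b0) i (ivc m j) = a (iv m j) i.
  rewrite mxE (bigD1 (iv m j)) //= big1; last first.
    by move=> k kj; rewrite form_ivc (negbTE kj) mulr0.
  by rewrite form_ivc eqxx mulr1 addr0 mxE.
apply: lamv_dual => // [i j ij|i ir].
  rewrite -colE ent mxE (bigD1 (ivc m j)) //= big1; last first.
    by move=> k kj; rewrite form_iv (negbTE kj) mul0r.
  by rewrite form_iv eqxx mul1r addr0.
rewrite -colE ent mxE (bigD1 (iw0 m r)) //= big1; last first.
  by move=> k kj; rewrite form_iw0 (negbTE kj) mulr0 mul0r.
by rewrite form_iw0 eqxx mulr1 addr0.
Qed.
End FormMatrix.

(** * Unipotent LU factorization *)

Section UnipotentLU.
Variables (R : realType) (K : topFieldType) (v : K -> R).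
Hypothesis vP : topological_abs v.

Definition unitriangular n (b : 'M[K]_n) :=
  forall i j : 'I_n, (j <= i)%N -> b i j = (i == j)%:R.

Lemma unitriangular_block n (b : 'M[K]_(1 + n)) : unitriangular b ->
  b = block_mx 1%:M (ursubmx b) 0 (drsubmx b) /\ unitriangular (drsubmx b).
Proof.
move=> ub; split.
  rewrite -{1}(submxK b); congr block_mx.
    by apply/matrixP => i j; rewrite !mxE ub ?ord1.
  by apply/matrixP => i j; rewrite !mxE ub ?ord1 //= eq_rlshift.
by move=> i j ij; rewrite !mxE ub ?(inj_eq (@rshift_inj _ _)) //= leq_add2l.
Qed.

(** For l b in block form the first row is that of b and the Schur complement of
    the corner entry 1 is the product of the lower right blocks of l and b; the
    recursion is polynomial, hence continuous on all matrices. *)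
Lemma unipotent_lu n : exists2 P : 'M[K]_n -> 'M[K]_n, continuous P &
  forall l b : 'M[K]_n, unitriangular l^T -> unitriangular b -> P (l *m b) = b.
Proof.
elim: n => [|n [P Pc PE]].
  exists id => [|l b _ _]; first by move=> x; exact: cvg_id.
  by apply/matrixP => -[].
pose Q (x : 'M[K]_(1 + n)) : 'M[K]_(1 + n) :=
  block_mx 1%:M (ursubmx x) 0 (P (drsubmx x - dlsubmx x *m ursubmx x)).
suff [Qc QE] : continuous Q /\ forall l b : 'M[K]_(1 + n), unitriangular l^T -> unitriangular b -> Q (l *m b) = b by exists Q.
split=> [x|l b /unitriangular_block[lE ul] /unitriangular_block[bE ub]].
  have urc : (fun x : 'M[K]_(1 + n) => ursubmx x) @ x --> ursubmx x.
    apply: (cvg_mx (F := nbhs x)) => i j; rewrite !mxE.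
    by under eq_fun do rewrite !mxE; exact: entry_continuous.
  have dlc : (fun x : 'M[K]_(1 + n) => dlsubmx x) @ x --> dlsubmx x.
    apply: (cvg_mx (F := nbhs x)) => i j; rewrite !mxE.
    by under eq_fun do rewrite !mxE; exact: entry_continuous.
  have Dc : (fun x : 'M[K]_(1 + n) => drsubmx x - dlsubmx x *m ursubmx x) @ x -->
      drsubmx x - dlsubmx x *m ursubmx x.
    have mc := cvg_mulmx vP (nbhs_filter x) dlc urc.
    apply: (cvg_mx (F := nbhs x)) => i j.
    have -> : (drsubmx x - dlsubmx x *m ursubmx x) i j =
        x (rshift 1 i) (rshift 1 j) + - (dlsubmx x *m ursubmx x) i j by rewrite !mxE.
    under eq_fun => y.
      have -> : (drsubmx y - dlsubmx y *m ursubmx y) i j =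
        y (rshift 1 i) (rshift 1 j) + - (dlsubmx y *m ursubmx y) i j by rewrite !mxE.
      over.
    apply: (cvg_addK vP (nbhs_filter x)); first exact: entry_continuous.
    apply: (cvg_oppK vP (nbhs_filter x)).
    exact: ((cvg_mxP (FF := nbhs_filter x) _ _).1 mc i j).
  have PDc := cvg_comp _ _ Dc (Pc _).
  by apply: (cvg_block_mx (FF := nbhs_filter x)); try exact: cvg_cst.
have lE' : l = block_mx 1%:M 0 (ursubmx l^T)^T (drsubmx l^T)^T.
  by rewrite -[LHS]trmxK {1}lE tr_block_mx trmx1 trmx0.
rewrite /Q; set x := l *m b.
have xE : x = block_mx 1%:M (ursubmx b) (ursubmx l^T)^T
    ((ursubmx l^T)^T *m ursubmx b + (drsubmx l^T)^T *m drsubmx b).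
  rewrite /x {1}lE' {1}bE mulmx_block !(mulmx0, mul0mx, addr0, add0r, mul1mx, mulmx1).
  by [].
rewrite xE block_mxKur block_mxKdl block_mxKdr addrC addKr PE -?bE //.
by rewrite trmxK.
Qed.
End UnipotentLU.

(** * The spaces as graphs over GL_n(K), and normal forms *)

Section Split.
Variable K : topFieldType.

Lemma fst_taumx n p (X : 'M[K * K]_(n, p)) : map_mx fst (taumx X) = map_mx snd X.
Proof. by apply/matrixP => i j; rewrite !mxE. Qed.

Lemma snd_taumx n p (X : 'M[K * K]_(n, p)) : map_mx snd (taumx X) = map_mx fst X.
Proof. by apply/matrixP => i j; rewrite !mxE. Qed.

Lemma SsetP m r (s : 'M[K * K]_(ndim m r)) :
  Sset s <-> map_mx fst s \in unitmx /\ map_mx snd s = invmx (map_mx fst s).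
Proof.
split=> [[su E]|[s1 s2]].
  have s1 := fst_unit su; split=> //.
  by apply/esym/mulmx1_inv; rewrite -(fst_taumx s) -fst_mulmx E fst_mx1.
split; first by rewrite unitmx_pair s1 s2 unitmx_inv.
apply: mxpairP; rewrite ?fst_mulmx ?snd_mulmx ?fst_taumx ?snd_taumx s2.
  by rewrite fst_mx1 mulmxV.
by rewrite snd_mx1 mulVmx.
Qed.

(** The second component of the element with first component a in the unitary
    group of the hermitian matrix over K x K with first component J. *)
Definition dual_mx n (J : 'M[K]_n) (a : 'M[K]_n) : 'M[K]_n :=
  (J *m invmx a *m invmx J)^T.

Lemma unitary_groupP n (J g : 'M[K * K]_n) :
  J \in unitmx -> (taumx J)^T = J ->
  unitary_group J g <->
  map_mx fst g \in unitmx /\ map_mx snd g = dual_mx (map_mx fst J) (map_mx fst g).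
Proof.
move=> Ju Jh; have J1u := fst_unit Ju.
have J2 : map_mx snd J = (map_mx fst J)^T.
  by rewrite -{1}Jh snd_tr snd_taumx.
rewrite /dual_mx; split=> [[gu E]|[g1 g2]].
  have g1 := fst_unit gu; split=> //.
  have := congr1 (map_mx fst) E; rewrite !fst_mulmx fst_tr fst_taumx => H.
  by apply: trmx_inj; rewrite trmxK -{1}H mulmxK // mulmxK.
split.
  by rewrite unitmx_pair g1 g2 unitmx_tr !unitmx_mul J1u !unitmx_inv g1 J1u.
apply: mxpairP; rewrite ?fst_mulmx ?snd_mulmx ?fst_tr ?snd_tr ?fst_taumx ?snd_taumx g2.
  by rewrite trmxK mulmxKV // mulmxKV.
rewrite J2 -trmx_mul -trmx_mul; congr trmx.
by rewrite !mulmxA mulmxKV // mulmxKV.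
Qed.

Lemma UradP m r (u : 'M[K * K]_(ndim m r)) :
  Urad u <-> Nset (map_mx fst u) /\ Nset (map_mx snd u).
Proof.
have e1 (c : bool) : (c%:R : K * K).1 = c%:R by case: c.
have e2 (c : bool) : (c%:R : K * K).2 = c%:R by case: c.
split=> [Nu|[N1 N2] i j ij].
  by split=> i j ij; rewrite mxE Nu // ?e1 ?e2.
rewrite [u i j]surjective_pairing [RHS]surjective_pairing e1 e2.
by have := N1 i j ij; have := N2 i j ij; rewrite !mxE => -> ->.
Qed.

Section Forms.
Variables (m r : nat) (beta0 : K).
Hypothesis b00 : beta0 != 0.
Local Notation n := (ndim m r).

Lemma trmx_form (b : 'M[K]_m) : (form r b beta0)^T = form r b^T beta0.
Proof.
have rT : (rmx K r)^T = rmx K r.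
  apply/matrixP => i j; rewrite !mxE; congr (_%:R); congr nat_of_bool.
  by rewrite -(inj_eq rev_ord_inj) rev_ordK eq_sym.
by rewrite /form !tr_block_mx tr_row_mx tr_col_mx !trmx0 tr_scalar_mx rT.
Qed.

Lemma form_unit (b : 'M[K]_m) : b \in unitmx -> form r b beta0 \in unitmx.
Proof.
move=> bu; have H := formM r (mulmxV bu) (mulfV b00).
by have [] := mulmx1_unit H.
Qed.

Lemma invmx_form (b : 'M[K]_m) : b \in unitmx ->
  invmx (form r b beta0) = form r (invmx b) beta0^-1.
Proof.
by move=> bu; apply: mulmx1_inv; exact: (formM r (mulmxV bu) (mulfV b00)).
Qed.

Variable beta : 'M[K * K]_m.

Lemma fst_Jmx : map_mx fst (Jmx r beta0 beta) = form r (map_mx fst beta) beta0.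
Proof.
rewrite /Jmx /form /betaprime !map_block_mx map_row_mx map_col_mx !map_mx0 map_scalar_mx.
have -> : map_mx fst (wmx K r) = rmx K r.
  by apply/matrixP => i j; rewrite !mxE; case: (_ == _).
by [].
Qed.

Lemma snd_Jmx : map_mx snd (Jmx r beta0 beta) = form r (map_mx snd beta) beta0.
Proof.
rewrite /Jmx /form /betaprime !map_block_mx map_row_mx map_col_mx !map_mx0 map_scalar_mx.
have -> : map_mx snd (wmx K r) = rmx K r.
  by apply/matrixP => i j; rewrite !mxE; case: (_ == _).
by [].
Qed.

Hypothesis Hb : Her beta.
Let b := map_mx fst beta.
Let J1 := form r b beta0.

Lemma Her_fst_unit : b \in unitmx.
Proof. by have [bu _] := Hb; exact: fst_unit. Qed.

Lemma Her_snd : map_mx snd beta = b^T.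
Proof. by have [_ E] := Hb; rewrite -{1}E snd_tr snd_taumx. Qed.

Lemma Jmx_unit : Jmx r beta0 beta \in unitmx.
Proof.
rewrite unitmx_pair fst_Jmx snd_Jmx Her_snd form_unit ?Her_fst_unit //.
by rewrite form_unit // unitmx_tr Her_fst_unit.
Qed.

Lemma Jmx_herm : (taumx (Jmx r beta0 beta))^T = Jmx r beta0 beta.
Proof.
apply: mxpairP; rewrite ?fst_tr ?snd_tr ?fst_taumx ?snd_taumx fst_Jmx snd_Jmx Her_snd.
  by rewrite trmx_form trmxK.
by rewrite trmx_form.
Qed.

Lemma UsetP (x : 'M[K * K]_n) : Uset beta0 beta x <->
  map_mx fst x \in unitmx /\ map_mx snd x = dual_mx J1 (map_mx fst x).
Proof. by rewrite /J1 -fst_Jmx; apply: unitary_groupP; [exact: Jmx_unit|exact: Jmx_herm]. Qed.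

Lemma Nset_dual (a : 'M[K]_n) : Nset a -> Nset (dual_mx J1 a).
Proof.
move=> Na; apply: antidiag_conj; last exact: NsetV.
- exact: form_antidiag.
- rewrite invmx_form; last exact: Her_fst_unit.
  exact: form_antidiag.
- by rewrite mulmxV // form_unit // Her_fst_unit.
Qed.

Lemma UprimeP (u : 'M[K * K]_n) : Uprime beta0 beta u <->
  Nset (map_mx fst u) /\ map_mx snd u = dual_mx J1 (map_mx fst u).
Proof.
split=> [[/UsetP[_ u2] /UradP[u1 _]] //|[u1 u2]]; split.
  by apply/UsetP; split=> //; exact: Nset_unit.
by apply/UradP; split=> //; rewrite u2; exact: Nset_dual.
Qed.

Lemma Uprime_lam (u : 'M[K * K]_n) : Uprime beta0 beta u ->
  lamv (map_mx fst u) - lamv (map_mx snd u) = lam beta0 (map_mx fst u).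
Proof.
move=> /UprimeP[Nu u2]; apply: (@form_dual _ m r b) => //.
rewrite u2 /dual_mx trmxK mulmxKV; last by rewrite form_unit // Her_fst_unit.
by rewrite mulmxKV // Nset_unit.
Qed.

End Forms.

(** Hermitian matrices are the pairs (b, b^T), and (b^-1 c, 1) transforms
    (b, b^T) into (c, c^T). *)
Lemma Her_one_class m (b c : 'M[K * K]_m) : Her b -> Her c -> Her_equiv b c.
Proof.
move=> Hb Hc; have bu := Her_fst_unit Hb; have cu := Her_fst_unit Hc.
exists (pairmx (invmx (map_mx fst b) *m map_mx fst c) 1%:M).
  by rewrite unitmx_pair fst_pairmx snd_pairmx unitmx_mul unitmx_inv bu cu unitmx1.
apply: mxpairP; rewrite ?fst_mulmx ?snd_mulmx ?fst_tr ?snd_tr ?fst_taumx ?snd_taumx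
  ?fst_pairmx ?snd_pairmx.
  by rewrite trmx1 mul1mx mulKVmx.
rewrite mulmx1 (Her_snd Hb) (Her_snd Hc) -trmx_mul mulKVmx //.
Qed.

Section NormalForm.
Variables (m r : nat).
Local Notation n := (ndim m r).
Implicit Types (xi : 'M[K * K]_(m + 1)) (t : {ffun 'I_r -> K * K}).

Lemma normal_form_antidiag xi t : antidiag (normal_form xi t).
Proof.
move=> i j ij; rewrite /normal_form mxE summxE.
have -> : central r xi i j = 0.
  rewrite /central; move: ij.
  case: (split_ordP i) => i1 ->; case: (split_ordP j) => j1 ->.
  - by rewrite block_mxEul mxE.
  - by rewrite block_mxEur mxE.
  - by rewrite block_mxEdl mxE.
  rewrite block_mxEdr; case: (split_ordP i1) => i2 ->; case: (split_ordP j1) => j2 ->.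
  - by rewrite !block_cen eqxx.
  - by rewrite block_mxEur mxE.
  - by rewrite block_mxEdl mxE.
  - by rewrite block_mxEdr mxE.
rewrite add0r big1 // => k _; rewrite !mxE.
have bk : (block (iv m k) + block (ivc m k))%N = (r + r)%N.
  by rewrite block_iv block_ivc; have := ltn_ord k; lia.
have -> : (i == iv m k) && (j == ivc m k) = false.
  by apply/negP => /andP[/eqP e1 /eqP e2]; move: ij; rewrite e1 e2 bk eqxx.
have -> : (i == ivc m k) && (j == iv m k) = false.
  by apply/negP => /andP[/eqP e1 /eqP e2]; move: ij; rewrite e1 e2 addnC bk eqxx.
by rewrite !mulr0 addr0.
Qed.

Definition cen (x : 'I_(m + 1)) : 'I_n := rshift r (lshift r x).

Lemma normal_form_cen xi t x y : normal_form xi t (cen x) (cen y) = xi x y.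
Proof.
rewrite /normal_form mxE summxE big1 ?addr0.
  by rewrite /central block_mxEdr block_mxEul.
move=> k _; rewrite !mxE /cen /iv /ivc.
by rewrite !eq_rlshift ?andbF /= !mulr0 addr0.
Qed.

Lemma normal_form_t xi t k : normal_form xi t (iv m k) (ivc m k) = t k.
Proof.
rewrite /normal_form mxE summxE.
have -> : central r xi (iv m k) (ivc m k) = 0 by rewrite /central block_mxEur mxE.
rewrite add0r (bigD1 k) //= big1 ?addr0.
  by rewrite !mxE !eqxx /iv /ivc eq_lrshift /= mulr1 mulr0 addr0.
move=> l lk; rewrite !mxE /iv /ivc eq_lrshift /= (inj_eq (@lshift_inj _ _)).
by rewrite eq_sym (negbTE lk) /= !mulr0 addr0.
Qed.

Lemma normal_form_inj xi t xi' t' :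
  normal_form xi t = normal_form xi' t' -> xi = xi' /\ t = t'.
Proof.
move=> E; split.
  by apply/matrixP => x y; rewrite -(normal_form_cen xi t) E normal_form_cen.
by apply/ffunP => k; rewrite -(normal_form_t xi t) E normal_form_t.
Qed.

(** xget must pick (xi, t): any other normal form in the orbit is block
    antidiagonal, and antidiag_unique applies. *)
Lemma normal_dataE xi t (O : set 'M[K * K]_n) :
  (forall i, t i \is a GRing.unit) -> O (normal_form xi t) ->
  (forall z, O z -> exists u a, [/\ Nset u, Nset a & z = invmx u *m normal_form xi t *m a]) ->
  normal_data O = (xi, t).
Proof.
move=> tu Oz H; rewrite /normal_data; case: xgetP => [p _ [_ Op]|]; last first.
  by move=> /(_ (xi, t)) /=; case.
have [u [a [Nu Na E]]] := H _ Op.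
have [e1 e2] : xi = p.1 /\ t = p.2; last by rewrite e1 e2; case: (p).
apply: normal_form_inj; apply: (@antidiag_unique _ _ _ _ _ u a) => //; try exact: normal_form_antidiag.
by rewrite E !mulmxA mulmxV ?Nset_unit // mul1mx.
Qed.

Lemma normal_data_S xi t : (forall i, t i \is a GRing.unit) ->
  normal_data (Sorbit (normal_form xi t)) = (xi, t).
Proof.
move=> tu; apply: normal_dataE => //.
  exists 1%:M; first exact: Nset1.
  have -> : taumx (1%:M : 'M[K * K]_n) = 1%:M.
    by apply: mxpairP; rewrite ?fst_taumx ?snd_taumx ?fst_mx1 ?snd_mx1.
  by rewrite invmx1 mul1mx mulmx1.
move=> _ [u Nu <-]; exists u, (taumx u); split=> //.
have [N1 N2] := (UradP u).1 Nu.
by apply/UradP; rewrite fst_taumx snd_taumx.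
Qed.

Lemma normal_data_U beta0 (beta : 'M[K * K]_m) xi t : beta0 != 0 -> Her beta ->
  (forall i, t i \is a GRing.unit) ->
  normal_data (Uorbit beta0 beta (normal_form xi t)) = (xi, t).
Proof.
move=> b00 Hb tu; have U1 : Uprime beta0 beta (1%:M : 'M[K * K]_n).
  apply/UprimeP => //; rewrite fst_mx1 snd_mx1; split; first exact: Nset1.
  by rewrite /dual_mx invmx1 mulmx1 mulmxV ?trmx1 // form_unit // Her_fst_unit.
apply: normal_dataE => //.
  by exists 1%:M, 1%:M; split=> //; rewrite invmx1 mul1mx mulmx1.
by move=> _ [u1 [u2 [[_ N1] [_ N2] ->]]]; exists u1, u2.
Qed.

Lemma normal_form_conj (g h : 'M[K * K]_m) xi t : g *m h = 1%:M ->
  embGL r g *m normal_form xi t *m embGL r h =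
  normal_form (block_mx g 0 0 1%:M *m xi *m block_mx h 0 0 1%:M) t.
Proof.
move=> gh; rewrite /normal_form mulmxDr mulmxDl mulmx_sumr mulmx_suml; congr (_ + _).
  by rewrite /embGL /central; do 2!rewrite !mulmx_block !(mulmx0, mul0mx, addr0, add0r, mul1mx, mulmx1).
have D (x y : 'I_n) : outer x -> outer y ->
    levi r g *m delta_mx x y *m levi r h = delta_mx x y.
  move=> ox oy; apply/matrixP => i j; rewrite mxE (bigD1 y) //= big1 ?addr0; last first.
    move=> k ky; rewrite mxE big1 ?mul0r // => l _.
    by rewrite [delta_mx _ _ _ _]mxE (negbTE ky) andbF mulr0.
  rewrite levi_row // mxE (bigD1 x) //= big1 ?addr0; last first.
    by move=> l lx; rewrite [delta_mx _ _ _ _]mxE (negbTE lx) mulr0.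
  rewrite levi_col // !mxE !eqxx /= mulr1 -natrM mulnb (eq_sym y j); exact: erefl.
apply: eq_bigr => i _; rewrite mulmxDr mulmxDl -!scalemxAr -!scalemxAl.
have oi : outer (iv m i) by left; exists i.
have oc : outer (ivc m i) by right; right; exists i.
by rewrite !D.
Qed.
End NormalForm.
End Split.

(** * Smooth functions under linear changes of variables *)

Section Smooth.
Variables (R : realType) (K : topFieldType) (n : nat).
Local Notation V := 'M[K * K]_n.

Lemma smooth_continuous (f : V -> R[i]) : smooth f ->
  continuous (fun x => complex.Re (f x)) /\ continuous (fun x => complex.Im (f x)).
Proof.
move=> [sa sn]; have [[iota ic]|na] := pselect (exists iota : {rmorphism R -> K}, continuous iota).
  by have [[? _] [? _]] := sa iota ic 0%N.
have lc := sn na; split=> x A /nbhs_singleton Ax;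
  by apply: filterS (lc x) => y /= e; rewrite /preimage /= e.
Qed.

(** Linearity over the diagonal copy of K, which contains the scalars along which
    Cclass differentiates. *)
Definition klinear (P : V -> V) : Prop :=
  [/\ continuous P, forall x y, P (x + y) = P x + P y &
      forall (s : K) x, P ((s, s) *: x) = (s, s) *: P x].

(** The directional derivative of f \o P along w is the one of f along P w,
    composed with P. *)
Lemma Cclass_comp (iota : R -> K) (P : V -> V) (c : R) p (f : V -> R) : klinear P ->
  Cclass iota p f -> Cclass iota p (fun x => c * f (P x)).
Proof.
move=> [Pc PD PZ]; have cP (g : V -> R) : continuous g -> continuous (fun x => c * g (P x)).
  move=> gc x; have h := cvg_comp P g (Pc x) (gc (P x)).
  exact: (cvgM (cvg_cst c) h).
elim: p f => [|p IH] f /= [fc H]; first by split=> //; exact: cP.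
split; first exact: cP.
move=> w; have [dw Cw] := H (P w).
have E x : (fun t : R => c * f (P (x + (iota t, iota t) *: w))) =
    c \*: (fun t : R => f (P x + (iota t, iota t) *: P w) : R^o).
  by apply/funext => t; rewrite PD PZ.
split=> [x|].
  by rewrite E; apply: derivableZ; exact: dw.
have -> : (fun x => derive1 (fun t : R => c * f (P (x + (iota t, iota t) *: w))) 0) =
    (fun x => c * derive1 (fun t : R => f (P x + (iota t, iota t) *: P w)) 0).
  apply/funext => x; rewrite E !derive1E deriveZ //.
exact: (IH _ Cw).
Qed.

Lemma smooth_comp (P : V -> V) (c : R) (f : V -> R[i]) : klinear P ->
  smooth f -> smooth (fun x => c%:C * f (P x)).
Proof.
move=> lP [sa sn]; split=> [iota ic p|na x].
  have [CR CI] := sa iota ic p.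
  have -> : (fun x => complex.Re (c%:C * f (P x))) = (fun x => c * complex.Re (f (P x))).
    by apply/funext => x; case: (f (P x)) => a b; rewrite /= mul0r subr0.
  have -> : (fun x => complex.Im (c%:C * f (P x))) = (fun x => c * complex.Im (f (P x))).
    by apply/funext => x; case: (f (P x)) => a b; rewrite /= mul0r addr0.
  by split; [exact: (Cclass_comp c lP CR)|exact: (Cclass_comp c lP CI)].
have [Pc _ _] := lP.
by apply: (@filterS _ (nbhs x) _ _ _ _ (Pc x _ (sn na (P x)))) => y /= ->.
Qed.

Lemma Cc_smooth_comp (X Y : set V) (P Q : V -> V) (c : R) (f : V -> R[i]) :
  klinear P -> klinear Q -> (forall y, Y y -> X (P y)) ->
  (forall x, X x -> Y (Q x)) -> (forall y, Y y -> Q (P y) = y) ->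
  Cc_smooth X f -> Cc_smooth Y (fun x => c%:C * f (P x)).
Proof.
move=> lP lQ YX XY PK [sf [C [cC CX fC]]].
have [Pc _ _] := lP; have [Qc _ _] := lQ; split.
  move=> x Yx; have [g sg fg] := sf _ (YX x Yx).
  exists (fun x => c%:C * g (P x)); first exact: smooth_comp.
  by apply: (@filterS _ (nbhs x) _ _ _ _ (Pc x _ fg)) => y /= H /YX/H ->.
exists (Q @` C); split.
- by apply: continuous_compact => //; apply: continuous_subspaceT.
- by move=> _ [x Cx <-]; exact/XY/CX.
- move=> x Yx nC; rewrite fC ?mulr0 //; first exact: YX.
  by move=> CPx; apply: nC; exists (P x) => //; exact: PK.
Qed.
End Smooth.

Section Identification.
Variables (R : realType) (K : topFieldType) (v : K -> R).
Hypothesis vP : topological_abs v.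
Variable n : nat.

(** With A = J_1^-1 and B = J_1 it maps the graph of the dual map of J_1 to the
    graph of inversion; the inverse of swap_form is again of this form. *)
Definition swap_form (A B : 'M[K]_n) (x : 'M[K * K]_n) : 'M[K * K]_n :=
  pairmx (map_mx fst x) (A *m (map_mx snd x)^T *m B).

Lemma fst_continuous p q : continuous (fun x : 'M[K * K]_(p, q) => map_mx fst x).
Proof. by apply: map_mx_continuous => x; exact: cvg_fst. Qed.

Lemma snd_continuous p q : continuous (fun x : 'M[K * K]_(p, q) => map_mx snd x).
Proof. by apply: map_mx_continuous => x; exact: cvg_snd. Qed.

Lemma swap_form_klinear A B : klinear (swap_form A B).
Proof.
split.
- move=> x; apply: (cvg_pairmx (F := nbhs x)); first exact: fst_continuous.
  apply: (cvg_mulmx vP (nbhs_filter x)); last exact: cvg_cst.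
  apply: (cvg_mulmx vP (nbhs_filter x)); first exact: cvg_cst.
  exact: (cvg_comp _ _ (@snd_continuous n n x) (@trmx_continuous _ _ _ _)).
- move=> x y; apply: mxpairP.
    by rewrite map_mxD !fst_pairmx map_mxD.
  rewrite map_mxD !snd_pairmx map_mxD linearD /= mulmxDr mulmxDl //.
- move=> s x; apply: mxpairP.
    have -> : map_mx fst ((s, s) *: swap_form A B x) = s *: map_mx fst x.
      by apply/matrixP => i j; rewrite !mxE.
    by rewrite fst_pairmx; apply/matrixP => i j; rewrite !mxE.
  have -> : map_mx snd ((s, s) *: swap_form A B x) = s *: map_mx snd (swap_form A B x).
    by apply/matrixP => i j; rewrite !mxE.
  rewrite !snd_pairmx.
  have -> : map_mx snd ((s, s) *: x) = s *: map_mx snd x.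
    by apply/matrixP => i j; rewrite !mxE.
  by rewrite linearZ /= -scalemxAr -scalemxAl.
Qed.

End Identification.

Section Restriction.
Variables (R : realType) (K : topFieldType) (v : K -> R).
Hypothesis vP : topological_abs v.
Variables m r : nat.
Local Notation n := (ndim m r).

Definition on_GL (F : 'M[K * K]_n -> R[i]) (y : 'M[K]_n) : R[i] :=
  F (pairmx y (invmx y)).

Lemma on_GLE F s : Sset s -> F s = on_GL F (map_mx fst s).
Proof.
by move=> /SsetP[_ s2]; rewrite /on_GL -s2 pairmxK.
Qed.

Lemma on_GL_continuous F : smooth_on (@Sset K m r) F -> forall y, y \in unitmx ->
  {for y, continuous (fun x => complex.Re (on_GL F x))} /\
  {for y, continuous (fun x => complex.Im (on_GL F x))}.
Proof.
move=> sF y yu.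
have Sx (x : 'M[K]_n) : x \in unitmx -> Sset (pairmx x (invmx x)).
  by move=> xu; apply/SsetP; rewrite fst_pairmx snd_pairmx.
have [g sg Fg] := sF _ (Sx y yu); have [gR gI] := smooth_continuous sg.
have pc : (fun x => pairmx x (invmx x)) @ y --> pairmx y (invmx y).
  apply: (cvg_pairmx (F := nbhs y)); first exact: cvg_id.
  by apply: (cvg_invmx vP (nbhs_filter y)) => //; exact: cvg_id.
have ev : \forall x \near y, on_GL F x = g (pairmx x (invmx x)).
  have yU : nbhs y [set x : 'M[K]_n | x \in unitmx].
    by apply: open_nbhs_nbhs; split=> //; exact: (GL_open vP).
  apply: filterS2 yU (pc _ Fg) => x xu /= H; apply: H; exact: Sx.
have ey : on_GL F y = g (pairmx y (invmx y)) by exact: nbhs_singleton ev.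
by split; [have gc := cvg_comp _ _ pc (gR _)|have gc := cvg_comp _ _ pc (gI _)];
  move=> A; rewrite /= ey => /gc; apply: filterS2 ev => x /= e;
  rewrite /preimage /= e.
Qed.

Lemma on_GL_support F : compactly_supported_on (@Sset K m r) F ->
  exists C : set 'M[K]_n, [/\ compact C, C `<=` [set x | x \in unitmx] &
    forall x, x \in unitmx -> on_GL F x != 0 -> C x].
Proof.
move=> [C [cC CS FC]]; exists ((fun x => map_mx fst x) @` C); split.
- apply: continuous_compact => //; apply: continuous_subspaceT.
  exact: fst_continuous.
- by move=> _ [s /CS/SsetP[s1 _] <-].
- move=> x xu; have Sx : Sset (pairmx x (invmx x)).
    by apply/SsetP; rewrite fst_pairmx snd_pairmx.
  move=> nz; exists (pairmx x (invmx x)); last exact: fst_pairmx.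
  by apply: contrapT => nC; move/eqP: nz; apply; exact: FC.
Qed.
End Restriction.

(** * Haar measure on N x N and the modulus of the Levi action *)

Section Groups.
Variables (R : realType) (K : topFieldType) (v : K -> R).
Hypotheses (vP : topological_abs v) (lcK : locally_compact [set: K]).

Lemma closed_entries p q (P : 'I_p -> 'I_q -> Prop) (c : 'M[K]_(p, q)) :
  closed [set X : 'M[K]_(p, q) | forall i j, P i j -> X i j = c i j].
Proof.
have -> : [set X : 'M[K]_(p, q) | forall i j, P i j -> X i j = c i j] =
    \bigcap_(ij in [set ij | P ij.1 ij.2])
      ((fun X : 'M[K]_(p, q) => X ij.1 ij.2) @^-1` [set c ij.1 ij.2]).
  apply/seteqP; split=> X H; first by move=> [i j] /= /H.
  by move=> i j Pij; exact: (H (i, j)).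
apply: closed_bigI => -[i j] _; apply: closed_comp.
  by move=> X _; exact: entry_continuous.
apply: accessible_closed_set1; apply: hausdorff_accessible.
exact: (hausdorff_abs vP).
Qed.

Lemma GL_closed_subgroup n : closed_subgroup [set A : 'M[K]_n | A \in unitmx].
Proof.
split.
- by exists setT; rewrite ?setTI //; exact: closedT.
- exact: unitmx1.
- by move=> A B /= Au Bu; rewrite unitmx_mul Au.
- by move=> A /=; rewrite unitmx_inv.
Qed.

Lemma closed_subgroupI n (Z : set 'M[K]_n) : closed Z ->
  (forall A, Z A -> A \in unitmx) -> Z 1%:M ->
  (forall A B, Z A -> Z B -> Z (A *m B)) -> (forall A, Z A -> Z (invmx A)) ->
  closed_subgroup Z.
Proof.
move=> cZ Zu Z1 ZM ZV; split=> //; exists Z => //.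
by apply/seteqP; split=> A; [move=> ZA; split=> //; exact: Zu|case].
Qed.

Lemma closed_Nset m r : closed (@Nset K m r).
Proof.
have -> : @Nset K m r = [set X : 'M[K]_(ndim m r) |
    forall i j, (block j <= block i)%N -> X i j = (1%:M : 'M[K]_(ndim m r)) i j].
  by apply/seteqP; split=> X H i j /H ->; rewrite mxE.
exact: closed_entries.
Qed.

Lemma Nset_closed_subgroup m r : closed_subgroup (@Nset K m r).
Proof.
apply: closed_subgroupI.
- exact: closed_Nset.
- exact: Nset_unit.
- exact: Nset1.
- exact: NsetM.
- exact: NsetV.
Qed.

(** G x G as a closed subgroup of GL_2n, so that uniqueness of Haar measures
    applies to N x N. *)
Section Double.
Variables (n : nat) (G : set 'M[K]_n).

Definition dbl (a b : 'M[K]_n) : 'M[K]_(n + n) := block_mx a 0 0 b.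

Definition double : set 'M[K]_(n + n) := [set X | exists a b, [/\ G a, G b & X = dbl a b]].

Lemma dblM a b a' b' : dbl a b *m dbl a' b' = dbl (a *m a') (b *m b').
Proof. by rewrite /dbl mulmx_block !(mulmx0, mul0mx, addr0, add0r). Qed.

Lemma dbl1 : dbl 1%:M 1%:M = 1%:M.
Proof. by rewrite /dbl -scalar_mx_block. Qed.

Lemma dbl_unit a b : a \in unitmx -> b \in unitmx -> dbl a b \in unitmx.
Proof. by move=> au bu; rewrite unitmxE det_ublock unitrM -!unitmxE au. Qed.

Lemma dblV a b : a \in unitmx -> b \in unitmx ->
  invmx (dbl a b) = dbl (invmx a) (invmx b).
Proof.
by move=> au bu; apply: mulmx1_inv; rewrite dblM !mulmxV // dbl1.
Qed.

Lemma dbl_continuous : continuous (fun p : 'M[K]_n * 'M[K]_n => dbl p.1 p.2).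
Proof.
move=> p; apply: (cvg_block_mx (FF := nbhs_filter p)); try exact: cvg_cst.
  exact: cvg_fst.
exact: cvg_snd.
Qed.

Lemma ulsubmx_continuous : continuous (fun X : 'M[K]_(n + n) => ulsubmx X).
Proof.
move=> X; apply: (cvg_mx (F := nbhs X)) => i j; rewrite !mxE.
by under eq_fun do rewrite !mxE; exact: entry_continuous.
Qed.

Lemma drsubmx_continuous : continuous (fun X : 'M[K]_(n + n) => drsubmx X).
Proof.
move=> X; apply: (cvg_mx (F := nbhs X)) => i j; rewrite !mxE.
by under eq_fun do rewrite !mxE; exact: entry_continuous.
Qed.

Lemma doubleE : double = [set X | [/\ G (ulsubmx X), G (drsubmx X) &
  ursubmx X = 0 /\ dlsubmx X = 0]].
Proof.
apply/seteqP; split=> X.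
  by move=> [a [b [Ga Gb ->]]]; rewrite /dbl /= block_mxKul block_mxKdr block_mxKur block_mxKdl.
by move=> [Ga Gb [u0 d0]]; exists (ulsubmx X), (drsubmx X); split=> //;
  rewrite /dbl -{1}(submxK X) u0 d0.
Qed.

Lemma double_closed_subgroup : closed G -> closed_subgroup G -> closed_subgroup double.
Proof.
move=> cG HG; have Gu := subgroup_unit HG; have [_ G1 GM GV] := HG.
apply: closed_subgroupI.
- rewrite doubleE.
  have -> : [set X : 'M[K]_(n + n) | [/\ G (ulsubmx X), G (drsubmx X) &
      ursubmx X = 0 /\ dlsubmx X = 0]] =
     (fun X : 'M[K]_(n + n) => ulsubmx X) @^-1` G `&`
     ((fun X : 'M[K]_(n + n) => drsubmx X) @^-1` G `&`
     [set X : 'M[K]_(n + n) | forall i j : 'I_(n + n), (i < n)%N != (j < n)%N -> X i j = (0 : 'M[K]_(n + n)) i j]).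
    apply/seteqP; split=> X.
      move=> [Ga Gb [u0 d0]]; split=> //; split=> // i j.
      rewrite -(submxK X) u0 d0 [RHS]mxE.
      case: (split_ordP i) => i1 ->; case: (split_ordP j) => j1 -> /=.
      - by have h1 := ltn_ord i1; have h2 := ltn_ord j1; move=> H; exfalso; move: H; lia.
      - by rewrite block_mxEur mxE.
      - by rewrite block_mxEdl mxE.
      - by move=> H; exfalso; move: H; lia.
    move=> [Ga [Gb X0]]; split=> //; split; apply/matrixP => i j; rewrite !mxE X0 ?mxE //=.
      by rewrite ltn_ord -[X in _ != (_ < X)%N]addn0 ltn_add2l.
    by rewrite ltn_ord -[X in (_ < X)%N != _]addn0 ltn_add2l.
  apply: closedI.
    by apply: closed_comp => // X _; exact: ulsubmx_continuous.
  apply: closedI; last exact: closed_entries.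
  by apply: closed_comp => // X _; exact: drsubmx_continuous.
- by move=> _ [a [b [/Gu au /Gu bu ->]]]; exact: dbl_unit.
- by exists 1%:M, 1%:M; rewrite dbl1.
- move=> _ _ [a [b [Ga Gb ->]]] [a' [b' [Ga' Gb' ->]]].
  by exists (a *m a'), (b *m b'); rewrite dblM; split=> //; exact: GM.
- move=> _ [a [b [Ga Gb ->]]]; exists (invmx a), (invmx b).
  by split; [exact: GV|exact: GV|rewrite dblV //; exact: Gu].
Qed.

Local Notation dblp :=
  (fun p : borel 'M[K]_n * borel 'M[K]_n => dbl p.1 p.2 : borel 'M[K]_(n + n)).

Lemma measurable_dbl : measurable_fun setT
  dblp.
Proof.
apply: (@continuous_prod_borel_fun 'M[K]_n 'M[K]_n 'M[K]_(n + n)).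
- exact: (countable_base_mxK vP lcK).
- exact: (countable_base_mxK vP lcK).
- exact: dbl_continuous.
Qed.

(** Fubini reduces the invariance of the product measure under (a, b) to the
    invariance of nu under a and under b. *)
Lemma haar_double (nu : {sigma_finite_measure set (borel 'M[K]_n) -> \bar R}) :
  closed G -> closed_subgroup G -> haar_on G nu ->
  exists2 mu : {measure set (borel 'M[K]_(n + n)) -> \bar R}, haar_on double mu &
   forall A, mu A = (nu \x nu)%E
     (dblp @^-1` A).
Proof.
move=> cG HG [fnu pnu inu cnu].
have Gu := subgroup_unit HG; have [_ G1 GM GV] := HG.
have mG := measurable_subgroup vP HG.
have [mu muE] := pushforward_restrP (nu \x nu)%E measurableT measurable_dbl.
have {}muE A : mu A = (nu \x nu)%E
     (dblp @^-1` A).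
  by rewrite muE setIT.
have mpre A : measurable A -> measurable (dblp @^-1` A).
  by move=> mA; rewrite -[X in measurable X]setTI; exact: measurable_dbl.
exists mu => //; split.
- move=> C cC CG; rewrite muE.
  have c1 : compact ((fun X : 'M[K]_(n + n) => ulsubmx X) @` C).
    apply: continuous_compact => //; apply: continuous_subspaceT.
    exact: ulsubmx_continuous.
  have c2 : compact ((fun X : 'M[K]_(n + n) => drsubmx X) @` C).
    apply: continuous_compact => //; apply: continuous_subspaceT.
    exact: drsubmx_continuous.
  have m1 := closed_borel_compact vP c1; have m2 := closed_borel_compact vP c2.
  have f1 : (nu ((fun X : 'M[K]_(n + n) => ulsubmx X) @` C : set (borel 'M[K]_n)) < +oo)%E.
    apply: fnu => // _ [X /CG[a [b [Ga Gb ->]]] <-].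
    by rewrite /dbl block_mxKul.
  have f2 : (nu ((fun X : 'M[K]_(n + n) => drsubmx X) @` C : set (borel 'M[K]_n)) < +oo)%E.
    apply: fnu => // _ [X /CG[a [b [Ga Gb ->]]] <-].
    by rewrite /dbl block_mxKdr.
  apply: (@le_lt_trans _ _ ((nu \x nu)%E
     (((fun X : 'M[K]_(n + n) => ulsubmx X) @` C : set (borel 'M[K]_n)) `*`
      ((fun X : 'M[K]_(n + n) => drsubmx X) @` C : set (borel 'M[K]_n))))).
    apply: le_measure; rewrite ?inE.
    - by apply: mpre; exact: (closed_borel_compact vP).
    - exact: measurableX.
    - move=> [a b] Cab; split; [exists (dbl a b) => //|exists (dbl a b) => //].
        by rewrite /dbl block_mxKul.
      by rewrite /dbl block_mxKdr.
  rewrite product_measure1E //; apply: lte_mul_pinfty => //.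
  by rewrite ge0_fin_numE.
- move=> O oO [X [OX [a [b [Ga Gb XE]]]]]; rewrite muE.
  have oO2 : open ((fun p : 'M[K]_n * 'M[K]_n => dbl p.1 p.2) @^-1` O).
    by apply: open_comp => // p _; exact: dbl_continuous.
  have [[P Q] /= [aP bQ] PQO] : nbhs (a, b)
      ((fun p : 'M[K]_n * 'M[K]_n => dbl p.1 p.2) @^-1` O).
    by apply: open_nbhs_nbhs; split=> //=; rewrite -XE.
  have mP : measurable (P° : set (borel 'M[K]_n)) by apply: open_borel; exact: open_interior.
  have mQ : measurable (Q° : set (borel 'M[K]_n)) by apply: open_borel; exact: open_interior.
  apply: (@lt_le_trans _ _ ((nu \x nu)%E ((P° : set (borel 'M[K]_n)) `*` (Q° : set (borel 'M[K]_n))))).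
    rewrite product_measure1E // mule_gt0 //; apply: pnu; try exact: open_interior.
      by exists a.
    by exists b.
  apply: le_measure; rewrite ?inE.
  - exact: measurableX.
  - by apply: mpre; exact: open_borel.
  - by move=> [x y] [/interior_subset Px /interior_subset Qy]; apply: (PQO (x, y)).
- move=> g A [a [b [Ga Gb ->]]] mA; rewrite !muE.
  set E := dblp @^-1` A.
  have mE : measurable E by exact: mpre.
  have -> : dblp @^-1`
      ((fun x : borel 'M[K]_(n + n) => mulop (dbl a b, x)) @^-1` A) =
    [set p | E (a *m p.1, b *m p.2)].
    by apply/seteqP; split=> p /=; rewrite /mulop /E /= dblM.
  have mx (B : set (borel 'M[K]_n * borel 'M[K]_n)) : measurable B ->
    measurable_fun setT (fun x => nu (xsection B x)) by exact: measurable_fun_xsection.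
  rewrite /product_measure1.
  rewrite -[RHS](left_invariant_integral (@measurable_mulop _ _ _ vP lcK n) inu Ga); last 2 first.
  - exact: (mx E mE).
  - by move=> x; exact: measure_ge0.
  apply: eq_integral => x _ /=.
  rewrite -[RHS](inu b) //; last exact: measurable_xsection.
- rewrite /concentrated muE.
  have mnG : measurable (~` G : set (borel 'M[K]_n)) by exact: measurableC.
  apply/eqP; rewrite eq_le measure_ge0 andbT.
  apply: (@le_trans _ _ ((nu \x nu)%E (((~` G : set (borel 'M[K]_n)) `*` (setT : set (borel 'M[K]_n)))
    `|` ((setT : set (borel 'M[K]_n)) `*` (~` G : set (borel 'M[K]_n)))))).
    apply: le_measure; rewrite ?inE.
    - apply: mpre; apply: measurableC; apply: (measurable_subgroup vP).
      exact: double_closed_subgroup.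
    - by apply: measurableU; exact: measurableX.
    - move=> [x y] /= nG; have [Gx|nGx] := pselect (G x); last by left.
      by right; split=> // Gy; apply: nG; exists x, y.
  have e1 : (nu \x nu)%E ((~` G : set (borel 'M[K]_n)) `*` (setT : set (borel 'M[K]_n))) = 0%E.
    by rewrite product_measure1E // [X in (X * _)%E]cnu mul0e.
  have e2 : (nu \x nu)%E ((setT : set (borel 'M[K]_n)) `*` (~` G : set (borel 'M[K]_n))) = 0%E.
    by rewrite product_measure1E // [X in (_ * X)%E]cnu mule0.
  apply: le_trans (measureU2 _ _ _) _; try exact: measurableX.
  by rewrite [X in (X + _)%E]e1 [X in (_ + X)%E]e2 adde0.
Qed.
End Double.

Lemma haar_on_measure n (G : set 'M[K]_n)
    (nu : {measure set (borel 'M[K]_n) -> \bar R}) : closed_subgroup G ->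
  haar_on G nu -> haar_measure (fun x y : 'M[K]_n => x *m y) G nu.
Proof.
move=> HG [fnu pnu inu cnu]; have [_ G1 GM GV] := HG.
have Gu := subgroup_unit HG; have mG := measurable_subgroup vP HG; split=> //.
  move=> O oO OG; have mO := open_borel oO.
  have := pnu O oO OG; by rewrite (concentratedE mG cnu).
move=> g A Gg mA AG; rewrite -(inu (invmx g) A (GV _ Gg) mA).
congr (nu _); apply/seteqP; split=> [_ [x Ax <-]|z].
  by rewrite /mulop /= mulKmx // Gu.
by rewrite /mulop /= => Az; exists (invmx g *m z) => //; rewrite mulKVmx // Gu.
Qed.

(** The image of a Haar measure under a topological automorphism is again a Haar
    measure, hence a multiple of the first one. *)
Lemma aut_modulus n (G : set 'M[K]_n)
    (nu : {measure set (borel 'M[K]_n) -> \bar R}) (p s : 'M[K]_n -> 'M[K]_n) :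
  closed_subgroup G -> haar_on G nu ->
  continuous p -> (forall y, G y -> {for y, continuous s}) ->
  (forall x, G x -> G (p x)) -> (forall y, G y -> G (s y)) ->
  (forall x, G x -> s (p x) = x) -> (forall y, G y -> p (s y) = y) ->
  (forall x y, G x -> G y -> p (x *m y) = p x *m p y) ->
  exists2 c : R, 0 < c & forall A : set (borel 'M[K]_n), measurable A ->
    nu (p @^-1` A) = (c%:E * nu A)%E.
Proof.
move=> HG hnu pc sc pG sG sK pK pM; have [_ _ GM _] := HG.
have mG := measurable_subgroup vP HG.
have [nu' hnu' nu'E] := haar_push vP lcK HG (haar_on_measure HG hnu) mG pc sc pG sG sK pK GM pM.
have [c c0 cE] := haar_on_unique vP lcK HG hnu' hnu.
exists c => // A mA; rewrite -cE // nu'E; have [_ _ _ cnu] := hnu.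
rewrite (concentratedE mG cnu) //.
by rewrite -[X in measurable X]setTI; exact: (continuous_borel_fun pc).
Qed.

Section Modulus.
Variables (m r : nat).
Local Notation n := (ndim m r).
Local Notation N := (@Nset K m r).
Variable nu : {measure set (borel 'M[K]_n) -> \bar R}.
Hypothesis hnu : haar_on N nu.

Definition conjL (g : 'M[K]_m) (u : 'M[K]_n) : 'M[K]_n :=
  levi r g *m u *m levi r (invmx g).

Lemma conjL_continuous g : continuous (conjL g).
Proof.
move=> u; apply: (cvg_mulmx vP (nbhs_filter u)); last exact: cvg_cst.
by apply: (cvg_mulmx vP (nbhs_filter u)); [exact: cvg_cst|exact: cvg_id].
Qed.

Lemma conjLK g u : g \in unitmx -> conjL (invmx g) (conjL g u) = u.
Proof.
move=> gu; rewrite /conjL invmxK !mulmxA -leviM mulVmx // levi1 mul1mx.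
by rewrite -mulmxA -leviM mulVmx // levi1 mulmx1.
Qed.

Lemma conjLVK g u : g \in unitmx -> conjL g (conjL (invmx g) u) = u.
Proof. by move=> gu; rewrite -{1}(invmxK g) conjLK // unitmx_inv. Qed.

Lemma conjLM g u a : g \in unitmx -> conjL g (u *m a) = conjL g u *m conjL g a.
Proof.
move=> gu; rewrite /conjL !mulmxA; congr (_ *m _ *m _).
by rewrite -[in RHS](mulmxA _ (levi r (invmx g))) -leviM mulVmx // levi1 mulmx1.
Qed.

Lemma conjL_comp g h u : g \in unitmx -> h \in unitmx ->
  conjL (g *m h) u = conjL g (conjL h u).
Proof.
move=> gu hu; rewrite /conjL leviM !mulmxA -!mulmxA; congr (_ *m (_ *m (_ *m _))).
by rewrite -leviM invmxM.
Qed.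

Lemma conjL_modulus g : g \in unitmx ->
  exists2 c : R, 0 < c & forall A : set (borel 'M[K]_n), measurable A ->
    nu (conjL g @^-1` A) = (c%:E * nu A)%E.
Proof.
move=> gu; have gVu : invmx g \in unitmx by rewrite unitmx_inv.
apply: (@aut_modulus n N nu (conjL g) (conjL (invmx g))) => //.
- exact: Nset_closed_subgroup.
- exact: conjL_continuous.
- by move=> y _; exact: conjL_continuous.
- by move=> x; exact: Nset_levi.
- by move=> x; exact: Nset_levi.
- by move=> x _; exact: conjLK.
- by move=> x _; exact: conjLVK.
- by move=> x y _ _; exact: conjLM.
Qed.

Lemma flip_continuous : continuous (@flip K m r).
Proof.
move=> u; apply: (cvg_mx (F := nbhs u)) => i j; rewrite /flip mxE.
under eq_fun do rewrite mxE.
have h := cvg_adj vP (nbhs_filter u) (@cvg_id _ (nbhs u)).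
exact: ((cvg_mxP (FF := nbhs_filter u) _ _).1 h).
Qed.

Lemma flip_modulus :
  exists2 c : R, 0 < c & forall A : set (borel 'M[K]_n), measurable A ->
    nu (@flip K m r @^-1` A) = (c%:E * nu A)%E.
Proof.
apply: (@aut_modulus n N nu (@flip K m r) (@flip K m r)) => //.
- exact: Nset_closed_subgroup.
- exact: flip_continuous.
- by move=> y _; exact: flip_continuous.
- exact: Nset_flip.
- exact: Nset_flip.
- exact: flipK.
- exact: flipK.
- exact: flipM.
Qed.

(** The modulus delta of conjugation by GL_m on N is a character, so
    delta(g^T) = delta(g).  As flip intertwines conjugation by g and by g^-T and
    rescales nu by a constant, delta(g) = delta(g^-T) = delta(g^-1).  Hence
    delta(g)^2 = 1, and delta(g) > 0. *)
Lemma conjL_invariant g (A : set (borel 'M[K]_n)) : g \in unitmx -> measurable A ->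
  nu (conjL g @^-1` A) = nu A.
Proof.
have [fnu pnu inu cnu] := hnu.
have HN := Nset_closed_subgroup m r; have mN := measurable_subgroup vP HN.
have [B mB [b b0 Bb]] : exists2 B : set (borel 'M[K]_n), measurable B &
    exists2 b : R, 0 < b & nu B = b%:E.
  have cB : compact (GLball v n 2 `&` N) by exact: (compact_GLballI vP lcK HN).
  have mB := closed_borel_compact vP cB.
  exists (GLball v n 2 `&` N) => //.
  have /andP[B0 Boo] := haar_GLball vP lcK HN hnu.
  exists (fine (nu (GLball v n 2 `&` N : set (borel 'M[K]_n)))); first by rewrite fine_gt0 ?B0.
  by rewrite fineK // ge0_fin_numE.
have mpre (p : 'M[K]_n -> 'M[K]_n) (C : set (borel 'M[K]_n)) : continuous p -> measurable C ->
    measurable (p @^-1` C : set (borel 'M[K]_n)).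
  by move=> pc mC; rewrite -[X in measurable X]setTI; exact: (continuous_borel_fun pc).
have [de deP] : exists de : 'M[K]_m -> R, forall g, g \in unitmx ->
    0 < de g /\ forall A : set (borel 'M[K]_n), measurable A ->
    nu (conjL g @^-1` A) = ((de g)%:E * nu A)%E.
  have H h : exists c : R, h \in unitmx -> 0 < c /\ forall A : set (borel 'M[K]_n),
      measurable A -> nu (conjL h @^-1` A) = (c%:E * nu A)%E.
    have [hu|nhu] := boolP (h \in unitmx); last by exists 0.
    by have [c c0 cE] := conjL_modulus hu; exists c.
  by have [f fP] := choice H; exists f.
have inj (x y : R) : (x%:E * b%:E = y%:E * b%:E)%E -> x = y.
  by rewrite -!EFinM => -[]; apply: mulIf; rewrite gt_eqF.
have chi : mult_character de.
  split=> [h /deP[h0 _]|g1 g2 u1 u2]; first by rewrite gt_eqF.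
  have u12 : g1 *m g2 \in unitmx by rewrite unitmx_mul u1.
  apply: inj; rewrite -Bb -(deP _ u12).2 //.
  have -> : conjL (g1 *m g2) @^-1` B = conjL g2 @^-1` (conjL g1 @^-1` B).
    by apply/seteqP; split=> x /=; rewrite conjL_comp.
  rewrite (deP _ u2).2; last by apply: mpre => //; exact: conjL_continuous.
  by rewrite (deP _ u1).2 // muleA -EFinM mulrC.
(* an element of absolute value greater than 1 is neither 0 nor -1 *)
have [t t0 t1] : exists2 t : K, t != 0 & 1 + t != 0.
  have [x x0 x1] := abs_large vP 1; exists x => //.
  apply/eqP => e; move: x1; have -> : x = - 1 by rewrite -[x](addKr 1) e addr0.
  by rewrite (absN vP) (abs1 vP) ltxx.
have deT h : h \in unitmx -> de h^T = de h by apply: chi_trmx t0 t1 _ _ chi h.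
have [s s0 sE] := flip_modulus.
have flip_de h : h \in unitmx -> de h = de (invmx h)^T.
  move=> hu; have hTu : (invmx h)^T \in unitmx by rewrite unitmx_tr unitmx_inv.
  apply: (@mulIf _ s); first by rewrite gt_eqF.
  have mfB : measurable (@flip K m r @^-1` B : set (borel 'M[K]_n)).
    by apply: mpre => //; exact: flip_continuous.
  have mcB : measurable (conjL (invmx h)^T @^-1` B : set (borel 'M[K]_n)).
    by apply: mpre => //; exact: conjL_continuous.
  have E1 : nu (conjL h @^-1` (@flip K m r @^-1` B)) = ((de h * s)%:E * b%:E)%E.
    by rewrite (deP _ hu).2 // sE // Bb muleA EFinM.
  have E2 : nu (@flip K m r @^-1` (conjL (invmx h)^T @^-1` B)) =
      ((de (invmx h)^T * s)%:E * b%:E)%E.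
    by rewrite sE // (deP _ hTu).2 // Bb muleA EFinM (muleC s%:E).
  apply: inj; rewrite -E1 -E2 (concentratedE mN cnu); last first.
    by apply: mpre => //; exact: conjL_continuous.
  rewrite [RHS](concentratedE mN cnu); last first.
    by apply: mpre => //; exact: flip_continuous.
  congr (nu _); apply/seteqP; split=> x [/= Bx Nx]; split=> //=.
    by move: Bx; rewrite flip_levi.
  by rewrite flip_levi.
move=> gu mA; have [dg0 dgE] := deP _ gu; rewrite dgE //.
suff -> : de g = 1 by rewrite mul1e.
have gVu : invmx g \in unitmx by rewrite unitmx_inv.
have d1 : de 1%:M = 1.
  have [_ chiM] := chi; have [h0 _] := deP _ (unitmx1 K m).
  apply: (@mulfI _ (de 1%:M)); first by rewrite gt_eqF.
  by rewrite -chiM ?unitmx1 // mulmx1 mulr1.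
have : de g * de g = 1.
  by rewrite {2}flip_de // deT // -chi.2 // mulmxV.
move=> e; apply/eqP; rewrite -(@eqrXn2 _ 2) // ?ltW // expr2 e expr1n //.
Qed.
End Modulus.
End Groups.

(** * Integrals with parameters *)

Section Scaling.
Context d (T : measurableType d) (R : realType).
Implicit Types (mu nu : {measure set T -> \bar R}) (f : T -> R) (c : R).

Lemma muleBr_ge0 c (x y : \bar R) : 0 < c -> (0 <= x)%E -> (0 <= y)%E ->
  fine (c%:E * x - c%:E * y) = c * fine (x - y).
Proof.
move=> c0; case: x => [x| |] //; case: y => [y| |] // _ _;
  rewrite ?gt0_muley ?lte_fin //= ?mulr0 // mulrBr //.
Qed.

(** The positive and the negative part are scaled separately, so the convention
    that makes infinite values 0 does no harm for non integrable f. *)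
Lemma Rintegral_scale mu f c : 0 < c -> measurable_fun setT f ->
  Rintegral mu setT (fun x => c * f x) = c * Rintegral mu setT f.
Proof.
move=> c0 mf; have mfE : measurable_fun setT (EFin \o f) by exact/measurable_EFinP.
have c0E : (0 <= c%:E)%E by rewrite lee_fin ltW.
have maxM (y : R) : maxe (c * y)%:E 0%E = (c%:E * maxe y%:E 0%E)%E.
  by rewrite -[0%E]/(0%:E) -!EFin_max -EFinM maxr_pMr ?ltW // mulr0.
rewrite /Rintegral integralE [in RHS]integralE -muleBr_ge0 //; last 2 first.
- by apply: integral_ge0 => x _; exact: funepos_ge0.
- by apply: integral_ge0 => x _; exact: funeneg_ge0.
rewrite -!ge0_integralZl //; last 2 first.
- exact: measurable_funeneg.
- exact: measurable_funepos.
have -> : (fun x => (c * f x)%:E) = (fun x => c%:E * (f x)%:E)%E.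
  by apply/funext => x; rewrite EFinM.
congr (fine (_ - _)); apply: eq_integral => x _; rewrite unlock /=.
  exact: maxM.
by rewrite -mulrN; exact: maxM.
Qed.

Lemma Rintegral_measure_scale mu nu f c : 0 < c ->
  (forall A, measurable A -> mu A = (c%:E * nu A)%E) -> measurable_fun setT f ->
  Rintegral mu setT f = c * Rintegral nu setT f.
Proof.
move=> c0 munu mf; have mfE : measurable_fun setT (EFin \o f) by exact/measurable_EFinP.
have H (g : T -> \bar R) : measurable_fun setT g -> (forall x, (0 <= g x)%E) ->
    (\int[mu]_x g x = c%:E * \int[nu]_x g x)%E.
  move=> mg g0; pose k : {nonneg R} := NngNum (ltW c0).
  have <- := @ge0_integral_mscale _ _ _ nu setT measurableT k g mg (fun x _ => g0 x).
  by apply: eq_measure_integral => A mA _; rewrite munu.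
rewrite /Rintegral integralE [in RHS]integralE -muleBr_ge0 //; last 2 first.
- by apply: integral_ge0 => x _; exact: funepos_ge0.
- by apply: integral_ge0 => x _; exact: funeneg_ge0.
rewrite !H //.
- exact: measurable_funeneg.
- exact: measurable_funepos.
Qed.

Lemma Rintegral_invariant d' (T' : measurableType d') (mu' : {measure set T' -> \bar R})
    (p : T' -> T') (f : T' -> R) : measurable_fun setT p ->
  (forall A, measurable A -> mu' (p @^-1` A) = mu' A) -> measurable_fun setT f ->
  Rintegral mu' setT (fun x => f (p x)) = Rintegral mu' setT f.
Proof.
move=> mp inv mf; apply: Rintegral_push => // A mA.
by rewrite setIT inv.
Qed.

End Scaling.

Lemma measurable_Rintegral_param d1 d2 d3 (T1 : measurableType d1)
    (T2 : measurableType d2) (T3 : measurableType d3) (R : realType)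
    (m2 : {sigma_finite_measure set T2 -> \bar R})
    (m3 : {sigma_finite_measure set T3 -> \bar R}) (f : T1 * (T2 * T3) -> R) :
  measurable_fun setT f ->
  measurable_fun setT (fun x => Rintegral (m2 \x m3)%E setT (fun y => f (x, y))).
Proof.
move=> mf; have mE : measurable_fun setT (EFin \o f) by exact/measurable_EFinP.
have H (g : T1 * (T2 * T3) -> \bar R) : measurable_fun setT g ->
    (forall q, (0 <= g q)%E) ->
    measurable_fun setT (fun x => \int[(m2 \x m3)%E]_y g (x, y))%E.
  move=> mg g0.
  pose k (q : T1 * T2 * T3) := g (q.1.1, (q.1.2, q.2)).
  have mk : measurable_fun setT k.
    apply: (measurableT_comp mg); apply: measurable_fun_pair.
      exact: (measurableT_comp measurable_fst measurable_fst).
    apply: measurable_fun_pair => //.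
    exact: (measurableT_comp measurable_snd measurable_fst).
  have m1 := measurable_fun_fubini_tonelli_F (m2 := m3) _ mk (fun q => g0 _).
  have g1 q : (0 <= fubini_F m3 k q)%E by apply: integral_ge0 => y _; exact: g0.
  have := measurable_fun_fubini_tonelli_F (m2 := m2) _ m1 g1.
  apply: eq_measurable_fun => x _; rewrite fubini_tonelli1 //.
  by apply: (measurableT_comp mg); exact: measurable_pair1.
have := measurableT_comp (fine_measurable measurableT)
  (emeasurable_funB (H _ (measurable_funepos mE) (funepos_ge0 _))
                    (H _ (measurable_funeneg mE) (funeneg_ge0 _))).
apply: eq_measurable_fun => h _; rewrite /Rintegral /= [in RHS]integralE.
have e1 : (fun y => (EFin \o f)^\+%E (h, y)) = (fun y => (f (h, y))%:E)^\+%E.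
  by apply/funext => y; rewrite unlock.
have e2 : (fun y => (EFin \o f)^\-%E (h, y)) = (fun y => (f (h, y))%:E)^\-%E.
  by apply/funext => y; rewrite unlock.
by rewrite e1 e2.
Qed.

Lemma measurable_restrict_open (R : realType) d (X : measurableType d)
    (S : topologicalType) (i : X -> S) (f : S -> R) (Om : set S) (E : set X) :
  opens_measurable i -> open Om -> (forall s, Om s -> {for s, continuous f}) ->
  measurable E -> E `<=` i @^-1` Om ->
  measurable_fun setT ((fun x => f (i x)) \_ E).
Proof.
move=> mi oOm fc mE EOm; apply/(measurable_restrictT _ mE).
apply: (@measurable_funS _ _ _ _ (i @^-1` Om)) => //; first exact: mi.
apply: (measurability _ (RGenOInfty.measurableE R)) => //.
move=> _ [_ [a ->] <-].
have -> : i @^-1` Om `&` (fun x => f (i x)) @^-1` `]a, +oo[%classic =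
   i @^-1` (Om `&` f @^-1` [set t | a < t]).
  by apply/seteqP; split=> x [Ox]; rewrite /= ?in_itv /= ?andbT => h; split=> //;
    rewrite /= ?in_itv /= ?andbT.
by apply: mi; apply: open_preimage_on => //; exact: open_gt.
Qed.

(** * Integrands on GL_m(K) and N x N *)

Section OrbitalIntegrals.
Variables (R : realType) (K : topFieldType) (v : K -> R).
Hypotheses (vP : topological_abs v) (lcK : locally_compact [set: K]).
Variables (m r : nat).
Local Notation n := (ndim m r).
Local Notation N := (@Nset K m r).
Local Notation GL := [set h : 'M[K]_m | h \in unitmx].

(** Continuity gives measurability; compact support in (a, b) for each h gives
    integrability over N x N, hence Fubini there. *)
Definition admissible (phi : 'M[K]_m -> 'M[K]_n * 'M[K]_n -> R) : Prop :=
  (forall h a b, h \in unitmx -> a \in unitmx -> b \in unitmx ->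
     {for (h, (a, b)), continuous
        (fun q : 'M[K]_m * ('M[K]_n * 'M[K]_n) => phi q.1 q.2)}) /\
  (forall h, h \in unitmx -> exists Q1 Q2 : set 'M[K]_n,
     [/\ compact Q1, compact Q2, Q1 `<=` N, Q2 `<=` N &
         forall a b, N a -> N b -> phi h (a, b) != 0 -> Q1 a /\ Q2 b]).

Section Integrand.
Variable phi : 'M[K]_m -> 'M[K]_n * 'M[K]_n -> R.
Hypothesis aphi : admissible phi.
Variable nu : {sigma_finite_measure set (borel 'M[K]_n) -> \bar R}.
Hypothesis hnu : haar_on N nu.

Local Notation X := (borel 'M[K]_m).
Local Notation Y := (borel 'M[K]_n).

Let dom : set (X * (Y * Y)) := [set q | [/\ GL q.1, N q.2.1 & N q.2.2]].

(** phi is controlled on the groups only; extended by 0 it becomes a measurable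
    function on the spaces of matrices, where the measures are defined. *)
Definition ext_phi : X * (Y * Y) -> R := (fun q => phi q.1 q.2) \_ dom.

Lemma ext_phiE h a b : h \in unitmx -> N a -> N b -> ext_phi (h, (a, b)) = phi h (a, b).
Proof. by move=> hu Na Nb; rewrite /ext_phi patchE mem_set. Qed.

Lemma ext_phi0 h a b : ~ (N a /\ N b) -> ext_phi (h, (a, b)) = 0.
Proof. by move=> nN; rewrite /ext_phi patchE memNset // => -[_ Na Nb]; apply: nN. Qed.

Lemma ext_phi0h h p : h \notin unitmx -> ext_phi (h, p) = 0.
Proof.
by move=> nu'; rewrite /ext_phi patchE memNset // => -[/= hu _ _]; rewrite hu in nu'.
Qed.

Lemma measurable_ext_phi : measurable_fun setT ext_phi.
Proof.
have [fc _] := aphi.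
have mN : measurable (N : set Y) := measurable_subgroup vP (Nset_closed_subgroup vP m r).
have mGL : measurable (GL : set X) by apply: open_borel; exact: (GL_open vP).
pose i (q : X * (Y * Y)) : 'M[K]_m * ('M[K]_n * 'M[K]_n) := (q.1, (q.2.1, q.2.2)).
have bm k l := @countable_base_mxK _ _ _ vP lcK k l.
have mi : opens_measurable i.
  apply: (@opens_measurable_prod _ _ X (Y * Y)%type 'M[K]_m ('M[K]_n * 'M[K]_n)%type
    (id : X -> 'M[K]_m) (fun p : Y * Y => (p.1, p.2))) => //.
  - exact: (countable_base_prod (bm _ _) (bm _ _)).
  - exact: opens_measurable_borel.
  - apply: (@opens_measurable_prod _ _ Y Y 'M[K]_n 'M[K]_n (id : Y -> 'M[K]_n) (id : Y -> 'M[K]_n)) => //;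
    exact: opens_measurable_borel.
have -> : ext_phi = (fun q => (fun s => phi s.1 s.2) (i q)) \_ dom.
  by apply/funext => -[h [a b]]; rewrite /ext_phi !patchE.
apply: (@measurable_restrict_open R _ (X * (Y * Y))%type _ i (fun s => phi s.1 s.2)
  [set s | [/\ s.1 \in unitmx, s.2.1 \in unitmx & s.2.2 \in unitmx]]) => //.
- have -> : [set s : 'M[K]_m * ('M[K]_n * 'M[K]_n) |
      [/\ s.1 \in unitmx, s.2.1 \in unitmx & s.2.2 \in unitmx]] =
    fst @^-1` [set A : 'M[K]_m | A \in unitmx] `&`
    ((fst \o snd) @^-1` [set A : 'M[K]_n | A \in unitmx] `&`
    (snd \o snd) @^-1` [set A : 'M[K]_n | A \in unitmx]).
    by apply/seteqP; split=> s; [move=> [? ? ?]|move=> [? [? ?]]].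
  apply: openI; first by apply: open_comp; [move=> s _; exact: cvg_fst|exact: (GL_open vP)].
  by apply: openI; apply: open_comp; try exact: (GL_open vP); move=> s _;
    [exact: (cvg_comp _ _ cvg_snd cvg_fst)|exact: (cvg_comp _ _ cvg_snd cvg_snd)].
- by move=> [h [a b]] [/= hu au bu]; exact: fc.
- have -> : dom = (GL : set X) `*` ((N : set Y) `*` (N : set Y)).
    by apply/seteqP; split=> -[h [a b]] /=; [move=> [? ? ?]|move=> [? [? ?]]].
  by apply: measurableX => //; exact: measurableX.
- by move=> [h [a b]] [/= hu Na Nb]; split=> //=; exact: Nset_unit.
Qed.

Lemma measurable_ext_phi2 h : measurable_fun setT (fun p : Y * Y => ext_phi (h, p)).
Proof. by apply: (measurableT_comp measurable_ext_phi); exact: measurable_pair1. Qed.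

(** A continuous function with support in a product of compact sets is bounded, and
    these sets have finite measure. *)
Lemma integrable_ext_phi h :
  (nu \x nu)%E.-integrable setT (fun p : Y * Y => (ext_phi (h, p))%:E).
Proof.
have [hu|hu] := boolP (h \in unitmx); last first.
  have -> : (fun p : Y * Y => (ext_phi (h, p))%:E) = cst 0%E.
    by apply/funext => p; rewrite ext_phi0h.
  exact: integrable0.
have [fc fs] := aphi; have [Q1 [Q2 [c1 c2 Q1N Q2N supp]]] := fs h hu.
have m1 := closed_borel_compact vP c1; have m2 := closed_borel_compact vP c2.
have [fnu _ _ _] := hnu.
have [M [M0 Mb]] : exists M : R, 0 <= M /\ forall a b, Q1 a -> Q2 b -> `|phi h (a, b)| <= M.
  have cQ : compact ((fun p => phi h p) @` (Q1 `*` Q2)).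
    apply: continuous_compact; last exact: compact_setX.
    apply: continuous_in_subspaceT => -[a b]; rewrite inE => -[/= /Q1N/Nset_unit au /Q2N/Nset_unit bu].
    have hc : (fun p : 'M[K]_n * 'M[K]_n => (h, p)) @ (a, b) --> (h, (a, b)).
      by apply: (@cvg_pair _ _ _ (nbhs (a, b)) (nbhs h) (nbhs (a, b))); [exact: cvg_cst|exact: cvg_id].
    exact: (cvg_comp _ _ hc (fc h a b hu au bu)).
  have [M [Mr HM]] := compact_bounded cQ.
  exists (Num.max 0 (M + 1)); split; first by rewrite le_max lexx.
  move=> a b Qa Qb; rewrite le_max; apply/orP; right.
  by apply: (HM (M + 1)); [rewrite ltrDl|exists (a, b)].
have mI : measurable_fun setT (fun p : Y * Y => (ext_phi (h, p))%:E).
  by apply/measurable_EFinP; exact: measurable_ext_phi2.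
apply/integrableP; split; first exact: mI.
have mQ : measurable ((Q1 : set Y) `*` (Q2 : set Y)) by exact: measurableX.
apply: (@le_lt_trans _ _ (\int[(nu \x nu)%E]_p (M%:E * (\1_((Q1 : set Y) `*` (Q2 : set Y)) p)%:E))%E).
  have mg : measurable_fun setT
      (fun p => (M%:E * (\1_((Q1 : set Y) `*` (Q2 : set Y)) p)%:E)%E : \bar R).
    by apply: emeasurable_funM => //; apply/measurable_EFinP; exact: measurable_indic.
  have mf : measurable_fun setT (fun p : Y * Y => `|(ext_phi (h, p))%:E|%E).
    by apply: measurableT_comp => //; exact: mI.
  apply: ge0_le_integral => //.
  move=> [a b] _; rewrite -EFinM lee_fin.
  have [[Na Nb]|nN] := pselect (N a /\ N b); last first.
    by rewrite ext_phi0 // normr0 mulr_ge0.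
  rewrite ext_phiE //; have [->|nz] := eqVneq (phi h (a, b)) 0.
    by rewrite normr0 mulr_ge0.
  have [Qa Qb] := supp a b Na Nb nz.
  by rewrite indicE mem_set // mulr1; exact: Mb.
rewrite ge0_integralZl //; last first.
  by apply/measurable_EFinP; exact: measurable_indic.
rewrite integral_indic // setIT [X in (_ * X)%E](product_measure1E nu nu m1 m2).
apply: lte_mul_pinfty => //; apply: lte_mul_pinfty => //; last exact: fnu.
by rewrite ge0_fin_numE //; exact: fnu.
Qed.

Definition fiber_int h : R := Rintegral (nu \x nu)%E setT (fun p : Y * Y => ext_phi (h, p)).
Definition half_int h (a : Y) : R := Rintegral nu setT (fun b : Y => ext_phi (h, (a, b))).

Lemma measurable_half_int h : measurable_fun setT (half_int h).
Proof.
have := measurable_fubini_F (integrable_ext_phi h).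
by move/(measurableT_comp (fine_measurable measurableT)).
Qed.

Lemma fiber_intE h : fiber_int h = Rintegral nu setT (half_int h).
Proof.
have I := integrable_ext_phi h.
transitivity (fine (\int[nu]_a fubini_F nu (fun p : Y * Y => (ext_phi (h, p))%:E) a)).
  by rewrite integral12_prod_meas1.
rewrite /Rintegral; congr fine.
have FI := integrable_fubini_F I.
apply: ae_eq_integral => //.
- exact: (measurable_fubini_F I).
- by apply/measurable_EFinP; exact: measurable_half_int.
have := integrable_ae measurableT FI; apply: filterS => a /(_ Logic.I) Fa _.
by rewrite /half_int /Rintegral fineK.
Qed.

Lemma measurable_fiber_int : measurable_fun setT fiber_int.
Proof.
exact: (measurable_Rintegral_param nu nu measurable_ext_phi).
Qed.

End Integrand.

End OrbitalIntegrals.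

(** * Both orbital integrals as an integral over GL_m(K) and N x N *)

Lemma eq_Rint d (T : measurableType d) (R : realType) (mu : {measure set T -> \bar R})
    (D : set T) (f g : T -> R) : (forall x, D x -> f x = g x) ->
  Rintegral mu D f = Rintegral mu D g.
Proof.
move=> fg; rewrite /Rintegral; congr fine; apply: eq_integral => x.
by rewrite inE => /fg ->.
Qed.

Section TwoSides.
Variables (R : realType) (K : topFieldType) (v : K -> R).
Hypotheses (vP : topological_abs v) (lcK : locally_compact [set: K]).
Variables (m r : nat).
Local Notation n := (ndim m r).
Local Notation N := (@Nset K m r).

Lemma closed_Urad : closed (@Urad K m r).
Proof.
have -> : @Urad K m r = (fun u => map_mx fst u) @^-1` N `&` (fun u => map_mx snd u) @^-1` N.
  by apply/seteqP; split=> u /UradP.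
apply: closedI; apply: closed_comp; try exact: (closed_Nset vP).
  by move=> u _; exact: fst_continuous.
by move=> u _; exact: snd_continuous.
Qed.

Section S_side.
Variable nu : {sigma_finite_measure set (borel 'M[K]_n) -> \bar R}.
Hypothesis hnu : haar_on N nu.

Let pU (u : 'M[K * K]_n) : 'M[K]_(n + n) := dbl (map_mx fst u) (map_mx snd u).

Let pU_continuous : continuous pU.
Proof.
move=> u.
have c1 := @fst_continuous K n n u; have c2 := @snd_continuous K n n u.
have hc : (fun x : 'M[K * K]_n => (map_mx fst x, map_mx snd x)) @ u -->
  (map_mx fst u, map_mx snd u) by exact: (cvg_pair c1 c2).
exact: (cvg_comp _ (fun p => dbl p.1 p.2) hc (@dbl_continuous K n (map_mx fst u, map_mx snd u))).
Qed.

(** An element of Urad is the pair of its components: the image of muU in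
    GL_2n(K) and the product measure are both Haar measures of N x N. *)
Lemma Urad_integral_fiber (muU : {measure set (borel 'M[K * K]_n) -> \bar R}) :
  haar_measure (fun x y : 'M[K * K]_n => x *m y) (@Urad K m r) muU ->
  exists2 c : R, 0 < c & forall phi, admissible phi -> forall h, h \in unitmx ->
    Rintegral muU (@Urad K m r) (fun u => phi h (map_mx fst u, map_mx snd u)) =
    c * fiber_int phi nu h.
Proof.
move=> hU; have mUr : measurable (@Urad K m r : set (borel 'M[K * K]_n)).
  by apply: closed_borel; exact: closed_Urad.
have HN := Nset_closed_subgroup vP m r; have cN := @closed_Nset _ _ _ vP m r.
have HD := double_closed_subgroup vP cN HN.
have sc : continuous (fun X : 'M[K]_(n + n) => pairmx (ulsubmx X) (drsubmx X)).
  by move=> X; apply: (cvg_pairmx (F := nbhs X)); [exact: ulsubmx_continuous|exact: drsubmx_continuous].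
have [mu' hmu' mu'E] : exists2 mu' : {measure set (borel 'M[K]_(n + n)) -> \bar R},
    haar_on (double N) mu' & forall A, mu' A = muU (pU @^-1` A `&` @Urad K m r).
  apply: (haar_push vP lcK HD hU mUr pU_continuous (fun y _ => sc y)).
  - by move=> x /UradP[N1 N2]; exists (map_mx fst x), (map_mx snd x).
  - move=> _ [a [b [Na Nb ->]]]; apply/UradP.
    by rewrite fst_pairmx snd_pairmx /dbl block_mxKul block_mxKdr.
  - by move=> x _; rewrite /pU /dbl block_mxKul block_mxKdr pairmxK.
  - move=> _ [a [b [Na Nb ->]]]; rewrite /pU fst_pairmx snd_pairmx.
    by rewrite /dbl block_mxKul block_mxKdr.
  - by move=> x y; exact: NsetM.
  - by move=> x y _ _; rewrite /pU fst_mulmx snd_mulmx dblM.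
have [mu0 hmu0 mu0E] := haar_double vP lcK cN HN hnu.
have [c c0 cE] := haar_on_unique vP lcK HD hmu' hmu0.
exists c => // phi aphi h hu.
pose f (X : borel 'M[K]_(n + n)) : R :=
  ext_phi phi (h, (ulsubmx (X : 'M[K]_(n + n)), drsubmx (X : 'M[K]_(n + n)))).
have mf : measurable_fun setT f.
  apply: (measurableT_comp (measurable_ext_phi2 vP lcK aphi h)).
  apply: measurable_fun_pair; apply: continuous_borel_fun.
    exact: ulsubmx_continuous.
  exact: drsubmx_continuous.
transitivity (Rintegral muU (@Urad K m r) (fun u => f (pU u))).
  apply: eq_Rint => u /UradP[N1 N2].
  by rewrite /f /pU /dbl block_mxKul block_mxKdr ext_phiE.
rewrite (Rintegral_push (nu := mu') mUr (continuous_borel_fun pU_continuous)) //.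
rewrite (Rintegral_measure_scale c0 cE mf); congr (_ * _).
rewrite -(Rintegral_push (mu := (nu \x nu)%E) (D := setT) measurableT (measurable_dbl vP lcK (n := n))) //.
  apply: eq_Rint => -[a b] _.
  by rewrite /f /dbl block_mxKul block_mxKdr.
by move=> A mA; rewrite mu0E setIT.
Qed.

Lemma haar_GL (muGL : {measure set (borel 'M[K]_m) -> \bar R}) :
  haar_measure (fun x y : 'M[K]_m => x *m y) (@GLset K m) muGL ->
  exists2 ga : {measure set (borel 'M[K]_m) -> \bar R},
    haar_on (@GLset K m) ga & forall A, ga A = muGL (A `&` @GLset K m).
Proof.
move=> hGL; have HG := @GL_closed_subgroup K m.
have mGL : measurable (@GLset K m : set (borel 'M[K]_m)).
  by apply: open_borel; exact: (GL_open vP).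
apply: (haar_push vP lcK HG hGL mGL (p := id) (s := id)) => //.
- by move=> x; exact: cvg_id.
- by move=> y _; exact: cvg_id.
- by move=> x y xu yu; rewrite /GLset /= unitmx_mul; apply/andP.
Qed.

Lemma orbital_fiber_S (muU : {measure set (borel 'M[K * K]_n) -> \bar R})
    (muGL ga : {measure set (borel 'M[K]_m) -> \bar R}) :
  haar_measure (fun x y : 'M[K * K]_n => x *m y) (@Urad K m r) muU ->
  (forall A, ga A = muGL (A `&` @GLset K m)) ->
  exists2 c : R, 0 < c & forall phi, admissible phi ->
    Rintegral muGL (@GLset K m) (fun h =>
      Rintegral muU (@Urad K m r) (fun u => phi h (map_mx fst u, map_mx snd u))) =
    c * Rintegral ga setT (fiber_int phi nu).
Proof.
move=> hU gaE; have [c c0 cE] := Urad_integral_fiber hU; exists c => // phi aphi.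
have mGL : measurable (@GLset K m : set (borel 'M[K]_m)).
  by apply: open_borel; exact: (GL_open vP).
have mH := measurable_fiber_int vP lcK aphi nu.
rewrite -(Rintegral_scale ga c0 mH).
rewrite -(Rintegral_push (p := id : borel 'M[K]_m -> borel 'M[K]_m) (mu := muGL) mGL) //.
  by apply: eq_Rint => h hu; exact: cE.
exact: measurable_funM.
Qed.
End S_side.


Lemma dual_mxM k (J a b : 'M[K]_k) : J \in unitmx -> a \in unitmx -> b \in unitmx ->
  dual_mx J (a *m b) = dual_mx J a *m dual_mx J b.
Proof.
move=> Ju au bu; rewrite /dual_mx -trmx_mul; congr trmx.
by rewrite invmxM // !mulmxA mulmxKV.
Qed.

Lemma dual_mx_eq k (J a b : 'M[K]_k) : J \in unitmx -> a \in unitmx ->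
  b = dual_mx J a <-> b^T *m J *m a = J.
Proof.
move=> Ju au; rewrite /dual_mx; split=> [->|E].
  by rewrite trmxK mulmxKV // mulmxKV.
by apply: trmx_inj; rewrite trmxK -{1}E mulmxK // mulmxK.
Qed.

(** Gs is the graph of the dual map over G, so the first component is an
    isomorphism of topological groups from Gs to G. *)
Lemma haar_dual k (G : set 'M[K]_k) (J : 'M[K]_k) (Gs : set 'M[K * K]_k)
    (mu : {measure set (borel 'M[K * K]_k) -> \bar R}) :
  closed_subgroup G -> J \in unitmx ->
  (forall x, Gs x <-> G (map_mx fst x) /\ map_mx snd x = dual_mx J (map_mx fst x)) ->
  haar_measure (fun x y : 'M[K * K]_k => x *m y) Gs mu ->
  measurable (Gs : set (borel 'M[K * K]_k)) /\
  exists2 nu : {measure set (borel 'M[K]_k) -> \bar R}, haar_on G nu &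
    forall A, nu A = mu ((fun x : 'M[K * K]_k => map_mx fst x) @^-1` A `&` Gs).
Proof.
move=> HG Ju GsP hmu; have mG := measurable_subgroup vP HG; have Gu := subgroup_unit HG.
have [_ _ GM _] := HG.
have fc := @fst_continuous K k k; have sc := @snd_continuous K k k.
have mGs : measurable (Gs : set (borel 'M[K * K]_k)).
  have -> : Gs = (fun x : 'M[K * K]_k => map_mx fst x) @^-1` G `&`
      (fun x => (map_mx snd x)^T *m J *m map_mx fst x) @^-1` [set J].
    apply/seteqP; split=> x.
      by move=> /GsP[Gx xE]; split=> //=; apply/dual_mx_eq => //; exact: Gu.
    by move=> [/= Gx xE]; apply/GsP; split=> //; apply/dual_mx_eq => //; exact: Gu.
  apply: measurableI.
    by rewrite -[X in measurable X]setTI; exact: (continuous_borel_fun fc).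
  apply: closed_borel; apply: closed_comp => [x _|].
    apply: (cvg_mulmx vP (nbhs_filter x)); last exact: fc.
    apply: (cvg_mulmx vP (nbhs_filter x)); last exact: cvg_cst.
    exact: (cvg_comp _ _ (sc x) (@trmx_continuous K k k _)).
  apply: accessible_closed_set1; apply: hausdorff_accessible.
  exact/hausdorff_mx/(hausdorff_abs vP).
split=> //.
apply: (haar_push vP lcK HG hmu mGs fc (s := fun a => pairmx a (dual_mx J a))).
- move=> y Gy; apply: (cvg_pairmx (F := nbhs y)); first exact: cvg_id.
  have ic : (fun a : 'M[K]_k => J *m invmx a *m invmx J) @ y --> J *m invmx y *m invmx J.
    apply: (cvg_mulmx vP (nbhs_filter y)); last exact: cvg_cst.
    apply: (cvg_mulmx vP (nbhs_filter y)); first exact: cvg_cst.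
    by apply: (cvg_invmx vP (nbhs_filter y)); [exact: Gu|exact: cvg_id].
  exact: (cvg_comp _ _ ic (@trmx_continuous K k k _)).
- by move=> x /GsP[].
- by move=> y Gy; apply/GsP; rewrite fst_pairmx snd_pairmx.
- by move=> x /GsP[Gx xE]; rewrite -xE pairmxK.
- by move=> y Gy; rewrite fst_pairmx.
- move=> x y /GsP[Gx xE] /GsP[Gy yE]; apply/GsP; rewrite fst_mulmx snd_mulmx; split.
    exact: GM.
  by rewrite dual_mxM ?xE ?yE //; exact: Gu.
- by move=> x y _ _; rewrite fst_mulmx.
Qed.

Section U_side.
Variables (beta0 : K) (beta : 'M[K * K]_m).
Hypotheses (b00 : beta0 != 0) (Hb : Her beta).

Lemma half_int_conj (phi : 'M[K]_m -> 'M[K]_n * 'M[K]_n -> R)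
    (nu : {sigma_finite_measure set (borel 'M[K]_n) -> \bar R}) (g : 'M[K]_m) h a :
  admissible phi -> haar_on N nu -> g \in unitmx ->
  Rintegral nu setT (fun b : borel 'M[K]_n => ext_phi phi (h, (a, conjL g b))) =
  half_int phi nu h a.
Proof.
move=> aphi hnu gu; have mp : measurable_fun setT (conjL g : borel 'M[K]_n -> borel 'M[K]_n).
  by apply: continuous_borel_fun; exact: (conjL_continuous vP).
apply: (Rintegral_invariant (p := conjL g : borel 'M[K]_n -> borel 'M[K]_n)
  (f := fun b => ext_phi phi (h, (a, b)))) => //.
  by move=> A mA; rewrite (conjL_invariant vP lcK hnu gu mA).
apply: (measurableT_comp (measurable_ext_phi2 vP lcK aphi h)).
exact: measurable_pair1.
Qed.

(** The conjugation by g0 accounts for the passage between matching elements: it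
    preserves nu, and translation by g0 preserves ga. *)
Lemma orbital_fiber_U (muUm : {measure set (borel 'M[K * K]_m) -> \bar R})
    (muU' : {measure set (borel 'M[K * K]_n) -> \bar R})
    (ga : {measure set (borel 'M[K]_m) -> \bar R}) :
  haar_measure (fun x y : 'M[K * K]_m => x *m y) (unitary_group beta) muUm ->
  haar_measure (fun x y : 'M[K * K]_n => x *m y) (@Uprime K m r beta0 beta) muU' ->
  haar_on (@GLset K m) ga ->
  exists2 nu : {sigma_finite_measure set (borel 'M[K]_n) -> \bar R}, haar_on N nu &
  exists2 c2 : R, 0 < c2 &
    forall phi phi' (c : R) (g0 : 'M[K]_m), admissible phi -> 0 < c -> g0 \in unitmx ->
    (forall g a b, g \in unitmx -> N a -> N b ->
      phi' g (a, b) = c * phi (g0 *m g) (conjL g0 a, conjL g0 b)) ->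
    Rintegral muUm (unitary_group beta) (fun g =>
      Rintegral muU' (@Uprime K m r beta0 beta) (fun u1 =>
        Rintegral muU' (@Uprime K m r beta0 beta) (fun u2 =>
          phi' (map_mx fst g) (map_mx fst u1, map_mx fst u2)))) =
    c * (c2 * Rintegral ga setT (fiber_int phi nu)).
Proof.
move=> hUm hU' hga; have [bu bH] := Hb.
have HN := Nset_closed_subgroup vP m r; have HG := @GL_closed_subgroup K m.
have Ju : form r (map_mx fst beta) beta0 \in unitmx.
  by apply: form_unit => //; exact: Her_fst_unit.
have [mUm [ga2 hga2 ga2E]] := haar_dual HG (fst_unit bu)
  (fun x => unitary_groupP x bu bH) hUm.
have [mU' [nu0 hnu0 nu0E]] := haar_dual HN Ju (fun x => UprimeP b00 Hb x) hU'.
have [nu nuE] := sigma_finite_measureP (haar_sigma_finite vP lcK HN hnu0).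
have hnu : haar_on N nu by exact: haar_on_eq nuE hnu0.
have [c2 c20 c2E] := haar_on_unique vP lcK HG hga2 hga.
exists nu => //; exists c2 => // phi phi' c g0 aphi c0 g0u phiE.
have mfst k : measurable_fun setT
    ((fun x : 'M[K * K]_k => map_mx fst x) : borel 'M[K * K]_k -> borel 'M[K]_k).
  by apply: continuous_borel_fun; exact: fst_continuous.
have mhalf := measurable_half_int vP lcK aphi hnu.
have mH := measurable_fiber_int vP lcK aphi nu.
have mcj : measurable_fun setT (conjL g0 : borel 'M[K]_n -> borel 'M[K]_n).
  by apply: continuous_borel_fun; exact: (conjL_continuous vP).
have pushU (k : borel 'M[K]_n -> R) : measurable_fun setT k ->
    Rintegral muU' (@Uprime K m r beta0 beta) (fun u => k (map_mx fst u)) =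
    Rintegral nu setT k.
  move=> mk; apply: (Rintegral_push (p := fun x : borel 'M[K * K]_n => map_mx fst (x : 'M[K * K]_n) : borel 'M[K]_n)) => //.
  by move=> A mA; rewrite nuE nu0E.
transitivity (Rintegral muUm (unitary_group beta) (fun g =>
    c * fiber_int phi nu (g0 *m map_mx fst g))).
  apply: eq_Rint => g /(unitary_groupP _ bu bH)[gu _].
  have hu : g0 *m map_mx fst g \in unitmx by rewrite unitmx_mul g0u.
  set h := g0 *m map_mx fst g in hu *.
  transitivity (Rintegral muU' (@Uprime K m r beta0 beta) (fun u1 =>
      c * half_int phi nu h (conjL g0 (map_mx fst u1)))).
    apply: eq_Rint => u1 /UprimeP-/(_ b00 Hb)[Nu1 _].
    have mk : measurable_fun setT (fun b : borel 'M[K]_n =>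
        ext_phi phi (h, (conjL g0 (map_mx fst u1), conjL g0 b))).
      apply: (measurableT_comp (measurable_ext_phi2 vP lcK aphi h)).
      apply: measurable_fun_pair => //.
    transitivity (Rintegral muU' (@Uprime K m r beta0 beta) (fun u2 =>
        c * ext_phi phi (h, (conjL g0 (map_mx fst u1), conjL g0 (map_mx fst u2))))).
      apply: eq_Rint => u2 /UprimeP-/(_ b00 Hb)[Nu2 _].
      by rewrite phiE // ext_phiE //; exact: Nset_levi.
    rewrite (pushU (fun b => c * ext_phi phi (h, (conjL g0 (map_mx fst u1), conjL g0 b)))); last first.
      exact: measurable_funM.
    by rewrite Rintegral_scale // half_int_conj.
  rewrite (pushU (fun a => c * half_int phi nu h (conjL g0 a))); last first.
    by apply: measurable_funM => //; exact: (measurableT_comp (mhalf h)).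
  rewrite Rintegral_scale //; last exact: (measurableT_comp (mhalf h)).
  rewrite (Rintegral_invariant mcj) //; first by rewrite -(fiber_intE vP lcK aphi hnu).
  by move=> A mA; rewrite (conjL_invariant vP lcK hnu g0u mA).
have mmul : measurable_fun setT ((fun x : 'M[K]_m => g0 *m x) : borel 'M[K]_m -> borel 'M[K]_m).
  by apply: continuous_borel_fun; exact: (mulmxl_continuous vP).
have mk : measurable_fun setT (fun x : borel 'M[K]_m => c * fiber_int phi nu (g0 *m (x : 'M[K]_m))).
  by apply: measurable_funM => //; exact: (measurableT_comp mH mmul).
rewrite (Rintegral_push mUm (mfst m) (fun A _ => ga2E A) mk).
rewrite Rintegral_scale //; last exact: (measurableT_comp mH mmul).
rewrite (Rintegral_measure_scale c20 c2E); last exact: (measurableT_comp mH mmul).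
congr (_ * (_ * _)); apply: (Rintegral_invariant mmul) => //.
by move=> A mA; have [_ _ iga _] := hga; exact: iga.
Qed.
End U_side.
End TwoSides.

(** * The common integrand *)

Section Integrand.
Variables (R : realType) (K : topFieldType) (v : K -> R).
Hypotheses (vP : topological_abs v) (lcK : locally_compact [set: K]).
Variables (m r : nat) (beta0 j1 : K) (psi' : K -> R[i]).
Hypothesis hpsi : additive_character psi'.
Local Notation n := (ndim m r).
Local Notation N := (@Nset K m r).

Definition orbit_arg (y : 'M[K]_n) (h : 'M[K]_m) (p : 'M[K]_n * 'M[K]_n) : 'M[K]_n :=
  levi r (invmx h) *m invmx p.1 *m y *m p.2 *m levi r h.

Definition orbit_char (p : 'M[K]_n * 'M[K]_n) : R[i] :=
  psi' (j1 * (lam beta0 p.2 - lam beta0 p.1)).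

Definition orbit_fun (Ft : 'M[K]_n -> R[i]) (y : 'M[K]_n) h p : R[i] :=
  Ft (orbit_arg y h p) * orbit_char p.

Lemma orbit_arg_unit y h p : y \in unitmx -> h \in unitmx -> p.1 \in unitmx ->
  p.2 \in unitmx -> orbit_arg y h p \in unitmx.
Proof.
move=> yu hu au bu; have hVu : invmx h \in unitmx by rewrite unitmx_inv.
by rewrite /orbit_arg !unitmx_mul unitmx_inv !levi_unit // au yu bu.
Qed.

(** A change of the base point by the Levi subgroup is absorbed by h, a and b. *)
Lemma orbit_arg_conj y g0 h a b : g0 \in unitmx -> h \in unitmx -> a \in unitmx ->
  orbit_arg (levi r (invmx g0) *m y *m levi r g0) h (a, b) =
  orbit_arg y (g0 *m h) (conjL g0 a, conjL g0 b).
Proof.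
move=> gu hu au; rewrite /orbit_arg /conjL /=.
have E1 : invmx (levi r g0 *m a *m levi r (invmx g0)) =
    levi r g0 *m invmx a *m levi r (invmx g0) by exact: leviJV.
have E2 : levi r (invmx (g0 *m h)) = levi r (invmx h) *m levi r (invmx g0).
  by rewrite -leviM invmxM.
have eu := levi_unit r gu.
rewrite E1 E2 leviM -(leviV r gu) !mulmxA mulmxKV //; congr (_ *m _).
by rewrite mulmxKV.
Qed.

Lemma orbit_char_conj g0 a b : orbit_char (conjL g0 a, conjL g0 b) = orbit_char (a, b).
Proof. by rewrite /orbit_char /= /conjL !lam_levi. Qed.

Lemma levi_continuous : continuous (@levi K m r).
Proof.
move=> h; have FF := nbhs_filter h.
by do 2!(apply: (cvg_block_mx (FF := FF)); try exact: cvg_cst);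
  apply: (cvg_block_mx (FF := FF)); try exact: cvg_cst; exact: cvg_id.
Qed.

Lemma lam_continuous : continuous (fun u : 'M[K]_n => lam beta0 u).
Proof.
move=> u; have FF := nbhs_filter u.
have s2 (P : 'I_r -> 'I_r -> bool) (f g : 'I_r -> 'I_r -> 'I_n) :
    (fun u : 'M[K]_n => \sum_i \sum_(j | P i j) u (f i j) (g i j)) @ u -->
    \sum_i \sum_(j | P i j) u (f i j) (g i j).
  by apply: (cvg_sumK vP FF) => i; apply: (cvg_sumK vP FF) => j; exact: entry_continuous.
have s1 (P : pred 'I_r) (f g : 'I_r -> 'I_n) :
    (fun u : 'M[K]_n => \sum_(i | P i) u (f i) (g i)) @ u --> \sum_(i | P i) u (f i) (g i).
  by apply: (cvg_sumK vP FF) => i; exact: entry_continuous.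
apply: (cvg_addK vP FF); last exact: s2.
apply: (cvg_addK vP FF); first by apply: (cvg_addK vP FF); [exact: s2|exact: s1].
by apply: (cvg_mulK vP FF); [exact: cvg_cst|exact: s1].
Qed.

Lemma cvg_Rmul (U : Type) (F : set_system U) (FF : Filter F) (f g : U -> R) (a b : R) :
  f @ F --> a -> g @ F --> b -> (fun x => f x * g x) @ F --> a * b.
Proof. by move=> fa gb; exact: (cvgM fa gb). Qed.

Local Notation Q := ('M[K]_m * ('M[K]_n * 'M[K]_n))%type.

Section Fixed.
Variables (Ft : 'M[K]_n -> R[i]) (y z2 : 'M[K]_n) (C : set 'M[K]_n).
Hypothesis Ftc : forall x, x \in unitmx ->
  {for x, continuous (fun x => complex.Re (Ft x))} /\
  {for x, continuous (fun x => complex.Im (Ft x))}.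
Hypotheses (cC : compact C) (CGL : C `<=` [set x | x \in unitmx]).
Hypothesis Ftsupp : forall x, x \in unitmx -> Ft x != 0 -> C x.
Hypotheses (yu : y \in unitmx) (z2E : z2 = invmx y).
Hypotheses (ay : antidiag y) (az : antidiag z2).

Lemma orbit_fun_continuous h a b : h \in unitmx -> a \in unitmx -> b \in unitmx ->
  {for (h, (a, b)), continuous (fun q : Q =>
      complex.Re (orbit_fun Ft y q.1 q.2))} /\
  {for (h, (a, b)), continuous (fun q : Q =>
      complex.Im (orbit_fun Ft y q.1 q.2))}.
Proof.
move=> hu au bu; set q0 : Q := (h, (a, b)).
have FF := nbhs_filter q0.
have c1 : (fun q : Q => q.1) @ q0 --> h by exact: cvg_fst.
have c2 : (fun q : Q => q.2.1) @ q0 --> a.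
  exact: (cvg_comp _ _ (@cvg_snd _ _ (nbhs h) (nbhs (a, b)) _) (@cvg_fst _ _ (nbhs a) (nbhs b) _)).
have c3 : (fun q : Q => q.2.2) @ q0 --> b.
  exact: (cvg_comp _ _ (@cvg_snd _ _ (nbhs h) (nbhs (a, b)) _) (@cvg_snd _ _ (nbhs a) (nbhs b) _)).
have argc : (fun q : Q => orbit_arg y q.1 q.2) @ q0 -->
    orbit_arg y h (a, b).
  apply: (cvg_mulmx vP FF); last exact: (cvg_comp _ _ c1 (@levi_continuous h)).
  apply: (cvg_mulmx vP FF); last exact: c3.
  apply: (cvg_mulmx vP FF); last exact: cvg_cst.
  apply: (cvg_mulmx vP FF); last exact: (cvg_invmx vP FF au c2).
  exact: (cvg_comp _ _ (cvg_invmx vP FF hu c1) (@levi_continuous _)).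
have charc : (fun q : Q =>
    j1 * (lam beta0 q.2.2 - lam beta0 q.2.1)) @ q0 --> j1 * (lam beta0 b - lam beta0 a).
  apply: (cvg_mulK vP FF); first exact: cvg_cst.
  apply: (cvg_addK vP FF); first exact: (cvg_comp _ _ c3 (@lam_continuous _)).
  apply: (cvg_oppK vP FF); exact: (cvg_comp _ _ c2 (@lam_continuous _)).
have [_ _ pR pI] := hpsi.
have xu : orbit_arg y h (a, b) \in unitmx by exact: orbit_arg_unit.
have [FR FI] := Ftc xu.
have r1 := cvg_comp _ _ argc FR; have i1 := cvg_comp _ _ argc FI.
have r2 := cvg_comp _ _ charc (pR _); have i2 := cvg_comp _ _ charc (pI _).
have ReE (x z : R[i]) : complex.Re (x * z) =
    complex.Re x * complex.Re z - complex.Im x * complex.Im z by case: x => ? ?; case: z.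
have ImE (x z : R[i]) : complex.Im (x * z) =
    complex.Re x * complex.Im z + complex.Im x * complex.Re z by case: x => ? ?; case: z.
split.
  have H := cvgB (cvg_Rmul FF r1 r2) (cvg_Rmul FF i1 i2).
  have -> : (fun q : Q => complex.Re (orbit_fun Ft y q.1 q.2)) =
    (fun q => complex.Re (Ft (orbit_arg y q.1 q.2)) * complex.Re (orbit_char q.2) -
              complex.Im (Ft (orbit_arg y q.1 q.2)) * complex.Im (orbit_char q.2)).
    by apply/funext => q; rewrite -ReE.
  exact: H.
have H := cvgD (cvg_Rmul FF r1 i2) (cvg_Rmul FF i1 r2).
have -> : (fun q : Q => complex.Im (orbit_fun Ft y q.1 q.2)) =
  (fun q => complex.Re (Ft (orbit_arg y q.1 q.2)) * complex.Im (orbit_char q.2) +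
            complex.Im (Ft (orbit_arg y q.1 q.2)) * complex.Re (orbit_char q.2)).
  by apply/funext => q; rewrite -ImE.
exact: H.
Qed.

Lemma Nset_unitriangular (b : 'M[K]_n) : N b -> unitriangular b.
Proof. by move=> Nb i j ij; apply: Nb; exact: block_homo. Qed.

(** As y is block antidiagonal, y^-1 a^-1 y is lower unipotent.  So
    y^-1 a^-1 y b is a unipotent LU product, from which b, and then a, can be
    recovered continuously; it stays in a compact set where Ft does not vanish. *)
Lemma orbit_fun_support h : h \in unitmx -> exists Q1 Q2 : set 'M[K]_n,
  [/\ compact Q1, compact Q2, Q1 `<=` N, Q2 `<=` N &
      forall a b, N a -> N b -> orbit_fun Ft y h (a, b) != 0 -> Q1 a /\ Q2 b].
Proof.
move=> hu; have [P Pc PE] := unipotent_lu vP n.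
have eu := levi_unit r hu; set e := levi r h in eu.
have zy : z2 *m y = 1%:M by rewrite z2E mulVmx.
have yz : y *m z2 = 1%:M by rewrite z2E mulmxV.
have zu : z2 \in unitmx by rewrite z2E unitmx_inv.
(* T recovers the LU product l b from the argument of Ft; A below recovers a *)
pose T (x : 'M[K]_n) := z2 *m e *m x *m invmx e.
have Tc : continuous T.
  move=> x; apply: (cvg_mulmx vP (nbhs_filter x)); last exact: cvg_cst.
  by apply: (cvg_mulmx vP (nbhs_filter x)); [exact: cvg_cst|exact: cvg_id].
have PTc : continuous (fun x => P (T x)).
  by move=> x; exact: (cvg_comp _ _ (Tc x) (Pc _)).
pose A (x : 'M[K]_n) := y *m P (T x) *m invmx (T x) *m z2.
have Tu x : x \in unitmx -> T x \in unitmx.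
  by move=> xu; rewrite !unitmx_mul zu eu xu unitmx_inv.
have Ac x : C x -> {for x, continuous A}.
  move=> /CGL xu; apply: (cvg_mulmx vP (nbhs_filter x)); last exact: cvg_cst.
  apply: (cvg_mulmx vP (nbhs_filter x)).
    apply: (cvg_mulmx vP (nbhs_filter x)); first exact: cvg_cst.
    exact: PTc.
  by apply: (cvg_invmx vP (nbhs_filter x)); [exact: Tu|exact: Tc].
exists (A @` C `&` N), ((fun x => P (T x)) @` C `&` N); split.
- apply: compact_closedI; last exact: (closed_Nset vP).
  apply: continuous_compact => //; apply: continuous_in_subspaceT => x.
  by rewrite inE; exact: Ac.
- apply: compact_closedI; last exact: (closed_Nset vP).
  by apply: continuous_compact => //; apply: continuous_subspaceT.
- by move=> x [].
- by move=> x [].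
move=> a b Na Nb nz; have au := Nset_unit Na; have bu := Nset_unit Nb.
have xu : orbit_arg y h (a, b) \in unitmx by exact: orbit_arg_unit.
have Cx : C (orbit_arg y h (a, b)).
  apply: Ftsupp => //; apply: contraNneq nz => F0.
  by rewrite /orbit_fun F0 mul0r.
set x := orbit_arg y h (a, b) in xu Cx.
pose l := z2 *m invmx a *m y.
have TE : T x = l *m b.
  by rewrite /T /x /orbit_arg /l /= -leviV // -/e !mulmxA mulmxK // mulmxK.
have PTE : P (T x) = b.
  rewrite TE; apply: PE; last exact: Nset_unitriangular.
  by apply: Nset_unitriangular; apply: antidiag_conj => //; exact: NsetV.
split; last by split=> //; exists x.
split=> //; exists x => //; rewrite /A PTE TE.
have lu : l \in unitmx by rewrite !unitmx_mul zu unitmx_inv au yu.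
have -> : invmx (l *m b) = invmx b *m (z2 *m a *m y).
  apply: mulmx1_inv; rewrite mulmxA mulmxK // /l !mulmxA.
  by rewrite -(mulmxA (z2 *m invmx a) y) yz mulmx1 mulmxKV.
by rewrite !mulmxA mulmxK // yz mul1mx -mulmxA yz mulmx1.
Qed.

Lemma orbit_fun_admissible :
  admissible (fun h p => complex.Re (orbit_fun Ft y h p)) /\
  admissible (fun h p => complex.Im (orbit_fun Ft y h p)).
Proof.
have supp h (p : R[i] -> R) : p 0 = 0 -> h \in unitmx -> exists Q1 Q2 : set 'M[K]_n,
    [/\ compact Q1, compact Q2, Q1 `<=` N, Q2 `<=` N & forall a b, N a -> N b ->
        p (orbit_fun Ft y h (a, b)) != 0 -> Q1 a /\ Q2 b].
  move=> p0 hu; have [Q1 [Q2 [? ? ? ? H]]] := orbit_fun_support hu.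
  exists Q1, Q2; split=> // a b Na Nb nz.
  by apply: H => //; apply: contraNneq nz => ->; rewrite p0.
split; (split=> [h a b hu au bu|h hu]; last exact: supp);
  by have [] := orbit_fun_continuous hu au bu.
Qed.
End Fixed.
End Integrand.

(** * Unfolding the orbital integrals *)

Section Cint.
Context d (T : measurableType d) (R : realType) (mu : {measure set T -> \bar R}).
Variables (D : set T) (f : T -> R[i]).

Lemma Re_Cintegral : complex.Re (Cintegral mu D f) = Rintegral mu D (fun x => complex.Re (f x)).
Proof. by []. Qed.

Lemma Im_Cintegral : complex.Im (Cintegral mu D f) = Rintegral mu D (fun x => complex.Im (f x)).
Proof. by []. Qed.

Lemma CintegralP A B : Rintegral mu D (fun x => complex.Re (f x)) = A ->
  Rintegral mu D (fun x => complex.Im (f x)) = B -> Cintegral mu D f = A +i* B.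
Proof. by move=> <- <-. Qed.
End Cint.

Section Unfold.
Variables (R : realType) (K : topFieldType) (v : K -> R).
Hypotheses (vP : topological_abs v) (lcK : locally_compact [set: K]).
Variables (m r : nat) (beta0 : K) (jm : K * K) (psi' : K -> R[i]).
Hypothesis b00 : beta0 != 0.
Local Notation n := (ndim m r).
Local Notation ofun := (orbit_fun beta0 jm.1 psi').

Lemma fst_embGL (g : 'M[K * K]_m) : map_mx fst (embGL r g) = levi r (map_mx fst g).
Proof. by rewrite /embGL /levi !map_block_mx !map_mx0 !map_mx1. Qed.

Lemma snd_embGL (g : 'M[K * K]_m) : map_mx snd (embGL r g) = levi r (map_mx snd g).
Proof. by rewrite /embGL /levi !map_block_mx !map_mx0 !map_mx1. Qed.

Lemma embGL_unit (g : 'M[K * K]_m) : g \in unitmx -> embGL r g \in unitmx.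
Proof. exact: levi_unit. Qed.

Lemma psiE (x : K * K) : psi psi' jm x = psi' (jm.1 * (x.1 - x.2)).
Proof. by rewrite /psi; case: x. Qed.

(** psi takes the difference of the two components, and lam changes sign under
    inversion. *)
Lemma psiU_E (u : 'M[K * K]_n) : Urad u ->
  psiU beta0 psi' jm (invmx u) = orbit_char beta0 jm.1 psi' (map_mx fst u, map_mx snd u).
Proof.
move=> uU; have uu : u \in unitmx := Nset_unit uU; have /UradP[N1 N2] := uU.
rewrite (_ : psiU beta0 psi' jm (invmx u) = psi psi' jm (lam (diagk beta0) (invmx u))) //.
have e1 : (lam (diagk beta0) (invmx u)).1 = - lam beta0 (map_mx fst u).
  by rewrite -lamV // -fst_invmx // -(lam_map fst (diagk beta0)).
have e2 : (lam (diagk beta0) (invmx u)).2 = - lam beta0 (map_mx snd u).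
  by rewrite -lamV // -snd_invmx // -(lam_map snd (diagk beta0)).
by rewrite psiE e1 e2 /orbit_char /= opprK addrC.
Qed.

(** lamv of the second component of w is expressed through the first one by the
    equations of U'. *)
Lemma psiU'_E (beta : 'M[K * K]_m) (w : 'M[K * K]_n) : Her beta ->
  Uprime beta0 beta w -> psiU' psi' jm w = psi' (jm.1 * lam beta0 (map_mx fst w)).
Proof.
move=> Hb wU; rewrite -(Uprime_lam b00 Hb wU).
rewrite (_ : psiU' psi' jm w = psi psi' jm (lamv w)) // psiE.
have e1 : (lamv w).1 = lamv (map_mx fst w) by rewrite -(lamv_map fst).
have e2 : (lamv w).2 = lamv (map_mx snd w) by rewrite -(lamv_map snd).
by rewrite e1 e2.
Qed.

Section S.
Variables (F : 'M[K * K]_n -> R[i]) (z : 'M[K * K]_n).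
Hypothesis Sz : Sset z.
Let y := map_mx fst z.

Lemma S_integrand (g : 'M[K]_m) (u : 'M[K * K]_n) : g \in unitmx -> Urad u ->
  F (invmx (embGL r (map_mx (@diagk K) g)) *m invmx u *m z *m taumx u
       *m embGL r (map_mx (@diagk K) g)) * psiU beta0 psi' jm (invmx u) *
    Defs.eta R (\det (map_mx (@diagk K) g)) =
  ofun (on_GL F) y g (map_mx fst u, map_mx snd u).
Proof.
move=> gu uU; have uu : u \in unitmx := Nset_unit uU; have /UradP[N1 N2] := uU.
have /SsetP[z1u z2E] := Sz.
have u1u := Nset_unit N1; have u2u := Nset_unit N2.
set g' := map_mx (@diagk K) g.
have g1 : map_mx fst g' = g by apply/matrixP => i j; rewrite !mxE.
have g2 : map_mx snd g' = g by apply/matrixP => i j; rewrite !mxE.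
have g'u : g' \in unitmx by rewrite unitmx_pair g1 g2 gu.
have eu := embGL_unit g'u.
rewrite /Defs.eta mulr1 psiU_E // /orbit_fun; congr (_ * _).
set X := _ *m embGL r g'.
have X1 : map_mx fst X = orbit_arg y g (map_mx fst u, map_mx snd u).
  rewrite /X !fst_mulmx fst_invmx // fst_embGL g1 fst_invmx // fst_taumx.
  by rewrite /orbit_arg leviV.
have X2 : map_mx snd X = invmx (levi r g) *m invmx (map_mx snd u) *m invmx y *m map_mx fst u *m levi r g.
  by rewrite /X !snd_mulmx snd_invmx // snd_embGL g2 snd_invmx // snd_taumx z2E.
have lu := levi_unit r gu.
have SX : Sset X.
  have X1u : map_mx fst X \in unitmx by rewrite X1; exact: orbit_arg_unit.
  apply/SsetP; split=> //; rewrite X2.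
  apply/esym/mulmx1_inv; rewrite X1 /orbit_arg /= -leviV // !mulmxA mulmxK // mulmxK //.
  by rewrite mulmxK // mulmxKV // mulVmx.
by rewrite (on_GLE F SX) X1.
Qed.

Lemma orbS_E (muGL : {measure set (borel 'M[K]_m) -> \bar R})
    (muU : {measure set (borel 'M[K * K]_n) -> \bar R}) :
  orbS beta0 psi' jm muGL muU F z =
  Rintegral muGL (@GLset K m) (fun h => Rintegral muU (@Urad K m r) (fun u =>
    complex.Re (ofun (on_GL F) y h (map_mx fst u, map_mx snd u)))) +i*
  Rintegral muGL (@GLset K m) (fun h => Rintegral muU (@Urad K m r) (fun u =>
    complex.Im (ofun (on_GL F) y h (map_mx fst u, map_mx snd u)))).
Proof.
rewrite /orbS; apply: CintegralP; apply: eq_Rint => g gu.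
  by rewrite Re_Cintegral; apply: eq_Rint => u uU; rewrite S_integrand.
by rewrite Im_Cintegral; apply: eq_Rint => u uU; rewrite S_integrand.
Qed.
End S.

Lemma levi_form (h g c : 'M[K]_m) (c0 : K) :
  levi r h *m form r c c0 *m levi r g = form r (h *m c *m g) c0.
Proof.
rewrite /levi /form !(mulmx_block, mul_row_block, mul_block_col,
  mulmx0, mul0mx, addr0, add0r, mul1mx, mulmx1).
by [].
Qed.

Section U.
Variable beta : 'M[K * K]_m.
Hypothesis Hb : Her beta.
Let b := map_mx fst beta.
Let J1 := form r b beta0.

Definition U_to_S : 'M[K * K]_n -> 'M[K * K]_n := swap_form (invmx J1) J1.
Definition S_to_U : 'M[K * K]_n -> 'M[K * K]_n := swap_form (invmx J1)^T J1^T.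

Let J1u : J1 \in unitmx.
Proof. by apply: form_unit => //; exact: Her_fst_unit. Qed.

Lemma U_to_S_Sset x : Uset beta0 beta x -> Sset (U_to_S x).
Proof.
move=> /(UsetP b00 Hb)[xu x2]; apply/SsetP; rewrite fst_pairmx snd_pairmx; split=> //.
by rewrite x2 /dual_mx trmxK !mulmxA mulVmx // mul1mx mulmxKV.
Qed.

Lemma S_to_U_Uset s : Sset s -> Uset beta0 beta (S_to_U s).
Proof.
move=> /SsetP[su s2]; apply/(UsetP b00 Hb); rewrite fst_pairmx snd_pairmx; split=> //.
by rewrite s2 /dual_mx !trmx_mul mulmxA.
Qed.

Lemma U_to_SK x : S_to_U (U_to_S x) = x.
Proof.
rewrite /S_to_U /U_to_S /swap_form; apply: mxpairP; rewrite ?fst_pairmx //.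
rewrite !snd_pairmx -trmx_mul -[RHS]trmxK -trmx_mul; congr trmx.
by rewrite !mulmxA mulmxV // mul1mx mulmxK.
Qed.

Lemma S_to_UK x : U_to_S (S_to_U x) = x.
Proof.
rewrite /S_to_U /U_to_S /swap_form; apply: mxpairP; rewrite ?fst_pairmx //.
rewrite !snd_pairmx !trmx_mul !trmxK !mulmxA.
by rewrite mulVmx // mul1mx mulmxKV.
Qed.

Lemma UsetM (x1 x2 : 'M[K * K]_n) : Uset beta0 beta x1 -> Uset beta0 beta x2 -> Uset beta0 beta (x1 *m x2).
Proof.
move=> /(UsetP b00 Hb)[u1 e1] /(UsetP b00 Hb)[u2 e2]; apply/(UsetP b00 Hb).
rewrite fst_mulmx snd_mulmx unitmx_mul u1 u2; split=> //.
by rewrite dual_mxM // e1 e2.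
Qed.

Lemma UsetV (x : 'M[K * K]_n) : Uset beta0 beta x -> Uset beta0 beta (invmx x).
Proof.
move=> Ux; have [xu _] := Ux; move: Ux => /(UsetP b00 Hb)[u1 e1]; apply/(UsetP b00 Hb).
rewrite fst_invmx // snd_invmx // unitmx_inv; split=> //.
have d1 : dual_mx J1 1%:M = 1%:M.
  by rewrite /dual_mx invmx1 mulmx1 mulmxV // trmx1.
have u1V : invmx (map_mx fst x) \in unitmx by rewrite unitmx_inv.
by rewrite e1; apply: mulmx1_inv; rewrite -dual_mxM // mulmxV.
Qed.

Lemma embGL_Uset (g : 'M[K * K]_m) : unitary_group beta g -> Uset beta0 beta (embGL r g).
Proof.
move=> gU; have [bu bH] := Hb.
have /(unitary_groupP _ bu bH)[g1u g2] := gU.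
apply/(UsetP b00 Hb); rewrite fst_embGL snd_embGL levi_unit //; split=> //.
apply/dual_mx_eq => //; first exact: levi_unit.
rewrite levi_tr g2 levi_form; congr form.
by rewrite /dual_mx trmxK mulmxKV ?Her_fst_unit // mulmxKV.
Qed.

Section Orb.
Variables (F f : 'M[K * K]_n -> R[i]) (c : R) (z : 'M[K * K]_n).
Hypothesis fE : forall x, Uset beta0 beta x -> f x = c%:C * F (U_to_S x).
Hypothesis Uz : Uset beta0 beta z.
Let y := map_mx fst z.

Lemma U_integrand (g : 'M[K * K]_m) (u1 u2 : 'M[K * K]_n) : unitary_group beta g ->
  Uprime beta0 beta u1 -> Uprime beta0 beta u2 ->
  f (invmx (embGL r g) *m invmx u1 *m z *m u2 *m embGL r g) *
    psiU' psi' jm (invmx u1 *m u2) =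
  c%:C * ofun (on_GL F) y (map_mx fst g) (map_mx fst u1, map_mx fst u2).
Proof.
move=> gU Hu1 Hu2; have [gu _] := gU.
have [u1U u1R] := Hu1; have [u2U u2R] := Hu2.
have u1u : u1 \in unitmx := Nset_unit u1R.
have wU : Uprime beta0 beta (invmx u1 *m u2).
  by split; [apply: UsetM => //; exact: UsetV|apply: NsetM => //; exact: NsetV].
have /UradP[N1 _] := u1R; have /UradP[N2 _] := u2R.
have eU := embGL_Uset gU.
set X := _ *m embGL r g.
have UX : Uset beta0 beta X.
  by do 4?[apply: UsetM => //]; apply: UsetV.
rewrite fE // (on_GLE F (U_to_S_Sset UX)) fst_pairmx.
have X1 : map_mx fst X = orbit_arg y (map_mx fst g) (map_mx fst u1, map_mx fst u2).
  rewrite /X !fst_mulmx fst_invmx ?embGL_unit // fst_embGL fst_invmx //.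
  by rewrite /orbit_arg leviV // fst_unit.
rewrite X1 (psiU'_E Hb wU) fst_mulmx fst_invmx // lamM //; last exact: NsetV.
by rewrite lamV // addrC /orbit_fun /orbit_char /= mulrA.
Qed.

Lemma orbU_E (muUm : {measure set (borel 'M[K * K]_m) -> \bar R})
    (muU' : {measure set (borel 'M[K * K]_n) -> \bar R}) :
  orbU beta0 psi' jm beta muUm muU' f z =
  Rintegral muUm (unitary_group beta) (fun g =>
    Rintegral muU' (Uprime beta0 beta) (fun u1 =>
      Rintegral muU' (Uprime beta0 beta) (fun u2 =>
        c * complex.Re (ofun (on_GL F) y (map_mx fst g) (map_mx fst u1, map_mx fst u2))))) +i*
  Rintegral muUm (unitary_group beta) (fun g =>
    Rintegral muU' (Uprime beta0 beta) (fun u1 =>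
      Rintegral muU' (Uprime beta0 beta) (fun u2 =>
        c * complex.Im (ofun (on_GL F) y (map_mx fst g) (map_mx fst u1, map_mx fst u2))))).
Proof.
have ReZ (x : R[i]) : complex.Re (c%:C * x) = c * complex.Re x.
  by case: x => p q; rewrite /= mul0r subr0.
have ImZ (x : R[i]) : complex.Im (c%:C * x) = c * complex.Im x.
  by case: x => p q; rewrite /= mul0r addr0.
rewrite /orbU; apply: CintegralP; apply: eq_Rint => g gU.
  rewrite Re_Cintegral; apply: eq_Rint => u1 U1; rewrite Re_Cintegral.
  by apply: eq_Rint => u2 U2; rewrite U_integrand // ReZ.
rewrite Im_Cintegral; apply: eq_Rint => u1 U1; rewrite Im_Cintegral.
by apply: eq_Rint => u2 U2; rewrite U_integrand // ImZ.
Qed.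
End Orb.
End U.
End Unfold.

(** * Comparison and smooth matching *)

Section Comparison.
Variables (R : realType) (K : topFieldType) (v : K -> R).
Hypotheses (vP : topological_abs v) (lcK : locally_compact [set: K]).
Variables (m r : nat) (beta0 : K) (jm : K * K) (psi' : K -> R[i]).
Hypotheses (b00 : beta0 != 0) (hpsi : additive_character psi').
Local Notation n := (ndim m r).

(** The data (Pr, t) of an element in normal form are the ones it is built from, so
    matching says that the two normal forms are conjugate under GL_m(k). *)
Lemma matching_conj (beta : 'M[K * K]_m) (zeta zetab : 'M[K * K]_n) : Her beta ->
  in_normal_form zeta -> in_normal_form zetab -> matching beta0 beta zeta zetab ->
  exists2 g : 'M[K]_m, g \in unitmx &
    map_mx fst zetab = levi r (invmx g) *m map_mx fst zeta *m levi r g.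
Proof.
move=> Hb [xi [t [tu ->]]] [xi' [t' [tu' ->]]] [].
rewrite /tS /tU /PrS /PrU normal_data_S // normal_data_U //= => -> [g gu ->].
have g1u := fst_unit gu.
exists (invmx (map_mx fst g)); first by rewrite unitmx_inv.
have E := normal_form_conj xi' t' (mulVmx gu).
have bV : invmx (block_mx g 0 0 1%:M) = block_mx (invmx g) 0 0 1%:M :> 'M[K * K]_(m + 1).
  have H (a b : 'M[K * K]_m) : a *m b = 1%:M ->
      block_mx a 0 0 1%:M *m block_mx b 0 0 1%:M = 1%:M :> 'M[K * K]_(m + 1).
    by move=> ab; rewrite mulmx_block !(mulmx0, mul0mx, addr0, add0r, mul1mx) ab -scalar_mx_block.
  exact/mulmx1_inv/H/mulmxV.
rewrite bV -E !fst_mulmx !fst_embGL fst_invmx // invmxK !mulmxA.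
by rewrite -leviM mulmxV // levi1 mul1mx -mulmxA -leviM mulmxV // levi1 mulmx1.
Qed.

Lemma normal_form_antidiag_map (f : {rmorphism K * K -> K}) (z : 'M[K * K]_n) :
  in_normal_form z -> antidiag (map_mx f z).
Proof.
by move=> [xi [t [_ ->]]] i j ij; rewrite mxE (normal_form_antidiag xi t ij) rmorph0.
Qed.

(** The constant is the ratio of the factors by which the given measures differ
    from one choice of Haar measures on GL_m(K) and N; it does not depend on the
    functions nor on the elements. *)
Lemma orbital_integrals_eq (beta : 'M[K * K]_m)
    (muGL : {measure set (borel 'M[K]_m) -> \bar R})
    (muU : {measure set (borel 'M[K * K]_n) -> \bar R})
    (muUm : {measure set (borel 'M[K * K]_m) -> \bar R})
    (muU' : {measure set (borel 'M[K * K]_n) -> \bar R}) :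
  Her beta ->
  haar_measure (fun x y : 'M[K]_m => x *m y) (@GLset K m) muGL ->
  haar_measure (fun x y : 'M[K * K]_n => x *m y) (@Urad K m r) muU ->
  haar_measure (fun x y : 'M[K * K]_m => x *m y) (unitary_group beta) muUm ->
  haar_measure (fun x y : 'M[K * K]_n => x *m y) (@Uprime K m r beta0 beta) muU' ->
  exists2 c : R, 0 < c & forall (F f : 'M[K * K]_n -> R[i]) zeta zetab,
    Cc_smooth (@Sset K m r) F ->
    (forall x, Uset beta0 beta x -> f x = c%:C * F (U_to_S beta0 beta x)) ->
    Sset zeta -> in_normal_form zeta ->
    Uset beta0 beta zetab -> in_normal_form zetab ->
    matching beta0 beta zeta zetab ->
    orbS beta0 psi' jm muGL muU F zeta =
    orbU beta0 psi' jm beta muUm muU' f zetab.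
Proof.
move=> Hb hGL hU hUm hU'.
have [ga hga gaE] := haar_GL vP lcK hGL.
have [nu hnu [c2 c20 c2E]] := orbital_fiber_U vP lcK b00 Hb hUm hU' hga.
have [c1 c10 c1E] := orbital_fiber_S vP lcK hnu hU gaE.
have c0 : 0 < c1 / c2 by exact: divr_gt0.
exists (c1 / c2) => // F f zeta zetab [sF cF] fE Sz nz Uz nzb mat.
have [g0 g0u zbE] := matching_conj Hb nz nzb mat.
have [C [cC CGL Csupp]] := on_GL_support cF.
have /SsetP[yu z2E] := Sz.
have [aR aI] := orbit_fun_admissible (Ft := on_GL F) vP beta0 jm.1 hpsi
  (on_GL_continuous vP sF) cC CGL Csupp yu z2E
  (normal_form_antidiag_map fst nz) (normal_form_antidiag_map snd nz).
rewrite (orbS_E beta0 jm psi' F Sz) (orbU_E jm psi' b00 Hb fE Uz).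
have E g a b : g \in unitmx -> Nset a -> Nset b ->
    orbit_fun beta0 jm.1 psi' (on_GL F) (map_mx fst zetab) g (a, b) =
    orbit_fun beta0 jm.1 psi' (on_GL F) (map_mx fst zeta) (g0 *m g) (conjL g0 a, conjL g0 b).
  move=> gu Na Nb; rewrite /orbit_fun orbit_char_conj; congr (on_GL F _ * _).
  by rewrite zbE orbit_arg_conj // Nset_unit.
have cc : c1 / c2 * c2 = c1 by rewrite mulfVK // gt_eqF.
congr (_ +i* _).
  apply: etrans (c1E _ aR) _; rewrite -[in LHS]cc -mulrA; apply/esym; apply: (c2E _
    (fun h p => c1 / c2 * complex.Re (orbit_fun beta0 jm.1 psi' (on_GL F) (map_mx fst zetab) h p))
    _ g0 aR) => // g a b gu Na Nb.
  by rewrite E.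
apply: etrans (c1E _ aI) _; rewrite -[in LHS]cc -mulrA; apply/esym; apply: (c2E _
  (fun h p => c1 / c2 * complex.Im (orbit_fun beta0 jm.1 psi' (on_GL F) (map_mx fst zetab) h p))
  _ g0 aI) => // g a b gu Na Nb.
by rewrite E.
Qed.

End Comparison.

Theorem corollary4p13 (R : realType) (K : topFieldType)
    (hK : local_field R K)
    (m r : nat) (hn : odd (m + 2 * r + 1)%N)
    (beta0 : K) (hbeta0 : beta0 != 0)
    (jm : K * K) (hjm : jm \is a GRing.unit) (hjmtau : tau jm = - jm)
    (psi' : K -> R[i]) (hpsi : additive_character psi')
    (hpsi1 : exists x, psi' x <> 1)
    (reps : set 'M[K * K]_m) (hreps : Her_representatives reps)
    (muGL : {measure set (borel 'M[K]_m) -> \bar R})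
    (hmuGL : haar_measure (fun x y : 'M[K]_m => x *m y) (@GLset K m) muGL)
    (muU : {measure set (borel 'M[K * K]_(ndim m r)) -> \bar R})
    (hmuU : haar_measure (fun x y : 'M[K * K]_(ndim m r) => x *m y)
         (@Urad K m r) muU)
    (muUm : 'M[K * K]_m -> {measure set (borel 'M[K * K]_m) -> \bar R})
    (hmuUm : forall beta, reps beta ->
       haar_measure (fun x y : 'M[K * K]_m => x *m y)
         (unitary_group beta) (muUm beta))
    (muU' : 'M[K * K]_m ->
       {measure set (borel 'M[K * K]_(ndim m r)) -> \bar R})
    (hmuU' : forall beta, reps beta ->
       haar_measure (fun x y : 'M[K * K]_(ndim m r) => x *m y)
         (@Uprime K m r beta0 beta)
         (muU' beta)) :
  let smooth_matching (F : 'M[K * K]_(ndim m r) -> R[i])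
      (f : 'M[K * K]_m -> 'M[K * K]_(ndim m r) -> R[i]) : Prop :=
    forall (zeta : 'M[K * K]_(ndim m r)) (beta : 'M[K * K]_m)
        (zetab : 'M[K * K]_(ndim m r)),
      Sreg zeta -> in_normal_form zeta ->
      reps beta ->
      Ureg beta0 beta zetab -> in_normal_form zetab ->
      matching beta0 beta zeta zetab ->
      orbS beta0 psi' jm muGL muU F zeta =
      transfer R zeta *
        orbU beta0 psi' jm beta (muUm beta) (muU' beta) (f beta) zetab
  in
  (forall F : 'M[K * K]_(ndim m r) -> R[i],
     Cc_smooth (@Sset K m r) F ->
     exists f : 'M[K * K]_m -> 'M[K * K]_(ndim m r) -> R[i],
       (forall beta, reps beta -> Cc_smooth (Uset beta0 beta) (f beta)) /\
       smooth_matching F f)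
  /\
  (forall f : 'M[K * K]_m -> 'M[K * K]_(ndim m r) -> R[i],
     (forall beta, reps beta -> Cc_smooth (Uset beta0 beta) (f beta)) ->
     exists2 F : 'M[K * K]_(ndim m r) -> R[i],
       Cc_smooth (@Sset K m r) F & smooth_matching F f).
Proof.
move=> smooth_matching.
have [v vP lcK] := local_field_abs hK.
have [HerB rep1] := hreps.
have Hb beta : reps beta -> Her beta by exact: HerB.
have ex beta : exists c : R, reps beta -> 0 < c /\
    forall (F f : 'M[K * K]_(ndim m r) -> R[i]) zeta zetab,
    Cc_smooth (@Sset K m r) F ->
    (forall x, Uset beta0 beta x -> f x = c%:C * F (U_to_S beta0 beta x)) ->
    Sset zeta -> in_normal_form zeta ->
    Uset beta0 beta zetab -> in_normal_form zetab ->
    matching beta0 beta zeta zetab ->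
    orbS beta0 psi' jm muGL muU F zeta =
    orbU beta0 psi' jm beta (muUm beta) (muU' beta) f zetab.
  have [rb|nrb] := pselect (reps beta); last by exists 1.
  have [c c0 cE] := orbital_integrals_eq vP lcK jm hbeta0 hpsi (Hb _ rb)
    hmuGL hmuU (hmuUm _ rb) (hmuU' _ rb).
  by exists c.
have [c cE] := choice ex.
split=> [F sF|f sf].
  exists (fun beta x => (c beta)%:C * F (U_to_S beta0 beta x)); split=> [beta rb|].
    apply: (Cc_smooth_comp (Q := S_to_U beta0 beta) _ _ _ _ _ _ sF) => [||x|x|x _];
      try exact: (swap_form_klinear vP).
    - exact: (U_to_S_Sset hbeta0 (Hb _ rb)).
    - exact: (S_to_U_Uset hbeta0 (Hb _ rb)).
    - exact: (U_to_SK hbeta0 (Hb _ rb)).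
  move=> zeta beta zetab [Sz _ _] nz rb [Uz _ _] nzb mat.
  have [_ H] := cE _ rb.
  by rewrite /transfer /Defs.eta mul1r; apply: (H F).
(* all hermitian matrices being equivalent, there is a single representative b1 *)
have H1 : Her (1%:M : 'M[K * K]_m).
  split; first exact: unitmx1.
  by apply: mxpairP; rewrite ?fst_tr ?snd_tr ?fst_taumx ?snd_taumx ?fst_mx1 ?snd_mx1 trmx1.
have [b1 [[rb1 _] b1u]] := rep1 _ H1.
have [c1 H] := cE _ rb1.
have sF : Cc_smooth (@Sset K m r) (fun s => ((c b1)^-1)%:C * f b1 (S_to_U beta0 b1 s)).
  apply: (Cc_smooth_comp (Q := U_to_S beta0 b1) _ _ _ _ _ _ (sf _ rb1)) => [||x|x|x _];
    try exact: (swap_form_klinear vP).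
  - exact: (S_to_U_Uset hbeta0 (Hb _ rb1)).
  - exact: (U_to_S_Sset hbeta0 (Hb _ rb1)).
  - exact: (S_to_UK hbeta0 (Hb _ rb1)).
exists (fun s => ((c b1)^-1)%:C * f b1 (S_to_U beta0 b1 s)) => //.
move=> zeta beta zetab [Sz _ _] nz rb [Uz _ _] nzb mat.
have eb : b1 = beta by apply: b1u; split=> //; exact: Her_one_class (Hb _ rb).
rewrite -eb in Uz mat *.
rewrite /transfer /Defs.eta mul1r; apply: H => //.
move=> x _; rewrite (U_to_SK hbeta0 (Hb _ rb1)) mulrA -rmorphM /= mulfV ?mul1r //.
by rewrite gt_eqF.
Qed.
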